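(* Let $k$ be a positive integer and let $P_k(x)$ be the polynomial of degree $k^2$ defined below. Write $$P_k(x)=c_0(k)x^{k^2}+c_1(k)x^{k^2-1}+\cdots+c_{k^2}(k).$$ Then for every $0\le r\le k^2$, $$c_r(k)=a_k\prod_{l=0}^{k-1}\frac{l!}{(k+l)!}\sum_{|\alpha|+|\beta|=r}2^{1-\delta(\alpha;\beta)}\,b_k(\alpha;\beta)\,N_k(\alpha;\beta),$$ where the sum runs over all pairs $(\alpha;\beta)$ of partitions with at most $k$ parts each, with $|\alpha|+|\beta|=r$ and $\alpha\ge\beta$ in lexicographic order (each pair is counted once). Here $\delta(\alpha;\beta)=1$ if $\alpha=\beta$ and $0$ otherwise.
   Context: Notation: $e(\theta)=\exp(2\pi i\theta)$; $\Delta(z_1,\dots,z_m)=\prod_{1\le i<j\le m}(z_j-z_i)$; $\zeta$ is the Riemann zeta function. For a positive integer $k$ define, for $z=(z_1,\dots,z_{2k})$ near $0$, the Euler product $$A_k(z)=\prod_p\prod_{i,j=1}^k\bigl(1-p^{-1-z_i+z_{k+j}}\bigr)\int_0^1\prod_{j=1}^k\Bigl(1-\tfrac{e(\theta)}{p^{1/2+z_j}}\Bigr)^{-1}\Bigl(1-\tfrac{e(-\theta)}{p^{1/2-z_{k+j}}}\Bigr)^{-1}d\theta,$$ let $G(z)=A_k(z)\prod_{i,j=1}^k\zeta(1+z_i-z_{j+k})$, and $$P_k(x)=\frac{(-1)^k}{k!^2}\frac{1}{(2\pi i)^{2k}}\oint\cdots\oint\frac{G(z)\Delta(z_1,\dots,z_{2k})^2}{\prod_{i=1}^{2k}z_i^{2k}}e^{\frac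 x2\sum_{i=1}^k(z_i-z_{i+k})}\,dz_1\cdots dz_{2k},$$ integrating over small circles about $z_i=0$. Let $a_k=\prod_p(1-p^{-1})^{k^2}\,{}_2F_1(k,k;1;1/p)$ (Gauss hypergeometric function); $a_k=A_k(0,\dots,0)$. $b_k(\alpha;\beta)$: for $k$-tuples $\alpha=(\alpha_1,\dots,\alpha_k)$, $\beta=(\beta_1,\dots,\beta_k)$ of nonnegative integers, $b_k(\alpha;\beta)$ is the coefficient of $z_1^{\alpha_1}\cdots z_k^{\alpha_k}z_{k+1}^{\beta_1}\cdots z_{2k}^{\beta_k}$ in the Taylor series at $0$ of $$\frac{1}{a_k}A_k(z_1,\dots,z_{2k})\prod_{1\le i,j\le k}(z_i-z_{j+k})\zeta(1+z_i-z_{j+k}).$$ A partition with at most $k$ parts is identified with the nonincreasing $k$-tuple obtained by padding with zeros; $|\alpha|=\sum_i\alpha_i$. $\tilde M_k$: for $k$-tuples $a=(a_1,\dots,a_k)$, $b=(b_1,\dots,b_k)$ of nonnegative integers, $\tilde M_k(a,b)=(-1)^{\sum_i b_i}\det(m_{ij})_{1\le i,j\le 2k}$, where for $1\le i\le k$, $1\le j\le 2k$: $m_{ij}=\Gamma(2k-i-j+2-a_i)^{-1}$ and $m_{k+i,j}=(-1)^{i+j-1}\Gamma(2k-i-j+2-b_i)^{-1}$, with the convention $1/\Gamma(m)=0$ for $m\in\{0,-1,-2,\dots\}$. $N_k$: for partitions $\alpha,\beta$ with at most $k$ parts and $r=|\alpha|+|\beta|$, $$N_k(\alpha;\beta)=\frac{1}{2^{k^2-r}}\Bigl(\prod_{l=0}^{k-1}\frac{l!}{(k+l)!}\Bigr)^{-1}\sum_{\sigma(\alpha),\tau(\beta)}\tilde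 M_k(\sigma(\alpha),\tau(\beta)),$$ where the sum runs over all distinct rearrangements $\sigma(\alpha)=(\alpha_{\sigma_1},\dots,\alpha_{\sigma_k})$ of the $k$-tuple $\alpha$ and $\tau(\beta)$ of $\beta$ (two rearrangements are the same if they give the same $k$-tuple). *)

(* Defs.v *)
From mathcomp Require Import all_boot all_algebra.
From mathcomp Require Import Rstruct.
From Stdlib Require Import Reals ClassicalEpsilon.

Set Implicit Arguments.
Unset Strict Implicit.
Unset Printing Implicit Defensive.

Fixpoint lists_upto (n m : nat) : seq (seq nat) :=
  match n with
  | 0 => [:: [::]]
  | n'.+1 => [seq x :: s | x <- iota 0 m.+1, s <- lists_upto n' m]
  end.

Fixpoint lex_ge (a b : seq nat) : bool :=
  match a, b with
  | x :: a', y :: b' => ltn y x || ((x == y) && lex_ge a' b')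
  | _, _ => true
  end.

(* A partition with at most k parts is identified with a nonincreasing
   k-tuple of naturals (padded with zeros): a list of size k, sorted by >=. *)
Definition is_partition_k (k : nat) (a : seq nat) : bool :=
  (size a == k) && sorted geq a.

Definition index_pairs (k r : nat) : seq (seq nat * seq nat) :=
  [seq ab <- [seq (a, b) | a <- lists_upto k r, b <- lists_upto k r]
     | [&& is_partition_k k ab.1, is_partition_k k ab.2,
           sumn ab.1 + sumn ab.2 == r & lex_ge ab.1 ab.2]].

Section RealCombinatorics.
Local Open Scope ring_scope.

(* 1/Gamma(m) for an integer m, with 1/Gamma(m) = 0 for m = 0,-1,-2,...;
   for m >= 1, Gamma(m) = (m-1)! *)
Definition invGamma (m : int) : R :=
  match m with
  | Posz (n.+1) => ((n`!)%:R)^-1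
  | _ => 0
  end.

Definition Mmat (k : nat) (a b : seq nat) : 'M[R]_(2 * k) :=
  \matrix_(i < 2 * k, j < 2 * k)
    let i' := nat_of_ord i in
    let j' := nat_of_ord j in
    let i2 := subn i' k in
    if ltn i' k then
      invGamma (Posz (2 * k) - Posz i' - Posz j' - Posz (nth O a i'))
    else
      (-1) ^+ (addn (addn i2 j') 1) *
      invGamma (Posz (2 * k) - Posz i2 - Posz j' - Posz (nth O b i2)).

Definition Mtilde (k : nat) (a b : seq nat) : R :=
  (-1) ^+ (sumn b) * \det (Mmat k a b).

Definition prodfact (k : nat) : R :=
  \prod_(l < k) ((l`!)%:R / ((addn k l)`!)%:R).

(* N_k(alpha;beta); [permutations s] is the duplicate-free list of all
   distinct rearrangements of s *)
Definition Nk (k : nat) (a b : seq nat) : R :=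
  let r := addn (sumn a) (sumn b) in
  ((2%:R ^+ (subn (muln k k) r))^-1) * (prodfact k)^-1 *
  \sum_(s <- permutations a) \sum_(t <- permutations b) Mtilde k s t.

End RealCombinatorics.

From Coquelicot Require Import Coquelicot.
Local Open Scope R_scope.

Definition Csum {T : Type} (l : seq T) (f : T -> C) : C :=
  foldr (fun i acc => Cplus (f i) acc) (RtoC 0) l.
Definition Cprod (l : seq nat) (f : nat -> C) : C :=
  foldr (fun i acc => Cmult (f i) acc) (RtoC 1) l.

Definition ce (t : R) : C := (cos (2 * PI * t), sin (2 * PI * t)).
Definition Cexp (z : C) : C :=
  (exp (Re z) * cos (Im z), exp (Re z) * sin (Im z)).
Definition Cpowr (p : R) (s : C) : C := Cexp (Cmult s (RtoC (ln p))).

Definition climit (u : nat -> C) : C :=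
  epsilon (inhabits (RtoC 0)) (fun L => filterlim u eventually (locally L)).

(* Riemann zeta function on Re s > 0, s <> 1 (analytic continuation), via
   the Dirichlet eta function eta(s) = sum_{n>=1} (-1)^(n-1) n^(-s),
   zeta(s) = eta(s) / (1 - 2^(1-s)). *)
Definition eta (s : C) : C :=
  climit (fun N => Csum (seq.iota 0 N)
    (fun n => Cmult (RtoC ((-1) ^ n)) (Cpowr (INR n.+1) (Copp s)))).
Definition zeta (s : C) : C :=
  Cdiv (eta s) (Cminus (RtoC 1) (Cpowr 2 (Cminus (RtoC 1) s))).

Definition primes_below (N : nat) : seq nat := [seq p <- seq.iota 0 N | prime p].

(* local factor of A_k at the prime p; z i stands for z_{i+1} *)
Definition local_factor (k p : nat) (z : nat -> C) : C :=
  Cmult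
   (Cprod (seq.iota 0 k) (fun i => Cprod (seq.iota 0 k) (fun j =>
      Cminus (RtoC 1)
        (Cpowr (INR p) (Cplus (Cminus (RtoC (-1)) (z i)) (z (k + j)%nat))))))
   (@RInt C_R_CompleteNormedModule (fun th : R => Cprod (seq.iota 0 k) (fun j =>
      Cmult
        (Cinv (Cminus (RtoC 1) (Cdiv (ce th) (Cpowr (INR p) (Cplus (RtoC (1/2)) (z j))))))
        (Cinv (Cminus (RtoC 1)
                 (Cdiv (ce (- th)) (Cpowr (INR p) (Cminus (RtoC (1/2)) (z (k + j)%nat)))))))) 0 1).

Definition Ak (k : nat) (z : nat -> C) : C :=
  climit (fun N => Cprod (primes_below N) (fun p => local_factor k p z)).

Fixpoint rising (a : R) (n : nat) : R :=
  match n with 0 => 1 | n'.+1 => rising a n' * (a + INR n') end.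
Definition hyp2F1 (a b c x : R) : R :=
  Series (fun n => rising a n * rising b n / (rising c n * INR (factorial n)) * x ^ n).

Definition ak (k : nat) : C :=
  climit (fun N => Cprod (primes_below N) (fun p =>
    RtoC ((1 - / INR p) ^ (k * k) * hyp2F1 (INR k) (INR k) 1 (/ INR p)))).

Definition Gfun (k : nat) (z : nat -> C) : C :=
  Cmult (Ak k z) (Cprod (seq.iota 0 k) (fun i => Cprod (seq.iota 0 k) (fun j =>
     zeta (Cminus (Cplus (RtoC 1) (z i)) (z (k + j)%nat))))).

Definition Vandermonde (n : nat) (z : nat -> C) : C :=
  Cprod (seq.iota 0 n) (fun j => Cprod (seq.iota 0 j) (fun i => Cminus (z j) (z i))).

Definition upd (w : nat -> C) (n : nat) (v : C) : nat -> C :=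
  fun i => if i == n then v else w i.

(* iterated contour integral over the circles |z_i| = rho i (i < n),
   each parametrized by z_i = rho_i e(t), t in [0,1], dz_i = 2 pi i z_i dt *)
Fixpoint circle_int (n : nat) (rho : nat -> R) (F : (nat -> C) -> C) : C :=
  match n with
  | 0 => F (fun _ => RtoC 0)
  | n'.+1 =>
      @RInt C_R_CompleteNormedModule (fun t : R =>
        let zt := Cmult (RtoC (rho n')) (ce t) in
        circle_int n' rho (fun w =>
          Cmult (F (upd w n' zt)) (Cmult (Cmult (RtoC (2 * PI)) Ci) zt))) 0 1
  end.

Definition Pk (k : nat) (rho : nat -> R) (x : R) : C :=
  Cmult (RtoC ((-1) ^ k / (INR (factorial k) ^ 2)))
  (Cmult (Cinv (Cpow (Cmult (RtoC (2 * PI)) Ci) (2 * k)))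
   (circle_int (2 * k) rho (fun z =>
     Cmult (Cdiv (Cmult (Gfun k z) (Cpow (Vandermonde (2 * k) z) 2))
                 (Cprod (seq.iota 0 (2 * k)) (fun i => Cpow (z i) (2 * k))))
       (Cexp (Cmult (RtoC (x / 2))
                (Csum (seq.iota 0 k) (fun i => Cminus (z i) (z (i + k)%nat)))))))).

Fixpoint comps (n d : nat) : seq (seq nat) :=
  match n with
  | O => if d == O then [:: [::]] else [::]
  | n'.+1 => [seq x :: s | x <- seq.iota 0 d.+1, s <- comps n' (d - x)%nat]
  end.

Definition monom (m : seq nat) (z : nat -> C) : C :=
  Cprod (seq.iota 0 (size m)) (fun i => Cpow (z i) (nth O m i)).

(* c is the family of Taylor coefficients at 0 of f (a function of the n
   variables z 0, ..., z (n-1)), f being defined at the points satisfying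
   [dom]: on a neighbourhood of 0 (intersected with dom) the Taylor series
   sum_m c_m z^m converges to f(z) (summed by total degree). *)
Definition is_taylor_expansion (n : nat) (dom : (nat -> C) -> Prop)
  (f : (nat -> C) -> C) (c : seq nat -> C) : Prop :=
  exists eps : R, 0 < eps /\
    forall z : nat -> C, (forall i, (i < n)%nat -> Cmod (z i) < eps) -> dom z ->
      filterlim (fun D => Csum (seq.iota 0 D) (fun d =>
                   Csum (comps n d) (fun m => Cmult (c m) (monom m z))))
                eventually (locally (f z)).

Definition taylor_coeff (n : nat) (dom : (nat -> C) -> Prop)
  (f : (nat -> C) -> C) (m : seq nat) : C :=
  epsilon (inhabits (fun _ : seq nat => RtoC 0)) (is_taylor_expansion n dom f) m.

Definition off_diag (k : nat) (z : nat -> C) : Prop :=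
  forall i j, (i < k)%nat -> (j < k)%nat -> z i <> z (k + j)%nat.

Definition bk (k : nat) (a b : seq nat) : C :=
  taylor_coeff (2 * k) (off_diag k)
    (fun z => Cmult (Cmult (Cinv (ak k)) (Ak k z))
       (Cprod (seq.iota 0 k) (fun i => Cprod (seq.iota 0 k) (fun j =>
          Cmult (Cminus (z i) (z (k + j)%nat))
                (zeta (Cminus (Cplus (RtoC 1) (z i)) (z (k + j)%nat)))))))
    (a ++ b).

(* Main.v *)
(* On a small closed polydisc the functions A_k(z) and s zeta(1 + s) are uniform limits of polynomials:
   for A_k, averaging the second-order expansion of the integrand over theta shows that the p-th local factor
   is 1 + O(p^{-5/4}); for zeta, group the terms of the eta series in pairs and divide by (1 - 2^{-s}) / s.
   Such limits have Taylor coefficients that are torus averages independent of the radii, so that averaging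
   over a torus picks out the coefficients b_k. On the torus G Delta^2 is, up to the sign (-1)^k, the product
   of a_k times the generating function of b_k with Delta(z_1, .., z_2k) Delta(z_1, .., z_k)
   Delta(z_{k+1}, .., z_2k); where z_i = z_{k+j} both sides vanish, whatever the junk value of zeta at 1.
   Expanding the Vandermonde determinants and extracting coefficients gives the determinants of reciprocal
   Gamma values. Finally b_k and the determinant sums are symmetric in alpha, in beta, and (with signs that
   cancel) under the exchange of alpha and beta, which groups the tuples into pairs of partitions with
   weight 2^{1 - delta}. *)
Require Import Defs.
From HB Require Import structures.
From mathcomp Require Import all_boot all_algebra.
From mathcomp Require Import fingroup perm Rstruct zify.
From Stdlib Require Import Reals Lra Classical FunctionalExtensionality ClassicalEpsilon.
From Coquelicot Require Import Coquelicot.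
Local Open Scope R_scope.

Delimit Scope ring_scope with ring.

Import GRing.Theory.

(** The limits, integrals and Taylor coefficients of the statement are total functions with
    arbitrary values where nothing converges, so each can be used only after an existence proof.
    Hence limits, integrals and torus averages are treated as relations ([Ccv], [cint], [is_cavg]),
    and limits carry an explicit null sequence as rate, which survives iterated integration. No
    complex differentiation is involved: for monomials the averages are orthogonality of characters,
    and uniform approximation by polynomials extends this to all functions at hand. The radius 1/48
    keeps every difference z_i - z_{k+j} in |s| <= 1/24, where s zeta(1 + s) is controlled, and
    every z_j well inside |s| <= 1/12, where p^{-1/2 - s} is bounded by p^{-5/12}, whose cube
    p^{-5/4} is summable. The expansion that defines b_k is only prescribed off the diagonals z_i =
    z_{k+j}; its uniqueness is therefore tested on a torus with pairwise different radii. Since b_k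
    is normalised by 1/a_k, the value a_k must be shown nonzero. The prefactor 1/k!^2 of P_k cancels
    because the k!^2 pairs of terms of the two small Vandermonde determinants contribute equally. *)

Ltac Cring := rewrite ?/GRing.mul ?/GRing.add ?/GRing.one ?/GRing.zero /=;
  match goal with |- @eq _ ?a ?b => change (@eq C a b) end; ring.

(** * The complex numbers as a commutative ring; finite sums and products *)

HB.instance Definition _ := Choice.copy C (R * R)%type.

Lemma Cplus_opp_l : left_inverse (RtoC 0) Copp Cplus.
Proof. by move=> x; rewrite Cplus_comm Cplus_opp_r. Qed.

Lemma C1_neq0 : RtoC 1 != RtoC 0.
Proof. by apply/eqP => -[]; lra. Qed.

HB.instance Definition _ :=
  GRing.isZmodule.Build C Cplus_assoc Cplus_comm Cplus_0_l Cplus_opp_l.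
HB.instance Definition _ := GRing.Zmodule_isComNzRing.Build C
  Cmult_assoc Cmult_comm Cmult_1_l Cmult_plus_distr_r C1_neq0.

Lemma CsumE (T : Type) (l : seq T) (f : T -> C) : Csum l f = (\sum_(i <- l) f i)%ring.
Proof. by rewrite unlock. Qed.

Lemma CprodE (l : seq nat) (f : nat -> C) : Cprod l f = (\prod_(i <- l) f i)%ring.
Proof. by rewrite unlock. Qed.

Lemma CmultE (x y : C) : (x * y)%C = (x * y)%ring. Proof. by []. Qed.
Notation nsum n := (Csum (seq.iota 0 n)).
Notation nprod n := (Cprod (seq.iota 0 n)).

Lemma mem_iota0 n i : (i \in seq.iota 0 n) = (i < n)%nat.
Proof. by rewrite mem_iota. Qed.

Lemma Csum_recr n (f : nat -> C) :
  nsum n.+1 f = (nsum n f + f n)%C.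
Proof. by rewrite !CsumE -addn1 iotaD big_cat /= big_seq1. Qed.

Lemma Cprod_recr n (f : nat -> C) :
  nprod n.+1 f = (nprod n f * f n)%C.
Proof. by rewrite !CprodE -addn1 iotaD big_cat /= big_seq1. Qed.

Lemma Cmod_minus_sym (x y : C) : Cmod (x - y) = Cmod (y - x).
Proof. by rewrite -Cmod_opp; congr Cmod; ring. Qed.

Lemma Cmod_triangle3 (x y z : C) : Cmod (x - z) <= Cmod (x - y) + Cmod (y - z).
Proof. by have := Cmod_triangle (x - y) (y - z); congr (Cmod _ <= _); ring. Qed.

Lemma Cmod_sum (T : eqType) (l : seq T) (f : T -> C) (b : T -> R) :
  (forall i, i \in l -> Cmod (f i) <= b i) ->
  Cmod (Csum l f) <= foldr (fun i s => b i + s) 0 l.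
Proof.
elim: l => [|a l IH] H /=; first by rewrite Cmod_0; lra.
apply: Rle_trans (Cmod_triangle _ _) _; apply: Rplus_le_compat.
  by apply: H; rewrite inE eqxx.
by apply: IH => i il; apply: H; rewrite inE il orbT.
Qed.

(** * Convergence with explicit rates *)

Definition Ccv (u : nat -> C) (L : C) : Prop :=
  forall eps, 0 < eps -> exists N, forall n, (N <= n)%nat -> Cmod (u n - L) < eps.

Lemma CcvP (u : nat -> C) (L : C) :
  filterlim u eventually (locally L) <-> Ccv u L.
Proof.
split=> [/filterlim_locally H eps e0|H].
(* The balls of [C] are squares; passing to the modulus costs a factor sqrt 2. *)
- have s0 : 0 < sqrt 2 by apply: sqrt_lt_R0; lra.
  have p : 0 < eps / sqrt 2 by apply: Rdiv_lt_0_compat.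
  have [N HN] := H (mkposreal _ p).
  exists N => n /leP Nn.
  have := C_NormedModule_mixin_compat2 L (u n) (mkposreal _ p) (HN n Nn).
  by rewrite /= (_ : sqrt 2 * (eps / sqrt 2) = eps) //; field; lra.
- apply/filterlim_locally => eps.
  have [N HN] := H eps (cond_pos eps).
  exists N => n /leP Nn.
  exact: (C_NormedModule_mixin_compat1 L (u n) eps (HN n Nn)).
Qed.

Lemma Ccv_unique u L L' : Ccv u L -> Ccv u L' -> L = L'.
Proof.
move=> /CcvP H /CcvP H'.
exact: (@filterlim_locally_unique _ _ C_NormedModule eventually _ u).
Qed.

(** Uniqueness of limits pins down the value chosen by [epsilon]. *)
Lemma climit_cv u L : Ccv u L -> climit u = L.
Proof.
move=> H; have /CcvP HL := epsilon_spec (inhabits (RtoC 0))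
  (fun L => filterlim u eventually (locally L)) (ex_intro _ L (proj2 (CcvP u L) H)).
exact: Ccv_unique HL H.
Qed.

Lemma Cmod_le_abs (z : C) : Cmod z <= Rabs (Re z) + Rabs (Im z).
Proof.
case: z => a b; rewrite /Re /Im {1}(_ : (a, b) = (RtoC a + Ci * RtoC b)%C) /=.
  by apply: Rle_trans (Cmod_triangle _ _) _; rewrite Cmod_mult Cmod_Ci !Cmod_R; lra.
by rewrite /RtoC /Cplus /Cmult /=; congr pair; ring.
Qed.

Lemma Im_le_Cmod (z : C) : Rabs (Im z) <= Cmod z.
Proof. exact: Rle_trans (Rmax_r _ _) (Rmax_Cmod z). Qed.

Lemma Ccauchy (u : nat -> C) :
  (forall eps, 0 < eps -> exists N, forall n m, (N <= n)%nat -> (N <= m)%nat ->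
     Cmod (u n - u m) < eps) -> exists L, Ccv u L.
Proof.
move=> H.
have cR : Cauchy_crit (fun n => Re (u n)).
  move=> eps e0; have [N HN] := H eps e0; exists N => n m /leP Nn /leP Nm.
  by apply: Rle_lt_trans (HN n m Nn Nm); apply: (re_le_Cmod (u n - u m)).
have cI : Cauchy_crit (fun n => Im (u n)).
  move=> eps e0; have [N HN] := H eps e0; exists N => n m /leP Nn /leP Nm.
  by apply: Rle_lt_trans (HN n m Nn Nm); apply: (Im_le_Cmod (u n - u m)).
have [a Ha] := Rcomplete.R_complete _ cR; have [b Hb] := Rcomplete.R_complete _ cI.
exists (a, b) => eps e0.
have [N HN] := Ha (eps / 2) ltac:(lra); have [M HM] := Hb (eps / 2) ltac:(lra).
exists (maxn N M) => n; rewrite geq_max => /andP[/leP Nn /leP Mn].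
apply: Rle_lt_trans (Cmod_le_abs _) _.
by have := HN n Nn; have := HM n Mn; rewrite /R_dist /Re /Im /=; rewrite /Rminus; lra.
Qed.

(** Null sequences used as error bounds. An estimate by such a rate can be uniform in parameters,
    and then passes unchanged through integrals and torus averages. *)
Definition vanishing (t : nat -> R) : Prop :=
  (forall n, 0 <= t n) /\
  forall eps, 0 < eps -> exists N, forall n, (N <= n)%nat -> t n < eps.

Lemma vanishing_scal K t : 0 <= K -> vanishing t -> vanishing (fun n => K * t n).
Proof.
move=> K0 [t0 H]; split=> [n|eps e0]; first exact: Rmult_le_pos.
have [N HN] := H (eps / (K + 1)) ltac:(apply: Rdiv_lt_0_compat; lra).
exists N => n Nn; have := HN n Nn => Hn.
have : (K + 1) * t n < eps.
  have -> : eps = (K + 1) * (eps / (K + 1)) by field; lra.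
  by apply: Rmult_lt_compat_l => //; lra.
by have := t0 n; lra.
Qed.

Lemma Ccv_vanishing u L t :
  vanishing t -> (forall n, Cmod (u n - L) <= t n) -> Ccv u L.
Proof.
move=> [_ Ht] H eps e0; have [N HN] := Ht eps e0.
by exists N => n Nn; apply: Rle_lt_trans (H n) (HN n Nn).
Qed.

Lemma telescoping_bound u t :
  (forall n, Cmod (u n.+1 - u n) <= t n - t n.+1) ->
  forall n m, (n <= m)%nat -> Cmod (u m - u n) <= t n - t m.
Proof.
move=> H n m /subnKC <-; elim: (m - n)%nat => [|d IH].
  by rewrite addn0 (_ : (u n - u n)%C = 0) ?Cmod_0; [lra|ring].
rewrite addnS; apply: Rle_trans (Cmod_triangle3 _ (u (n + d)%nat) _) _.
by have := H (n + d)%nat; lra.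
Qed.

(** The increments telescope, so [t] gives both the Cauchy property and the distance to the
    limit. *)
Lemma telescoping_cv u t : vanishing t ->
  (forall n, Cmod (u n.+1 - u n) <= t n - t n.+1) ->
  exists L, forall n, Cmod (u n - L) <= t n.
Proof.
move=> vt H; have [t0 Ht] := vt.
have tb := telescoping_bound _ _ H.
have [L HL] : exists L, Ccv u L.
  apply: Ccauchy => eps e0; have [N HN] := Ht eps e0.
  exists N => n m Nn Nm; case: (leqP n m) => [nm|/ltnW mn].
    by rewrite Cmod_minus_sym; have := tb n m nm; have := HN n Nn; have := t0 m; lra.
  by have := tb m n mn; have := HN m Nm; have := t0 n; lra.
exists L => n; apply: Rnot_lt_le => Hn.
have [N HN] := HL (Cmod (u n - L) - t n) ltac:(lra).
have := HN (maxn N n) (leq_maxl _ _).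
have := tb n (maxn N n) (leq_maxr _ _).
have := Cmod_triangle3 (u n) (u (maxn N n)) L; have := t0 (maxn N n).
by rewrite (Cmod_minus_sym (u n) (u _)); lra.
Qed.

(** Up to a shift, the integral of x^{-5/4} from n to infinity. The paired eta series and the Euler
    products are all controlled by this one sequence. *)
Definition tailmaj (n : nat) : R := 4 * Rpower (INR n + 1) (- / 4).

Lemma Rpower_pos x y : 0 < Rpower x y. Proof. exact: exp_pos. Qed.

(** With a and b the fourth roots of n + 1 and n + 2, the identity 1 = b^4 - a^4 = (b - a)(b +
    a)(b^2 + a^2) gives 4 b^3 (b - a) >= 1, whence 4/a - 4/b >= 1/(a b^4) >= b^{-5}. *)
Lemma tailmaj_diff n : Rpower (INR n + 2) (- (5 / 4)) <= tailmaj n - tailmaj n.+1.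
Proof.
rewrite /tailmaj S_INR !Rpower_Ropp.
have n0 := pos_INR n.
have ab : Rpower (INR n + 1) (/4) <= Rpower (INR n + 1 + 1) (/4).
  by apply: Rle_Rpower_l; lra.
have a0 := Rpower_pos (INR n + 1) (/4).
have e4 x : 0 < x -> Rpower x (/4) ^ 4 = x.
  by move=> x0; rewrite -Rpower_pow ?Rpower_mult; [rewrite /= (_ : / 4 * _ = 1) ?Rpower_1 //; field|exact: Rpower_pos].
have := e4 (INR n + 1) ltac:(lra); have := e4 (INR n + 1 + 1) ltac:(lra).
have -> : Rpower (INR n + 2) (5 / 4) = (INR n + 2) * Rpower (INR n + 1 + 1) (/4).
  rewrite (_ : 5 / 4 = 1 + / 4); last by field.
  rewrite Rpower_plus Rpower_1; last by lra.
  by rewrite (_ : INR n + 2 = INR n + 1 + 1) //; ring.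
move: (Rpower _ _) (Rpower (INR n + 1 + 1) _) a0 ab => a b a0 ab eb ea.
rewrite (_ : INR n + 2 = b ^ 4); last by lra.
have b0 : 0 < b by lra.
have d : (b - a) * ((b + a) * (b ^ 2 + a ^ 2)) = 1 by nra.
have sab : 0 < (b + a) * (b ^ 2 + a ^ 2) by apply: Rmult_lt_0_compat; nra.
have sb : (b + a) * (b ^ 2 + a ^ 2) <= 4 * b ^ 3.
  have -> : 4 * b ^ 3 = (2 * b) * (2 * b ^ 2) by ring.
  by apply: Rmult_le_compat; nra.
have lo : 1 <= (b - a) * (4 * b ^ 3) by rewrite -d; apply: Rmult_le_compat_l; lra.
have b4 : 0 < b ^ 4 * b by have := pow_lt b 4 b0; nra.
apply: (Rmult_le_reg_r (b ^ 4 * b)) => //.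
rewrite Rinv_l; last by lra.
have -> : (4 * / a - 4 * / b) * (b ^ 4 * b) = (b - a) * (4 * b ^ 3) * (b / a).
  by field; lra.
have : 1 <= b / a by apply: (Rmult_le_reg_r a) => //; rewrite /Rdiv Rmult_assoc Rinv_l; lra.
by nra.
Qed.

Lemma tailmaj_vanishing : vanishing tailmaj.
Proof.
split=> [n|eps e0]; first by have := Rpower_pos (INR n + 1) (- / 4); rewrite /tailmaj; lra.
have e4 : 0 < 4 / eps by apply: Rdiv_lt_0_compat; lra.
have p4 := Rpower_pos (4 / eps) 4.
have [N HN] := INR_unbounded (Rpower (4 / eps) 4).
exists N => n /leP /le_INR Nn.
rewrite /tailmaj Rpower_Ropp.
have H : 4 / eps < Rpower (INR n + 1) (/ 4).
  rewrite -[X in X < _](Rpower_1 _ e4) (_ : 1 = 4 * / 4); last by field.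
  by rewrite -Rpower_mult; apply: Rlt_Rpower_l; lra.
apply: (Rmult_lt_reg_r (Rpower (INR n + 1) (/ 4))); first exact: Rpower_pos.
rewrite Rmult_assoc Rinv_l; last by have := Rpower_pos (INR n + 1) (/ 4); lra.
have -> : 4 * 1 = eps * (4 / eps) by field; lra.
exact: Rmult_lt_compat_l.
Qed.

(** * Uniform limits of polynomials in a family of functions *)

Section UniformAlgebra.
Context {X I : Type}.
Implicit Types (D : X -> Prop) (g : I -> X -> C) (F G : X -> C).

(** The family [g] stays abstract because several occur: the coordinates on a polydisc, the
    coordinate of a disc, and coordinates together with e(theta) and e(-theta). *)
Inductive alg g : (X -> C) -> Prop :=
| alg_const c : alg g (fun=> c)
| alg_gen i : alg g (g i)
| alg_add F G : alg g F -> alg g G -> alg g (fun x => F x + G x)%C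
| alg_mul F G : alg g F -> alg g G -> alg g (fun x => F x * G x)%C.

(** The sup-norm closure of [alg g] on [D]. For bounded generators it is stable under products,
    inverses of functions near 1, exponentials and composition, and this takes the place of complex
    differentiability. *)
Definition unif D g F : Prop :=
  forall eps, 0 < eps -> exists2 P, alg g P & forall x, D x -> Cmod (F x - P x) <= eps.

Definition bounded_on D F : Prop := exists M, forall x, D x -> Cmod (F x) <= M.

Lemma bounded_onP D F : bounded_on D F -> exists2 M, 0 < M & forall x, D x -> Cmod (F x) <= M.
Proof.
case=> M H; exists (Rmax M 1); first by apply: Rlt_le_trans (Rmax_r M 1); lra.
by move=> x /H Hx; apply: Rle_trans Hx (Rmax_l M 1).
Qed.

Notation bounded_gens D g := (forall i, bounded_on D (g i)).

Lemma alg_bounded D g : bounded_gens D g -> forall P, alg g P -> bounded_on D P.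
Proof.
move=> gb P; elim=> [c|i|F G _ [M HM] _ [N HN]|F G _ [M HM] _ [N HN]].
- by exists (Cmod c) => x _; lra.
- exact: gb.
- exists (M + N) => x Dx; apply: Rle_trans (Cmod_triangle _ _) _.
  by have := HM x Dx; have := HN x Dx; lra.
- exists (M * N) => x Dx; rewrite Cmod_mult.
  by apply: Rmult_le_compat; [exact: Cmod_ge_0|exact: Cmod_ge_0|exact: HM|exact: HN].
Qed.

Lemma unif_bounded D g F : bounded_gens D g -> unif D g F -> bounded_on D F.
Proof.
move=> gb H; have [P aP HP] := H 1 ltac:(lra).
have [M HM] := alg_bounded _ _ gb _ aP; exists (1 + M) => x Dx.
have -> : F x = (F x - P x + P x)%C by ring.
by apply: Rle_trans (Cmod_triangle _ _) _; have := HP x Dx; have := HM x Dx; lra.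
Qed.

Lemma unif_alg D g P : alg g P -> unif D g P.
Proof.
move=> aP eps e0; exists P => // x _.
by rewrite (_ : (P x - P x)%C = 0) ?Cmod_0; [lra|ring].
Qed.

Lemma unif_lim D g F :
  (forall eps, 0 < eps -> exists2 G, unif D g G & forall x, D x -> Cmod (F x - G x) <= eps) ->
  unif D g F.
Proof.
move=> H eps e0; have [G uG HG] := H (eps / 2) ltac:(lra).
have [P aP HP] := uG (eps / 2) ltac:(lra); exists P => // x Dx.
by have := Cmod_triangle3 (F x) (G x) (P x); have := HG x Dx; have := HP x Dx; lra.
Qed.

Lemma unif_ext D g F G : (forall x, D x -> F x = G x) -> unif D g G -> unif D g F.
Proof.
move=> E H eps e0; have [P aP HP] := H eps e0; exists P => // x Dx.
by rewrite E //; apply: HP.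
Qed.

Lemma unif_const D g c : unif D g (fun=> c).
Proof. by apply: unif_alg; apply: alg_const. Qed.

Lemma unif_gen D g i : unif D g (g i).
Proof. by apply: unif_alg; apply: alg_gen. Qed.

Lemma unif_add D g F G : unif D g F -> unif D g G -> unif D g (fun x => F x + G x)%C.
Proof.
move=> HF HG eps e0; have [P aP HP] := HF (eps / 2) ltac:(lra).
have [Q aQ HQ] := HG (eps / 2) ltac:(lra).
exists (fun x => P x + Q x)%C; first exact: alg_add.
move=> x Dx; have -> : (F x + G x - (P x + Q x) = (F x - P x) + (G x - Q x))%C by ring.
by apply: Rle_trans (Cmod_triangle _ _) _; have := HP x Dx; have := HQ x Dx; lra.
Qed.

Lemma unif_mul D g F G : bounded_gens D g ->
  unif D g F -> unif D g G -> unif D g (fun x => F x * G x)%C.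
Proof.
move=> gb HF HG eps e0.
have [M M0 HM] := bounded_onP _ _ (unif_bounded _ _ _ gb HF).
have [Q aQ HQ] := HG (eps / (2 * M)) ltac:(apply: Rdiv_lt_0_compat; lra).
have [N N0 HN] := bounded_onP _ _ (alg_bounded _ _ gb _ aQ).
have [P aP HP] := HF (eps / (2 * N)) ltac:(apply: Rdiv_lt_0_compat; lra).
exists (fun x => P x * Q x)%C; first exact: alg_mul.
move=> x Dx.
have -> : (F x * G x - P x * Q x = F x * (G x - Q x) + (F x - P x) * Q x)%C by ring.
apply: Rle_trans (Cmod_triangle _ _) _; rewrite !Cmod_mult.
have -> : eps = M * (eps / (2 * M)) + (eps / (2 * N)) * N by field; lra.
apply: Rplus_le_compat; apply: Rmult_le_compat; try exact: Cmod_ge_0.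
- exact: HM.
- exact: HQ.
- exact: HP.
- exact: HN.
Qed.

Lemma unif_scal D g c F : bounded_gens D g ->
  unif D g F -> unif D g (fun x => c * F x)%C.
Proof. by move=> gb; apply: unif_mul => //; apply: unif_const. Qed.

Lemma unif_opp D g F : bounded_gens D g -> unif D g F -> unif D g (fun x => - F x)%C.
Proof.
move=> gb uF; apply: (unif_ext _ _ _ (fun x => - (1) * F x)%C); first by move=> x _; ring.
exact: unif_scal.
Qed.

Lemma unif_sub D g F G : bounded_gens D g ->
  unif D g F -> unif D g G -> unif D g (fun x => F x - G x)%C.
Proof. by move=> gb uF uG; apply: unif_add => //; apply: unif_opp. Qed.

Lemma unif_Cprod D g (l : seq nat) (f : nat -> X -> C) : bounded_gens D g ->
  (forall i, i \in l -> unif D g (f i)) -> unif D g (fun x => Cprod l (fun i => f i x)).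
Proof.
move=> gb; elim: l => [|a l IH] H /=; first exact: unif_const.
apply: unif_mul => //; first by apply: H; rewrite inE eqxx.
by apply: IH => i il; apply: H; rewrite inE il orbT.
Qed.

Lemma unif_Csum D g (l : seq nat) (f : nat -> X -> C) :
  (forall i, i \in l -> unif D g (f i)) -> unif D g (fun x => Csum l (fun i => f i x)).
Proof.
elim: l => [|a l IH] H /=; first exact: unif_const.
apply: unif_add => //; first by apply: H; rewrite inE eqxx.
by apply: IH => i il; apply: H; rewrite inE il orbT.
Qed.

Lemma unif_pow D g F n : bounded_gens D g ->
  unif D g F -> unif D g (fun x => Cpow (F x) n).
Proof.
move=> gb uF; elim: n => [|n IH] /=; first exact: unif_const.
exact: unif_mul.
Qed.

Lemma unif_cvg D g (f : nat -> X -> C) F t : vanishing t ->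
  (forall n, unif D g (f n)) -> (forall n x, D x -> Cmod (f n x - F x) <= t n) -> unif D g F.
Proof.
move=> [_ Ht] uf H; apply: unif_lim => eps e0; have [N HN] := Ht eps e0.
exists (f N) => // x Dx; rewrite Cmod_minus_sym.
by have := HN N (leqnn N); have := H N x Dx; lra.
Qed.

(* Neumann series *)
Lemma unif_inv1m D g F q : bounded_gens D g -> q < 1 ->
  (forall x, D x -> Cmod (F x) <= q) -> unif D g F -> unif D g (fun x => / (1 - F x))%C.
Proof.
move=> gb q1 Fq uF.
case: (Rle_lt_dec 0 q) => q0; last first.
  by apply: (unif_ext _ _ _ (fun=> RtoC 0)) (unif_const _ _ _) => x /Fq; have := Cmod_ge_0 (F x); lra.
have F1 x : D x -> (1 - F x)%C <> 0 /\ 1 - q <= Cmod (1 - F x).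
  move=> /Fq Fx; have : 1 - q <= Cmod (1 - F x).
    have := Cmod_triangle (1 - F x) (F x).
    by rewrite (_ : (1 - F x + F x)%C = 1); [rewrite Cmod_1; lra|ring].
  by move=> H; split=> // E; rewrite E Cmod_0 in H; lra.
apply: (unif_cvg _ _ (fun n x => nsum n (fun i => Cpow (F x) i)) _ (fun n => / (1 - q) * q ^ n)).
- split=> [n|eps e0].
    by apply: Rmult_le_pos; [apply: Rlt_le; apply: Rinv_0_lt_compat; lra|apply: pow_le].
  have [N HN] := pow_lt_1_zero q ltac:(rewrite Rabs_pos_eq; lra) (eps * (1 - q)) ltac:(nra).
  exists N => n /leP Nn; have := HN n Nn; rewrite Rabs_pos_eq; last exact: pow_le.
  by move=> H; rewrite Rmult_comm; apply: (Rmult_lt_reg_r (1 - q)); [lra|rewrite Rmult_assoc Rinv_l; lra].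
- by move=> n; apply: unif_Csum => i _; apply: unif_pow.
- move=> n x Dx; have [nz lb] := F1 x Dx.
  have E : (nsum n (fun i => Cpow (F x) i) - / (1 - F x) = - (Cpow (F x) n / (1 - F x)))%C.
    elim: n => [|n IH]; first by rewrite /=; field.
    rewrite Csum_recr (_ : (_ + _ - _ = nsum n (fun i => Cpow (F x) i) - / (1 - F x) + Cpow (F x) n)%C).
      by rewrite IH /=; field.
    by ring.
  rewrite E Cmod_opp Cmod_div // Cmod_pow /Rdiv Rmult_comm.
  apply: Rmult_le_compat; first by apply: Rlt_le; apply: Rinv_0_lt_compat; lra.
  + by apply: pow_le; apply: Cmod_ge_0.
  + by apply: Rinv_le_contravar => //; lra.
  + by apply: pow_incr; split; [exact: Cmod_ge_0|exact: Fq].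
Qed.

End UniformAlgebra.

(** Substitution turns a polynomial in the [g i] into a polynomial in functions that are already
    uniform limits. It serves to insert z_i - z_{k+j} into s zeta(1 + s). *)
Lemma unif_comp {X I Y J : Type} (D : X -> Prop) (g : I -> X -> C) (E : Y -> Prop) (h : J -> Y -> C)
    (phi : Y -> X) F :
  (forall j, bounded_on E (h j)) -> (forall y, E y -> D (phi y)) ->
  (forall i, unif E h (fun y => g i (phi y))) ->
  unif D g F -> unif E h (fun y => F (phi y)).
Proof.
move=> hb ED gu uF; apply: unif_lim => eps e0; have [P aP HP] := uF eps e0.
exists (fun y => P (phi y)); last by move=> y /ED; apply: HP.
elim: aP => [c|i|G H _ IG _ IH|G H _ IG _ IH].
- exact: unif_const.
- exact: gu.
- exact: unif_add.
- exact: unif_mul.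
Qed.

(** * The exponential and (e^y - 1) / y as uniform limits of polynomials *)

Lemma Cexp_add z w : Cexp (z + w)%C = (Cexp z * Cexp w)%C.
Proof.
case: z => a b; case: w => c d; rewrite /Cexp /Cplus /Cmult /Re /Im /=.
by rewrite exp_plus cos_plus sin_plus; congr pair; ring.
Qed.

Lemma Cexp_0 : Cexp 0 = 1.
Proof. by rewrite /Cexp /Re /Im /= exp_0 cos_0 sin_0; congr pair; ring. Qed.

Lemma Cmod_Cexp z : Cmod (Cexp z) = exp (Re z).
Proof.
rewrite /Cexp /Cmod /=; have := exp_pos (Re z); move: (exp _) => e e0.
have -> : e * cos (Im z) * (e * cos (Im z) * 1) + e * sin (Im z) * (e * sin (Im z) * 1)
  = e ^ 2 * (Rsqr (sin (Im z)) + Rsqr (cos (Im z))) by rewrite /Rsqr; ring.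
by rewrite sin2_cos2 Rmult_1_r; apply: sqrt_pow2; lra.
Qed.

Lemma Cexp_neq0 z : Cexp z <> 0.
Proof. by move=> E; have := Cmod_Cexp z; rewrite E Cmod_0; have := exp_pos (Re z); lra. Qed.

Lemma Cexp_opp z : Cexp (- z)%C = (/ Cexp z)%C.
Proof.
have H : (Cexp (- z) * Cexp z)%C = 1.
  by rewrite -Cexp_add (_ : (- z + z)%C = 0) ?Cexp_0 //; ring.
by rewrite -[LHS]Cmult_1_r -(Cinv_r _ (Cexp_neq0 z)) Cmult_assoc H Cmult_1_l.
Qed.

Lemma exp_le x y : x <= y -> exp x <= exp y.
Proof. by case=> [/exp_increasing|->]; lra. Qed.

Definition expT (N : nat) (z : C) : C :=
  nsum N (fun n => Cpow z n / RtoC (INR n`!))%C.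

Lemma INR_fact_pos n : 0 < INR n`!.
Proof. by apply: lt_0_INR; apply/leP; apply: fact_gt0. Qed.

Lemma factE n : Factorial.fact n = n`!.
Proof. by elim: n => // n IH; rewrite /= IH factS mulSn. Qed.

Lemma expT_recr N z : expT N.+1 z = (expT N z + Cpow z N / RtoC (INR N`!))%C.
Proof. exact: Csum_recr. Qed.

Lemma Rle_of_derive (f df g dg : R -> R) T : 0 <= T ->
  (forall t, is_derive f t (df t)) -> (forall t, is_derive g t (dg t)) ->
  (forall t, 0 <= t <= T -> df t <= dg t) -> f 0 = 0 -> g 0 = 0 -> f T <= g T.
Proof.
move=> T0 Df Dg H f0 g0.
have D t : is_derive (fun t => g t - f t) t (dg t - df t).
  exact: (@is_derive_minus R_AbsRing R_NormedModule).
have [//|t _|c [Hc]] := MVT_gen (fun t => g t - f t) 0 T (fun t => dg t - df t).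
  by apply: derivable_continuous_pt; eexists; apply/is_derive_Reals; apply: D.
rewrite f0 g0; move: Hc; rewrite Rmin_left // Rmax_right // => /H Hc E.
have : 0 <= (dg c - df c) * (T - 0) by apply: Rmult_le_pos; lra.
by lra.
Qed.

Section ExpTaylor.
Variables (u v : R) (z : C).
(** A real linear functional: the mean value theorem is real, so remainders are differentiated along
    the ray t z after applying [L]. *)
Let L (w : C) : R := u * Re w + v * Im w.

Let L_add w w' : L (w + w')%C = L w + L w'.
Proof. by rewrite /L /Re /Im /=; ring. Qed.

Let L_scal t w : L (RtoC t * w)%C = t * L w.
Proof. by rewrite /L /Re /Im /=; ring. Qed.

Lemma is_derive_Cexp t :
  is_derive (fun t => L (Cexp (RtoC t * z)%C)) t (L (z * Cexp (RtoC t * z))%C).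
Proof.
case: z => x y; rewrite /L /Cexp /Cmult /Re /Im /=.
apply: (is_derive_ext (fun t => u * (exp (t * x) * cos (t * y)) + v * (exp (t * x) * sin (t * y)))).
  by move=> s; rewrite !(Rmult_0_l, Rminus_0_r, Rplus_0_r).
by auto_derive => //; rewrite !(Rmult_0_l, Rminus_0_r, Rplus_0_r); ring.
Qed.

Lemma is_derive_expT N t :
  is_derive (fun t => L (expT N.+1 (RtoC t * z)%C)) t (L (z * expT N (RtoC t * z))%C).
Proof.
elim: N => [|N IH].
  apply: (is_derive_ext (fun=> L (expT 1 0))); first by move=> s; rewrite /expT /=.
  rewrite (_ : L (z * _)%C = 0); [auto_derive => //|by rewrite /L /expT /Re /Im /=; ring].
have E s : (Cpow (RtoC s * z) N.+1 / RtoC (INR (N.+1)`!) =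
    RtoC (s ^ N.+1) * (Cpow z N.+1 / RtoC (INR (N.+1)`!)))%C.
  by rewrite Cpow_mult_l RtoC_pow /Cdiv Cmult_assoc.
apply: (is_derive_ext (fun s => L (expT N.+1 (RtoC s * z)%C) +
    s ^ N.+1 * L (Cpow z N.+1 / RtoC (INR (N.+1)`!))%C)).
  by move=> s; rewrite (expT_recr N.+1) L_add E L_scal.
rewrite expT_recr Cmult_plus_distr_l L_add; apply: (@is_derive_plus R_AbsRing R_NormedModule) => //.
have -> : L (z * (Cpow (RtoC t * z) N / RtoC (INR N`!)))%C =
    INR N.+1 * t ^ N * L (Cpow z N.+1 / RtoC (INR (N.+1)`!))%C.
  rewrite -L_scal; congr L.
  rewrite factS mult_INR Cpow_mult_l -RtoC_pow !RtoC_mult Cpow_S.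
  have f0 : RtoC (INR N`!) <> 0 by move=> [] ; have := INR_fact_pos N; lra.
  have n0 : RtoC (INR N.+1) <> 0 by move/RtoC_inj; have := pos_INR N; rewrite S_INR; lra.
  by field; split.
by auto_derive => //; rewrite /= -/(INR N.+1); ring.
Qed.

End ExpTaylor.

(** Induction on N: along the ray t z the derivative of a remainder is z times the previous
    remainder. Real and imaginary parts are estimated separately, which costs a factor 2 per step
    and explains (2|z|)^N. *)
Lemma Cexp_taylor N z :
  Cmod (Cexp z - expT N z) <= exp (Cmod z) * ((2 * Cmod z) ^ N / INR N`!).
Proof.
have main : forall t, 0 <= t <= 1 -> Cmod (Cexp (RtoC t * z) - expT N (RtoC t * z)) <=
    exp (Cmod z) * ((2 * Cmod z) ^ N / INR N`!) * t ^ N.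
  elim: N => [|N IH] t Ht.
    rewrite /expT /= (_ : (_ - 0)%C = Cexp (RtoC t * z)) ?Cmod_Cexp; last by ring.
    rewrite (_ : _ * 1 = exp (Cmod z)); last by field.
    apply: exp_le; apply: Rle_trans (Rle_abs _) _; apply: Rle_trans (re_le_Cmod _) _.
    rewrite Cmod_mult Cmod_R Rabs_pos_eq; last by lra.
    by have := Cmod_ge_0 z; nra.
  set K := exp (Cmod z) * ((2 * Cmod z) ^ N / INR N`!) in IH.
  have K0 : 0 <= K.
    apply: Rmult_le_pos; first by apply: Rlt_le; apply: exp_pos.
    apply: Rmult_le_pos; first by apply: pow_le; have := Cmod_ge_0 z; lra.
    by apply: Rlt_le; apply: Rinv_0_lt_compat; apply: INR_fact_pos.
  have n0 : 0 < INR N.+1 by rewrite S_INR; have := pos_INR N; lra.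
  have f0 := INR_fact_pos N.
  (* The pair (u, v) will be (1, 0), (-1, 0), (0, 1), (0, -1), which bounds both parts from above
     and below. *)
  have bnd u v : (forall w : C, u * Re w + v * Im w <= Cmod w) ->
      u * Re (Cexp (RtoC t * z) - expT N.+1 (RtoC t * z))%C +
      v * Im (Cexp (RtoC t * z) - expT N.+1 (RtoC t * z))%C <=
      Cmod z * K / INR N.+1 * t ^ N.+1.
    move=> Huv.
    pose f s := u * Re (Cexp (RtoC s * z)%C) + v * Im (Cexp (RtoC s * z)%C) -
      (u * Re (expT N.+1 (RtoC s * z)%C) + v * Im (expT N.+1 (RtoC s * z)%C)).
    rewrite (_ : _ + _ = f t); last by rewrite /f /Re /Im /=; ring.
    apply: (Rle_of_derive f (fun s => u * Re (z * Cexp (RtoC s * z))%C + v * Im (z * Cexp (RtoC s * z))%C -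
      (u * Re (z * expT N (RtoC s * z))%C + v * Im (z * expT N (RtoC s * z))%C))
      (fun s => Cmod z * K / INR N.+1 * s ^ N.+1) (fun s => Cmod z * (K * s ^ N))) => //.
    - by case: Ht.
    - move=> s; apply: (@is_derive_minus R_AbsRing R_NormedModule).
        exact: is_derive_Cexp.
      exact: is_derive_expT.
    - by move=> s; auto_derive => //; rewrite /= -/(INR N.+1); field; lra.
    - move=> s [s0 st].
      apply: (Rle_trans _ (Cmod (z * (Cexp (RtoC s * z) - expT N (RtoC s * z)))%C)).
        apply: Rle_trans _ (Huv _); apply: Req_le.
        by rewrite /Re /Im /=; ring.
      rewrite Cmod_mult; apply: Rmult_le_compat_l; first exact: Cmod_ge_0.
      by apply: IH; lra.
    - rewrite /f (_ : (RtoC 0 * z)%C = 0); last by ring.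
      have -> : expT N.+1 0 = 1.
        elim: (N) => [|M E]; first by rewrite /expT /= /Cdiv; apply: injective_projections; rewrite /=; field.
        by rewrite expT_recr E /= Cmult_0_l /Cdiv Cmult_0_l Cplus_0_r.
      by rewrite Cexp_0; ring.
    - by rewrite /=; ring.
  have rele (s : R) (w : C) : s = 1 \/ s = -1 -> s * Re w <= Cmod w.
    have := re_le_Cmod w; have := Rle_abs (Re w); have := Rle_abs (- Re w).
    by rewrite Rabs_Ropp => ? ? ? []->; lra.
  have imle (s : R) (w : C) : s = 1 \/ s = -1 -> s * Im w <= Cmod w.
    have := Im_le_Cmod w; have := Rle_abs (Im w); have := Rle_abs (- Im w).
    by rewrite Rabs_Ropp => ? ? ? []->; lra.
  have b1 := bnd 1 0 ltac:(move=> w; have := rele 1 w; lra).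
  have b2 := bnd (-1) 0 ltac:(move=> w; have := rele (-1) w; lra).
  have b3 := bnd 0 1 ltac:(move=> w; have := imle 1 w; lra).
  have b4 := bnd 0 (-1) ltac:(move=> w; have := imle (-1) w; lra).
  apply: Rle_trans (Cmod_le_abs _) _.
  rewrite (_ : _ * t ^ N.+1 = 2 * (Cmod z * K / INR N.+1 * t ^ N.+1)); last first.
    by rewrite /K factS mult_INR -[(2 * Cmod z) ^ N.+1]/((2 * Cmod z) * (2 * Cmod z) ^ N); field; lra.
  by apply: (Rle_trans _ (Cmod z * K / INR N.+1 * t ^ N.+1 + Cmod z * K / INR N.+1 * t ^ N.+1)); [apply: Rplus_le_compat; apply: Rabs_le; lra|lra].
have := main 1 ltac:(lra); rewrite pow1 Rmult_1_r.
by rewrite (_ : (RtoC 1 * z)%C = z) //; ring.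
Qed.

Lemma vanishing_exp_tail x : 0 <= x -> vanishing (fun N => x ^ N / INR N`!).
Proof.
move=> x0; split=> [n|eps e0].
  apply: Rmult_le_pos; first exact: pow_le.
  by apply: Rlt_le; apply: Rinv_0_lt_compat; apply: INR_fact_pos.
have [N HN] := cv_speed_pow_fact x eps e0; exists N => n /leP Nn.
have := HN n Nn; rewrite /R_dist Rminus_0_r factE.
by apply: Rle_lt_trans; apply: Rle_abs.
Qed.

Lemma Cexp_taylor_le N z M : Cmod z <= M ->
  Cmod (Cexp z - expT N z) <= exp M * ((2 * M) ^ N / INR N`!).
Proof.
move=> zM; apply: Rle_trans (Cexp_taylor N z) _.
have z0 := Cmod_ge_0 z; apply: Rmult_le_compat.
- by apply: Rlt_le; apply: exp_pos.
- by apply: Rmult_le_pos; [apply: pow_le; lra|apply: Rlt_le; apply: Rinv_0_lt_compat; apply: INR_fact_pos].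
- exact: exp_le.
- apply: Rmult_le_compat_r; first by apply: Rlt_le; apply: Rinv_0_lt_compat; apply: INR_fact_pos.
  by apply: pow_incr; lra.
Qed.

Lemma unif_expT {X I : Type} (D : X -> Prop) (g : I -> X -> C) F N :
  (forall i, bounded_on D (g i)) -> unif D g F -> unif D g (fun x => expT N (F x)).
Proof.
move=> gb uF; apply: unif_Csum => n _.
apply: unif_mul => //; [exact: unif_pow|exact: unif_const].
Qed.

Lemma unif_Cexp {X I : Type} (D : X -> Prop) (g : I -> X -> C) F :
  (forall i, bounded_on D (g i)) -> unif D g F -> unif D g (fun x => Cexp (F x)).
Proof.
move=> gb uF; have [M M0 HM] := bounded_onP _ _ (unif_bounded _ _ _ gb uF).
apply: (unif_cvg _ _ (fun N x => expT N (F x)) _ (fun N => exp M * ((2 * M) ^ N / INR N`!))).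
- by apply: vanishing_scal; [apply: Rlt_le; apply: exp_pos|apply: vanishing_exp_tail; lra].
- by move=> N; apply: unif_expT.
- by move=> N x Dx; rewrite Cmod_minus_sym; apply: Cexp_taylor_le; apply: HM.
Qed.

(* (e^y - 1) / y, with its removable singularity at 0 filled in *)
Definition phi (y : C) : C :=
  if excluded_middle_informative (y = 0) then RtoC 1 else ((Cexp y - 1) / y)%C.

Lemma phi_0 : phi 0 = 1.
Proof. by rewrite /phi; case: excluded_middle_informative. Qed.

Lemma phi_neq0 (y : C) : y <> 0 -> phi y = ((Cexp y - 1) / y)%C.
Proof. by rewrite /phi => y0; case: excluded_middle_informative. Qed.

Lemma Cexp_phi y : Cexp y = (1 + y * phi y)%C.
Proof.
case: (excluded_middle_informative (y = 0)) => y0.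
  by rewrite y0 Cexp_0 phi_0; ring.
by rewrite phi_neq0 //; field.
Qed.

Definition phiT (N : nat) (y : C) : C :=
  nsum N (fun n => Cpow y n / RtoC (INR (n.+1)`!))%C.

Lemma expT_phiT N y : expT N.+1 y = (1 + y * phiT N y)%C.
Proof.
elim: N => [|N IH].
  by rewrite /expT /phiT /= /Cdiv; apply: injective_projections; rewrite /=; field.
rewrite expT_recr IH /phiT Csum_recr Cpow_S /Cdiv; ring.
Qed.

(** Dividing the exponential remainder of order N + 2 by y costs one power of y; the factorial
    (N+2)! is then weakened to (N+1)!. Truncating at N + 1 >= 1 terms keeps the constant term, so
    the value at 0 is exact. *)
Lemma phi_taylor_le N y M : Cmod y <= M ->
  Cmod (phi y - phiT N.+1 y) <= 2 * exp M * ((2 * M) ^ N.+1 / INR (N.+1)`!).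
Proof.
move=> yM; have y0 := Cmod_ge_0 y.
have f0 n : 0 < / INR n`! by apply: Rinv_0_lt_compat; apply: INR_fact_pos.
case: (excluded_middle_informative (y = 0)) => [yE|yn].
  rewrite yE phi_0.
  have -> : phiT N.+1 0 = 1.
    elim: N => [|N IH]; first by rewrite /phiT /= /Cdiv; apply: injective_projections; rewrite /=; field.
    by rewrite /phiT Csum_recr -/(phiT N.+1 0) IH /= Cmult_0_l /Cdiv Cmult_0_l Cplus_0_r.
  rewrite (_ : (1 - 1)%C = 0) ?Cmod_0; last by ring.
  apply: Rmult_le_pos; first by have := exp_pos M; lra.
  by rewrite /Rdiv; apply: Rmult_le_pos; [apply: pow_le; lra|apply: Rlt_le].
rewrite phi_neq0 //; have yp : 0 < Cmod y by apply/Cmod_gt_0.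
have -> : ((Cexp y - 1) / y - phiT N.+1 y = (Cexp y - expT N.+2 y) / y)%C.
  by rewrite expT_phiT; field.
rewrite Cmod_div //; apply: (Rmult_le_reg_r (Cmod y)) => //.
rewrite /Rdiv Rmult_assoc Rinv_l ?Rmult_1_r; last by lra.
apply: Rle_trans (Cexp_taylor _ _) _.
have -> : 2 * exp M * ((2 * M) ^ N.+1 * / INR (N.+1)`!) * Cmod y =
  exp M * ((2 * M) ^ N.+1 * (2 * Cmod y) * / INR (N.+1)`!) by ring.
apply: Rmult_le_compat; first by apply: Rlt_le; apply: exp_pos.
- by apply: Rmult_le_pos; [apply: pow_le; lra|apply: Rlt_le].
- exact: exp_le.
- apply: Rmult_le_compat; try exact: (Rlt_le _ _ (f0 _)).
  + by apply: pow_le; lra.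
  + rewrite -tech_pow_Rmult Rmult_comm; apply: Rmult_le_compat_r; first by lra.
    by apply: pow_incr; lra.
  + apply: Rinv_le_contravar; first exact: INR_fact_pos.
    by apply: le_INR; apply/leP; rewrite (factS N.+1) leq_pmull.
Qed.

Lemma unif_phi {X I : Type} (D : X -> Prop) (g : I -> X -> C) F :
  (forall i, bounded_on D (g i)) -> unif D g F -> unif D g (fun x => phi (F x)).
Proof.
move=> gb uF; have [M M0 HM] := bounded_onP _ _ (unif_bounded _ _ _ gb uF).
apply: (unif_cvg _ _ (fun N x => phiT N.+1 (F x)) _ (fun N => 2 * exp M * ((2 * M) ^ N.+1 / INR (N.+1)`!))).
- apply: vanishing_scal; first by have := exp_pos M; lra.
  have [v0 H] := vanishing_exp_tail (2 * M) ltac:(lra).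
  split=> [n|eps e0]; first exact: v0.
  by have [N HN] := H eps e0; exists N => n Nn; apply: HN; apply: leqW.
- move=> N; apply: unif_Csum => n _.
  by apply: unif_mul => //; [exact: unif_pow|exact: unif_const].
- by move=> N x Dx; rewrite Cmod_minus_sym; apply: phi_taylor_le; apply: HM.
Qed.

Lemma phi_near1 y : Cmod (phi y - 1) <= 4 * exp (Cmod y) * Cmod y.
Proof.
have := phi_taylor_le 0 y _ (Rle_refl _).
rewrite (_ : phiT 1 y = 1); last by rewrite /phiT /= /Cdiv; apply: injective_projections; rewrite /=; field.
by rewrite (_ : INR 1`! = 1) //; lra.
Qed.

Lemma Cexp_near1 y : Cmod (Cexp y - 1) <= 2 * exp (Cmod y) * Cmod y.
Proof.
have := Cexp_taylor 1 y; rewrite (_ : expT 1 y = 1).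
  by rewrite (_ : INR 1`! = 1) //; lra.
by rewrite /expT /= /Cdiv; apply: injective_projections; rewrite /=; field.
Qed.

Lemma choice_on (A B : Type) (b0 : B) (P : A -> Prop) (Q : A -> B -> Prop) :
  (forall a, P a -> exists b, Q a b) -> exists f, forall a, P a -> Q a (f a).
Proof.
move=> H; exists (fun a => epsilon (inhabits b0) (Q a)) => a Pa.
exact: epsilon_spec (H a Pa).
Qed.

Lemma choice_fun (A B : Type) (Q : A -> B -> Prop) :
  (forall a, exists b, Q a b) -> exists f, forall a, Q a (f a).
Proof.
move=> H; exists (fun a => proj1_sig (constructive_indefinite_description _ (H a))).
by move=> a; case: constructive_indefinite_description.
Qed.

(** * Means over circles and tori *)

(** A relation rather than a value of [RInt], so that integrability is part of it. *)
Definition cint (f : R -> C) (v : C) : Prop := @is_RInt C_R_NormedModule f 0 1 v.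

Lemma cint_RInt f v : cint f v -> @RInt C_R_CompleteNormedModule f 0 1 = v.
Proof. exact: (@is_RInt_unique C_R_CompleteNormedModule). Qed.

Lemma cint_unique f v w : cint f v -> cint f w -> v = w.
Proof. by move=> /cint_RInt <- /cint_RInt <-. Qed.

Lemma cintP f v :
  cint f v <-> is_RInt (fun t => Re (f t)) 0 1 (Re v) /\ is_RInt (fun t => Im (f t)) 0 1 (Im v).
Proof.
split=> [H|[Hr Hi]].
  split; first exact: (is_RInt_fct_extend_fst f 0 1 v H).
  exact: (is_RInt_fct_extend_snd f 0 1 v H).
have -> : v = (Re v, Im v) by case: v {Hr Hi}.
exact: (is_RInt_fct_extend_pair f 0 1).
Qed.

Lemma cint_ext f g v : (forall t, 0 < t < 1 -> f t = g t) -> cint f v -> cint g v.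
Proof.
move=> E; apply: is_RInt_ext => t; rewrite Rmin_left ?Rmax_right; try lra.
exact: E.
Qed.

Lemma cint_add f g v w : cint f v -> cint g w -> cint (fun t => f t + g t)%C (v + w)%C.
Proof. by move=> Hf Hg; apply: (@is_RInt_plus C_R_NormedModule). Qed.

Lemma cint_scal c f v : cint f v -> cint (fun t => c * f t)%C (c * v)%C.
Proof.
move=> /cintP[Hr Hi]; apply/cintP; split.
  exact: (is_RInt_minus _ _ _ _ _ _ (is_RInt_scal _ _ _ (Re c) _ Hr) (is_RInt_scal _ _ _ (Im c) _ Hi)).
exact: (is_RInt_plus _ _ _ _ _ _ (is_RInt_scal _ _ _ (Re c) _ Hi) (is_RInt_scal _ _ _ (Im c) _ Hr)).
Qed.

Lemma cint_const c : cint (fun=> c) c.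
Proof.
have /= := @is_RInt_const C_R_NormedModule 0 1 c.
have -> : @scal R_AbsRing C_R_NormedModule (1 - 0) c = c.
  by rewrite Rminus_0_r; apply: (@scal_one R_AbsRing C_R_NormedModule).
by [].
Qed.

Lemma cint_bound f v M : (forall t, 0 <= t <= 1 -> Cmod (f t) <= M) -> cint f v -> Cmod v <= M.
Proof.
move=> H /(@norm_RInt_le_const C_R_NormedModule) Hv.
have := Hv M Rle_0_1; rewrite Rminus_0_r Rmult_1_l -Cmod_norm; apply.
by move=> t /H; rewrite Cmod_norm.
Qed.

Lemma cint_opp_sub f g v w : cint f v -> cint g w -> cint (fun t => f t - g t)%C (v - w)%C.
Proof. by move=> Hf Hg; apply: (@is_RInt_minus C_R_NormedModule). Qed.

(** The estimate is asked for all real t because the exchange of limit and integral is applied in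
    the uniform space of functions on the whole line. Integrability of the limit is part of the
    conclusion. *)
Lemma cint_lim (f : nat -> R -> C) (v : nat -> C) g e : vanishing e ->
  (forall n, cint (f n) (v n)) -> (forall n t, Cmod (f n t - g t) <= e n) ->
  exists2 w, cint g w & forall n, Cmod (v n - w) <= e n.
Proof.
move=> [_ He] Hf H.
have [|w [_ Hw]] := @filterlim_RInt nat C_R_CompleteNormedModule f 0 1 eventually _ g v Hf.
  apply/filterlim_locally => eps; have [N HN] := He eps (cond_pos eps).
  exists N => n /leP Nn t; apply: (@norm_compat1 R_AbsRing C_R_NormedModule).
  by rewrite -Cmod_norm; apply: Rle_lt_trans (H n t) (HN n Nn).
exists w => // n; apply: (cint_bound (fun t => f n t - g t)%C) => //.
exact: cint_opp_sub.
Qed.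

Lemma ceE t : ce t = Cexp (Ci * RtoC (2 * PI * t))%C.
Proof.
rewrite /ce /Cexp /Cmult /Re /Im /= !(Rmult_0_l, Rmult_0_r, Rmult_1_l, Rplus_0_r, Rplus_0_l, Rminus_0_r).
by rewrite exp_0 !Rmult_1_l.
Qed.

Lemma ce_add s t : ce (s + t) = (ce s * ce t)%C.
Proof. by rewrite !ceE -Cexp_add; congr Cexp; rewrite Rmult_plus_distr_l RtoC_plus; ring. Qed.

Lemma Cmod_ce t : Cmod (ce t) = 1.
Proof.
rewrite ceE Cmod_Cexp /Re /Im /= !(Rmult_0_l, Rmult_0_r, Rminus_0_r).
by rewrite exp_0.
Qed.

Lemma ce_0 : ce 0 = 1.
Proof. by rewrite ceE Rmult_0_r Cmult_0_r Cexp_0. Qed.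

Lemma ce_1 : ce 1 = 1.
Proof. by rewrite /ce Rmult_1_r cos_2PI sin_2PI. Qed.

Lemma ce_opp t : ce (- t) = (/ ce t)%C.
Proof. by rewrite !ceE -Cexp_opp; congr Cexp; rewrite -Ropp_mult_distr_r RtoC_opp; ring. Qed.

Lemma ce_neq0 t : ce t <> 0.
Proof. by rewrite ceE; apply: Cexp_neq0. Qed.

Lemma ce_pow t n : Cpow (ce t) n = ce (INR n * t).
Proof.
elim: n => [|n IH]; first by rewrite /= Rmult_0_l ce_0.
by rewrite Cpow_S IH S_INR Rmult_plus_distr_r Rmult_1_l ce_add Cmult_comm.
Qed.

Lemma ce_INR n : ce (INR n) = 1.
Proof. by rewrite -[INR n]Rmult_1_r -ce_pow ce_1; elim: n => //= n ->; ring. Qed.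

Lemma cint_ce_freq k : k <> 0 -> ce k = 1 -> cint (fun t => ce (k * t)) 0.
Proof.
move=> k0 ck; have pi0 := PI_RGT_0.
have c1 : PI <> 0 by lra.
have [E1 E2] : cos (2 * PI * (k * 1)) = 1 /\ sin (2 * PI * (k * 1)) = 0.
  by move: ck; rewrite /ce Rmult_1_r => -[].
apply/cintP; split.
  rewrite (_ : Re 0 = minus (sin (2 * PI * (k * 1)) / (2 * PI * k)) (sin (2 * PI * (k * 0)) / (2 * PI * k))).
    apply: (is_RInt_derive (fun t => sin (2 * PI * (k * t)) / (2 * PI * k))) => t _.
      by rewrite /ce /Re /=; auto_derive => //; field.
    by apply: ex_derive_continuous; rewrite /ce /Re /=; auto_derive.
  by rewrite E2 !Rmult_0_r sin_0 /minus /plus /opp /Re /=; field.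
rewrite (_ : Im 0 = minus (- cos (2 * PI * (k * 1)) / (2 * PI * k)) (- cos (2 * PI * (k * 0)) / (2 * PI * k))).
  apply: (is_RInt_derive (fun t => - cos (2 * PI * (k * t)) / (2 * PI * k))) => t _.
    by rewrite /ce /Im /=; auto_derive => //; field.
  by apply: ex_derive_continuous; rewrite /ce /Im /=; auto_derive.
by rewrite E1 !Rmult_0_r cos_0 /minus /plus /opp /Im /=; field.
Qed.

(** Orthogonality of characters; quotients of natural powers stand for integer frequencies. *)
Lemma cint_ce_pow a b :
  cint (fun t => Cpow (ce t) a / Cpow (ce t) b)%C (RtoC (if a == b then 1 else 0)).
Proof.
have E t : (Cpow (ce t) a / Cpow (ce t) b)%C = ce ((INR a - INR b) * t).
  by rewrite /Rminus Rmult_plus_distr_r ce_add !ce_pow Ropp_mult_distr_l_reverse ce_opp.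
apply: (cint_ext _ _ _ (fun t _ => esym (E t))).
case: eqP => [->|/eqP ab].
  apply: cint_ext (cint_const _) => t _.
  by rewrite Rminus_diag Rmult_0_l ce_0.
apply: cint_ce_freq; first by move=> H; case/eqP: ab; apply: INR_eq; lra.
by rewrite /Rminus ce_add ce_opp !ce_INR; apply: Cinv_r; case; lra.
Qed.

Lemma Csum_scal (T : Type) c (l : seq T) (f : T -> C) :
  Csum l (fun i => c * f i)%C = (c * Csum l f)%C.
Proof. by elim: l => [|a l IH] /=; rewrite ?IH; ring. Qed.

Lemma Csum_ext (T : eqType) (l : seq T) (f g : T -> C) :
  (forall i, i \in l -> f i = g i) -> Csum l f = Csum l g.
Proof.
elim: l => //= a l IH H; rewrite IH; first by rewrite H // inE eqxx.
by move=> i il; apply: H; rewrite inE il orbT.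
Qed.

Lemma Cprod_ext (l : seq nat) (f g : nat -> C) :
  (forall i, i \in l -> f i = g i) -> Cprod l f = Cprod l g.
Proof.
elim: l => //= a l IH H; rewrite IH; first by rewrite H // inE eqxx.
by move=> i il; apply: H; rewrite inE il orbT.
Qed.

Lemma Cprod_mul (l : seq nat) (f g : nat -> C) :
  Cprod l (fun i => f i * g i)%C = (Cprod l f * Cprod l g)%C.
Proof. by elim: l => [|a l IH] /=; rewrite ?IH; ring. Qed.

Lemma Csum_single N (b : nat) (v : C) : (b < N)%nat ->
  nsum N (fun n => if n == b then v else 0) = v.
Proof.
elim: N => // N IH; rewrite ltnS leq_eqVlt Csum_recr => /orP[/eqP->|bN].
  rewrite eqxx (Csum_ext _ _ _ (fun=> RtoC 0 * 0)%C).
    by rewrite Csum_scal; ring.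
  by move=> i; rewrite mem_iota0 => iN; rewrite ltn_eqF //; ring.
by rewrite IH // gtn_eqF //; ring.
Qed.

Lemma cint_sum (T : Type) (l : seq T) (f : T -> R -> C) v :
  (forall i, cint (f i) (v i)) -> cint (fun t => Csum l (fun i => f i t)) (Csum l v).
Proof.
by move=> H; elim: l => [|a l IH] /=; [exact: cint_const|exact: cint_add].
Qed.

Lemma RtoC_neq0 x : x <> 0 -> RtoC x <> 0.
Proof. by move=> x0 /RtoC_inj. Qed.

Lemma Cpow_neq0 (z : C) n : z <> 0 -> Cpow z n <> 0.
Proof. exact: Cpow_nz. Qed.

Lemma circle_neq0 r t : 0 < r -> (RtoC r * ce t)%C <> 0.
Proof. by move=> r0; apply: Cmult_neq_0; [apply: RtoC_neq0; lra|exact: ce_neq0]. Qed.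

Lemma Cmod_circle r t : 0 < r -> Cmod (RtoC r * ce t) = r.
Proof. by move=> r0; rewrite Cmod_mult Cmod_ce Cmod_R Rabs_pos_eq; lra. Qed.

Lemma cint_pow r a b : 0 < r ->
  cint (fun t => Cpow (RtoC r * ce t) a / Cpow (RtoC r * ce t) b)%C (RtoC (if a == b then 1 else 0)).
Proof.
move=> r0; have rn : RtoC r <> 0 by apply: RtoC_neq0; lra.
have -> : RtoC (if a == b then 1 else 0) =
    (Cpow r a / Cpow r b * RtoC (if a == b then 1 else 0))%C.
  by case: eqP => [->|_]; [rewrite /Cdiv Cinv_r ?Cmult_1_l //; apply: Cpow_neq0|ring].
apply: cint_ext (cint_scal _ _ _ (cint_ce_pow a b)) => t _.
rewrite !Cpow_mult_l; field; split; apply: Cpow_neq0 => //; exact: ce_neq0.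
Qed.

(** The coefficient of u^b in u^a e^{cu}. *)
Definition exp_coef (c : C) (a b : nat) : C :=
  if (a <= b)%nat then (Cpow c (b - a) / RtoC (INR (b - a)`!))%C else 0.

(** The exponential is truncated, integrated termwise by orthogonality, and the truncation removed
    by uniform convergence on the circle. *)
Lemma cint_pow_Cexp r c a b : 0 < r ->
  cint (fun t => Cpow (RtoC r * ce t) a * Cexp (c * (RtoC r * ce t)) / Cpow (RtoC r * ce t) b)%C
    (exp_coef c a b).
Proof.
move=> r0; pose z t := (RtoC r * ce t)%C.
pose M := Cmod c * r; have M0 : 0 <= M by apply: Rmult_le_pos; [exact: Cmod_ge_0|lra].
have zM t : Cmod (c * z t) <= M by rewrite Cmod_mult Cmod_circle //; apply: Rle_refl.
pose e N := r ^ a / r ^ b * exp M * ((2 * M) ^ N / INR N`!).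
have ra : 0 < r ^ a / r ^ b by apply: Rdiv_lt_0_compat; apply: pow_lt.
have ve : vanishing e.
  apply: vanishing_scal; last by apply: vanishing_exp_tail; lra.
  by apply: Rmult_le_pos; [lra|apply: Rlt_le; apply: exp_pos].
pose f N t := nsum N (fun n => Cpow c n / RtoC (INR n`!) * (Cpow (z t) (n + a) / Cpow (z t) b))%C.
pose v N := nsum N (fun n => Cpow c n / RtoC (INR n`!) * RtoC (if addn n a == b then 1 else 0))%C.
have fv N : cint (f N) (v N).
  by apply: cint_sum => n; apply: cint_scal; apply: cint_pow.
have fE N t : f N t = (Cpow (z t) a * expT N (c * z t) / Cpow (z t) b)%C.
  rewrite /f /expT (_ : (_ / _)%C = (Cpow (z t) a / Cpow (z t) b * nsum N (fun n => Cpow (c * z t) n / RtoC (INR n`!)))%C).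
    rewrite -Csum_scal; apply: Csum_ext => n _; rewrite Cpow_mult_l Cpow_add_r /Cdiv; ring.
  by rewrite /Cdiv; ring.
have fg N t : Cmod (f N t - Cpow (z t) a * Cexp (c * z t) / Cpow (z t) b) <= e N.
  have zn : Cpow (z t) b <> 0 by apply: Cpow_neq0; apply: circle_neq0.
  rewrite fE (_ : (_ - _ = Cpow (z t) a / Cpow (z t) b * (expT N (c * z t) - Cexp (c * z t)))%C); last by field.
  rewrite Cmod_mult Cmod_div // !Cmod_pow Cmod_circle // /e Rmult_assoc.
  apply: Rmult_le_compat_l; first by lra.
  by rewrite Cmod_minus_sym; apply: Cexp_taylor_le.
have [w Hw vw] := cint_lim f v _ e ve fv fg.
suff <- : w = exp_coef c a b by [].
apply: (Ccv_unique v); first exact: Ccv_vanishing ve vw.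
(* For n > b the truncation contains the only term that can contribute, so the means are constant
   from there on. *)
move=> eps e0; exists b.+1 => n bn; rewrite (_ : v n = exp_coef c a b).
  by rewrite (_ : (_ - _)%C = 0) ?Cmod_0 //; ring.
rewrite /exp_coef; case: leqP => ab.
  rewrite -(Csum_single n (b - a) (Cpow c (b - a) / RtoC (INR (b - a)`!))%C); last by lia.
  apply: Csum_ext => i _; case: eqP => [iab|iab]; case: eqP => [jab|jab].
  - by rewrite jab; ring.
  - by exfalso; lia.
  - by exfalso; lia.
  - by ring.
rewrite /v (Csum_ext _ _ _ (fun=> RtoC 0 * 0)%C); first by rewrite Csum_scal; ring.
by move=> i _; case: eqP => [iab|_]; [exfalso; lia|ring].
Qed.

Notation slice n rho t F := (fun w => F (upd w n (RtoC (rho n) * ce t)%C)).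

(** The iterated mean over |z_i| = rho i with the last variable outermost, in the order of
    [circle_int]; coordinates from n on are 0. Each inner mean must exist for every value of the
    outer angle. *)
Fixpoint is_cavg (n : nat) (rho : nat -> R) (F : (nat -> C) -> C) (v : C) : Prop :=
  match n with
  | 0 => F (fun=> RtoC 0) = v
  | n'.+1 => exists2 g : R -> C,
      forall t, is_cavg n' rho (slice n' rho t F) (g t) & cint g v
  end.

Definition torus (n : nat) (rho : nat -> R) (w : nat -> C) : Prop :=
  forall i, (i < n)%nat -> Cmod (w i) = rho i.

Lemma torus_upd n rho w t : 0 < rho n -> torus n rho w ->
  torus n.+1 rho (upd w n (RtoC (rho n) * ce t)%C).
Proof.
move=> r0 H i; rewrite ltnS leq_eqVlt /upd; case: eqP => [->|_ /= iN]; last exact: H.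
by move=> _; apply: Cmod_circle.
Qed.

Lemma is_cavg_unique n rho F v w : is_cavg n rho F v -> is_cavg n rho F w -> v = w.
Proof.
elim: n F v w => [|n IH] F v w /=; first by move=> <- <-.
move=> [g Hg gv] [h Hh hw]; apply: (cint_unique g) => //.
by apply: cint_ext hw => t _; apply: IH (Hh t) (Hg t).
Qed.

Lemma is_cavg_ext n rho F G v : (forall i, (i < n)%nat -> 0 < rho i) ->
  (forall w, torus n rho w -> F w = G w) -> is_cavg n rho F v -> is_cavg n rho G v.
Proof.
elim: n F G v => [|n IH] F G v r0 E /=; first by move=> <-; rewrite E.
move=> [g Hg gv]; exists g => // t; apply: IH (Hg t).
  by move=> i iN; apply: r0; apply: ltnW.
by move=> w Tw; apply: E; apply: torus_upd => //; apply: r0.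
Qed.

Lemma is_cavg_const n rho c : is_cavg n rho (fun=> c) c.
Proof. by elim: n => //= n IH; exists (fun=> c) => //; apply: cint_const. Qed.

Lemma is_cavg_add n rho F G v w : is_cavg n rho F v -> is_cavg n rho G w ->
  is_cavg n rho (fun z => F z + G z)%C (v + w)%C.
Proof.
elim: n F G v w => [|n IH] F G v w /=; first by move=> -> ->.
move=> [g Hg gv] [h Hh hw]; exists (fun t => g t + h t)%C; last exact: cint_add.
by move=> t; apply: (IH (slice n rho t F) (slice n rho t G)).
Qed.

Lemma is_cavg_scal n rho c F v : is_cavg n rho F v -> is_cavg n rho (fun z => c * F z)%C (c * v)%C.
Proof.
elim: n F v => [|n IH] F v /=; first by move=> ->.
move=> [g Hg gv]; exists (fun t => c * g t)%C; last exact: cint_scal.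
by move=> t; apply: (IH (slice n rho t F)).
Qed.

Lemma is_cavg_sum (T : eqType) n rho (l : seq T) F v :
  (forall i, i \in l -> is_cavg n rho (F i) (v i)) ->
  is_cavg n rho (fun z => Csum l (fun i => F i z)) (Csum l v).
Proof.
elim: l => [|a l IH] H /=; first exact: is_cavg_const.
apply: (is_cavg_add _ _ (F a)); first by apply: H; rewrite inE eqxx.
by apply: IH => i il; apply: H; rewrite inE il orbT.
Qed.

(** Uniform convergence on the torus yields both the mean of the limit and convergence of the means
    at the same rate. As the rate does not depend on the outer angle, the one-variable statement can
    be iterated. *)
Lemma is_cavg_lim n rho (G : nat -> (nat -> C) -> C) v F e :
  (forall i, (i < n)%nat -> 0 < rho i) -> vanishing e ->
  (forall j, is_cavg n rho (G j) (v j)) ->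
  (forall j w, torus n rho w -> Cmod (G j w - F w) <= e j) ->
  exists2 u, is_cavg n rho F u & forall j, Cmod (v j - u) <= e j.
Proof.
elim: n G v F => [|n IH] G v F r0 ve Hv H.
  by exists (F (fun=> RtoC 0)) => // j; rewrite -Hv; apply: H.
have [g Hg] : exists g : nat -> R -> C, forall j,
    (forall t, is_cavg n rho (slice n rho t (G j)) (g j t)) /\ cint (g j) (v j).
  have ex j : exists g, (forall t, is_cavg n rho (slice n rho t (G j)) (g t)) /\ cint g (v j).
    by have [gj Hgj] := Hv j; exists gj.
  exact: choice_fun ex.
have slice_lim t : exists u, is_cavg n rho (slice n rho t F) u /\ forall j, Cmod (g j t - u) <= e j.
  have [||||u Hu Hu'] := IH (fun j => slice n rho t (G j)) (fun j => g j t) (slice n rho t F) => //.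
  - by move=> i iN; apply: r0; apply: ltnW.
  - by move=> j; apply: (proj1 (Hg j)).
  - by move=> j w Tw; apply: H; apply: torus_upd => //; apply: r0.
  - by exists u.
have [h Hh] := choice_fun _ _ _ slice_lim.
have [u Hu Hu'] := cint_lim g v h e ve (fun j => proj2 (Hg j)) (fun j t => proj2 (Hh t) j).
by exists u => //; exists h => // t; apply: (proj1 (Hh t)).
Qed.

Lemma is_cavg_prod n rho (g : nat -> C -> C) v :
  (forall i, (i < n)%nat -> cint (fun t => g i (RtoC (rho i) * ce t)%C) (v i)) ->
  is_cavg n rho (fun w => nprod n (fun i => g i (w i))) (nprod n v).
Proof.
elim: n => [|n IH] H //; rewrite Cprod_recr.
exists (fun t => nprod n v * g n (RtoC (rho n) * ce t)%C)%C; last first.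
  apply: (cint_scal (nprod n v) (fun t => g n (RtoC (rho n) * ce t)%C)).
  exact: H.
move=> t; set u := (RtoC (rho n) * ce t)%C.
have -> : (fun w => nprod n.+1 (fun i => g i (upd w n u i))) =
    (fun w => g n u * nprod n (fun i => g i (w i)))%C.
  apply: functional_extensionality => w; rewrite Cprod_recr /upd eqxx Cmult_comm; congr Cmult.
  by apply: Cprod_ext => i; rewrite mem_iota0 => iN; rewrite ltn_eqF.
by rewrite Cmult_comm; apply: is_cavg_scal; apply: IH => i iN; apply: H; apply: ltnW.
Qed.

(** [circle_int] inserts the factor dz_i/dt = 2 pi i z_i one level at a time; here the factors are
    collected into one product under a plain mean. *)
Lemma circle_int_cavg n rho F v :
  is_cavg n rho (fun z => F z * nprod n (fun i => RtoC (2 * PI) * Ci * z i))%C v ->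
  circle_int n rho F = v.
Proof.
elim: n F v => [|n IH] F v; first by rewrite /= => <-; ring.
move=> [g Hg gv] /=; apply: cint_RInt; apply: cint_ext gv => t _; apply/esym; apply: IH.
have := Hg t; congr is_cavg; apply: functional_extensionality => w.
rewrite Cprod_recr {3}/upd eqxx.
rewrite (Cprod_ext _ _ (fun i => RtoC (2 * PI) * Ci * w i)%C); first by ring.
by move=> i; rewrite mem_iota0 /upd => iN; rewrite ltn_eqF.
Qed.

(** * Polynomial approximation on polydiscs and Cauchy coefficients *)

Definition polydisc (n : nat) (r : R) (z : nat -> C) : Prop :=
  forall i, (i < n)%nat -> Cmod (z i) <= r.

(** Generators indexed by all naturals, zero beyond n, so that a polynomial in them sees only the
    first n variables. *)
Definition coord (n i : nat) (z : nat -> C) : C := if (i < n)%nat then z i else 0.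

Lemma coord_bounded n r i : 0 < r -> bounded_on (polydisc n r) (coord n i).
Proof.
move=> r0; exists r => z Dz; rewrite /coord; case: ifP => [iN|_]; first exact: Dz.
by rewrite Cmod_0; lra.
Qed.

(** Repeated exponents are allowed; [poly_coef] adds up their coefficients. *)
Definition polyval (l : seq (C * seq nat)) (z : nat -> C) : C :=
  Csum l (fun p => p.1 * monom p.2 z)%C.

Lemma monom_cons x m z : monom (x :: m) z = (Cpow (z 0%nat) x * monom m (fun i => z i.+1))%C.
Proof.
rewrite /monom /= -[1%nat]addn0 iotaDl; congr Cmult.
by rewrite !CprodE big_map.
Qed.

Lemma monom_coef n e z : size e = n ->
  monom e z = nprod n (fun i => Cpow (z i) (nth 0%nat e i)).
Proof. by move=> <-. Qed.

Definition madd (e f : seq nat) : seq nat := [seq (p.1 + p.2)%nat | p <- zip e f].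

Lemma size_madd n e f : size e = n -> size f = n -> size (madd e f) = n.
Proof. by move=> se sf; rewrite size_map size_zip se sf minnn. Qed.

Lemma monom_madd e f z : size e = size f -> monom (madd e f) z = (monom e z * monom f z)%C.
Proof.
elim: e f z => [|x e IH] [|y f] z //= ; first by move=> _; rewrite /monom /=; ring.
move=> [sef]; rewrite !monom_cons /= -/(madd e f) IH // Cpow_add_r; ring.
Qed.

Lemma poly_normal n P : alg (coord n) P ->
  exists l, all (fun p => size p.2 == n) l /\ forall z, P z = polyval l z.
Proof.
elim=> [c|i|F G _ [l [sl El]] _ [k [sk Ek]]|F G _ [l [sl El]] _ [k [sk Ek]]].
- exists [:: (c, nseq n 0%nat)]; rewrite /= size_nseq eqxx; split=> // z.
  rewrite /polyval /= (_ : monom _ z = 1); first by ring.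
  by elim: n z => // n IH z; rewrite /= monom_cons IH /=; ring.
- rewrite /coord; case iN: (i < n)%nat; last first.
    by exists [::]; split.
  exists [:: (RtoC 1, mkseq (fun j => nat_of_bool (j == i)) n)]; rewrite /= size_mkseq eqxx; split=> // z.
  rewrite /polyval /= (monom_coef n) ?size_mkseq // CprodE (bigD1_seq i) /=; last exact: iota_uniq.
    rewrite nth_mkseq // eqxx big_seq_cond big1.
      by rewrite mulr1 /= Cmult_1_r; Cring.
    move=> j /andP[]; rewrite mem_iota0 => jn ji.
    by rewrite nth_mkseq // (negbTE ji).
  by rewrite mem_iota.
- exists (l ++ k); rewrite all_cat sl sk; split=> // z.
  by rewrite El Ek /polyval !CsumE big_cat.
- exists [seq (p.1 * q.1, madd p.2 q.2)%C | p <- l, q <- k]; split.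
    apply/allP => _ /allpairsP[[p q] [/= pl qk ->]] /=.
    by rewrite (size_madd n) //; apply/eqP; [move/allP: sl; apply|move/allP: sk; apply].
  move=> z; rewrite El Ek /polyval !CsumE big_allpairs_dep CmultE big_distrlr /=.
  apply: eq_big_seq => p pl.
  apply: eq_big_seq => q qk.
  rewrite monom_madd; first by Cring.
  by rewrite (eqP (allP sl p pl)) (eqP (allP sk q qk)).
Qed.

(** The working notion of a holomorphic function on a closed polydisc. *)
Definition hol (n : nat) (r : R) (F : (nat -> C) -> C) : Prop := unif (polydisc n r) (coord n) F.

Lemma vanishing_inv K : 0 <= K -> vanishing (fun j => K * / (INR j + 1)).
Proof.
move=> K0; apply: vanishing_scal => //; split=> [n|eps e0].
  by apply: Rlt_le; apply: Rinv_0_lt_compat; have := pos_INR n; lra.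
have [N HN] := INR_unbounded (/ eps); exists N => n /leP /le_INR nN.
rewrite -[eps]Rinv_inv; apply: Rinv_lt_contravar; last by lra.
apply: Rmult_lt_0_compat; first exact: Rinv_0_lt_compat.
by have := pos_INR n; lra.
Qed.

Lemma hol_approx n r F : hol n r F -> exists l : nat -> seq (C * seq nat),
  forall j, all (fun p => size p.2 == n) (l j) /\
    forall z, polydisc n r z -> Cmod (polyval (l j) z - F z) <= / (INR j + 1).
Proof.
move=> hF; suff H j : exists l, all (fun p => size p.2 == n) l /\
    forall z, polydisc n r z -> Cmod (polyval l z - F z) <= / (INR j + 1) by exact: choice_fun H.
have [P aP HP] := hF (/ (INR j + 1)) ltac:(apply: Rinv_0_lt_compat; have := pos_INR j; lra).
have [l [sl El]] := poly_normal _ _ aP; exists l; split=> // z Dz.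
by rewrite -El Cmod_minus_sym; apply: HP.
Qed.

(** Here [gam i a] is the a-th moment of the weight [h i] on its circle; the mean of a monomial
    against a product weight factors into moments. *)
Lemma cavg_monom n rho (h : nat -> C -> C) gam e : size e = n ->
  (forall i a, (i < n)%nat ->
     cint (fun t => Cpow (RtoC (rho i) * ce t) a * h i (RtoC (rho i) * ce t))%C (gam i a)) ->
  is_cavg n rho (fun z => monom e z * nprod n (fun i => h i (z i)))%C
    (nprod n (fun i => gam i (nth 0%nat e i))).
Proof.
move=> se H.
have := is_cavg_prod n rho (fun i z => Cpow z (nth 0%nat e i) * h i z)%C (fun i => gam i (nth 0%nat e i))
  (fun i iN => H i _ iN).
congr is_cavg; apply: functional_extensionality => z.
by rewrite Cprod_mul (monom_coef n).
Qed.

Lemma cavg_polyval n rho (h : nat -> C -> C) gam l : all (fun p => size p.2 == n) l ->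
  (forall i a, (i < n)%nat ->
     cint (fun t => Cpow (RtoC (rho i) * ce t) a * h i (RtoC (rho i) * ce t))%C (gam i a)) ->
  is_cavg n rho (fun z => polyval l z * nprod n (fun i => h i (z i)))%C
    (Csum l (fun p => p.1 * nprod n (fun i => gam i (nth 0%nat p.2 i)))%C).
Proof.
move=> sl H.
have -> : (fun z => polyval l z * nprod n (fun i => h i (z i)))%C =
   (fun z => Csum l (fun p => p.1 * (monom p.2 z * nprod n (fun i => h i (z i)))))%C.
  apply: functional_extensionality => z; rewrite Cmult_comm -Csum_scal.
  by apply: Csum_ext => p _; ring.
apply: (is_cavg_sum _ _ _ _ (fun p z => p.1 * (monom p.2 z * nprod n (fun i => h i (z i))))%C) => p pl.
apply: is_cavg_scal; apply: cavg_monom => //.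
by apply/eqP; move/allP: sl; apply.
Qed.

(** The monomial z^{-m}, written coordinatewise so that it is a product weight for
    [cavg_polyval]. *)
Definition minv (n : nat) (m : seq nat) (z : nat -> C) : C :=
  nprod n (fun i => / Cpow (z i) (nth 0%nat m i))%C.

Definition delta (e m : seq nat) : C := RtoC (if e == m then 1 else 0).

Lemma delta_prod n e m : size e = n -> size m = n ->
  nprod n (fun i => RtoC (if nth 0%nat e i == nth 0%nat m i then 1 else 0)) = delta e m.
Proof.
move=> se sm; rewrite /delta; case: eqP => [->|ne].
  by rewrite CprodE big1 // => i _; rewrite eqxx.
have [i iN ni] : exists2 i, (i < n)%nat & nth 0%nat e i <> nth 0%nat m i.
  apply: NNPP => H; apply: ne; apply: (@eq_from_nth _ 0%nat); first by rewrite se sm.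
  move=> i; rewrite se => iN; apply: NNPP => ni; apply: H; by exists i.
rewrite CprodE (bigD1_seq i) ?mem_iota ?iota_uniq //=.
by move/eqP/negbTE: ni => ->; Cring.
Qed.

Lemma Cinv_1 : Cinv (RtoC 1) = 1.
Proof. by apply: injective_projections; rewrite /=; field. Qed.

Lemma monom_bound m rho z : 0 <= rho -> (forall i, (i < size m)%nat -> Cmod (z i) <= rho) ->
  Cmod (monom m z) <= rho ^ sumn m.
Proof.
move=> r0; elim: m z => [|x m IH] z H; first by rewrite /monom /= Cmod_1; lra.
rewrite monom_cons /= pow_add Cmod_mult; apply: Rmult_le_compat; try exact: Cmod_ge_0.
  by rewrite Cmod_pow; apply: pow_incr; split; [exact: Cmod_ge_0|exact: (H 0%nat)].
by apply: IH => i im; apply: (H i.+1).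
Qed.

Lemma minvE n m (z : nat -> C) : size m = n -> (forall i, (i < n)%nat -> z i <> 0) ->
  minv n m z = (/ monom m z)%C /\ monom m z <> 0.
Proof.
move=> <- H; rewrite /minv /monom.
have: forall i, i \in seq.iota 0 (size m) -> z i <> 0.
  by move=> i; rewrite mem_iota0; apply: H.
elim: (seq.iota _ _) => [|a l IH] Hz /=; first by rewrite Cinv_1; split=> //; case; lra.
have [|E nz] := IH; first by move=> i il; apply: Hz; rewrite inE il orbT.
have z0 : Cpow (z a) (nth 0%nat m a) <> 0 by apply: Cpow_neq0; apply: Hz; apply: mem_head.
by rewrite E; split; [field; split|apply: Cmult_neq_0].
Qed.

Lemma monom_torus m rho z : 0 <= rho -> (forall i, (i < size m)%nat -> Cmod (z i) = rho) ->
  Cmod (monom m z) = rho ^ sumn m.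
Proof.
move=> r0; elim: m z => [|x m IH] z H; first by rewrite /monom /= Cmod_1.
rewrite monom_cons /= pow_add Cmod_mult Cmod_pow (H 0%nat) // IH //.
by move=> i im; apply: (H i.+1).
Qed.

Lemma minv_torus n m rho z : size m = n -> 0 < rho -> torus n (fun=> rho) z ->
  Cmod (minv n m z) = / rho ^ sumn m.
Proof.
move=> sm r0 T; have [|E nz] := minvE n m z sm.
  by move=> i iN z0; have := T i iN; rewrite z0 Cmod_0; lra.
by rewrite E Cmod_inv // (monom_torus m rho) ?sm //; lra.
Qed.

Lemma torus_polydisc n rho r z : (forall i, (i < n)%nat -> rho i <= r) -> torus n rho z -> polydisc n r z.
Proof. by move=> H T i iN; rewrite T //; apply: H. Qed.

(** The Cauchy formula for the coefficients, on the torus all of whose radii equal r. *)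
Definition is_coefs (n : nat) (r : R) (F : (nat -> C) -> C) (c : seq nat -> C) : Prop :=
  forall m, size m = n -> is_cavg n (fun=> r) (fun z => F z * minv n m z)%C (c m).

Definition poly_coef (l : seq (C * seq nat)) (m : seq nat) : C :=
  Csum l (fun p => p.1 * delta p.2 m)%C.

Lemma polyval_coefs n r l : 0 < r -> all (fun p => size p.2 == n) l ->
  is_coefs n r (polyval l) (poly_coef l).
Proof.
move=> r0 sl m sm.
have -> : poly_coef l m = Csum l (fun p => p.1 * nprod n
    (fun i => RtoC (if nth 0%nat p.2 i == nth 0%nat m i then 1 else 0)))%C.
  by apply: Csum_ext => p pl; rewrite (delta_prod n) //; apply/eqP; move/allP: sl; apply.
apply: (cavg_polyval n (fun=> r) (fun i z => / Cpow z (nth 0%nat m i))%C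
  (fun i a => RtoC (if a == nth 0%nat m i then 1 else 0))) => // i a _.
exact: cint_pow.
Qed.

(** Since |z^{-m}| = r^{-|m|} on the torus, a uniform error e_j of the approximation becomes a
    Cauchy estimate r^{-|m|} e_j for the coefficient of z^m. *)
Lemma coefs_approx n r F l e : 0 < r -> hol n r F -> vanishing e ->
  (forall j, all (fun p => size p.2 == n) (l j) /\
    forall z, polydisc n r z -> Cmod (polyval (l j) z - F z) <= e j) ->
  exists c, is_coefs n r F c /\
    forall j m, size m = n -> Cmod (poly_coef (l j) m - c m) <= / r ^ sumn m * e j.
Proof.
move=> r0 hF ve Hl.
have rp k : 0 < / r ^ k by apply: Rinv_0_lt_compat; apply: pow_lt.
suff H m : size m = n -> exists u, is_cavg n (fun=> r) (fun z => F z * minv n m z)%C u /\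
    forall j, Cmod (poly_coef (l j) m - u) <= / r ^ sumn m * e j.
  have [c Hc] := choice_on _ _ (RtoC 0) _ _ H.
  by exists c; split=> [m sm|j m sm]; case: (Hc m sm).
move=> sm.
have [||||u Hu Hu'] := is_cavg_lim n (fun=> r) (fun j z => polyval (l j) z * minv n m z)%C
    (fun j => poly_coef (l j) m) (fun z => F z * minv n m z)%C (fun j => / r ^ sumn m * e j).
- by [].
- by apply: vanishing_scal => //; apply: Rlt_le.
- by move=> j; apply: polyval_coefs => //; case: (Hl j).
- move=> j w Tw; rewrite (_ : (_ - _ = minv n m w * (polyval (l j) w - F w))%C); last by ring.
  rewrite Cmod_mult (minv_torus n m r) //; apply: Rmult_le_compat_l; first exact: Rlt_le.
  by apply: (proj2 (Hl j)); apply: torus_polydisc Tw => i _; lra.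
- by exists u.
Qed.

Lemma is_coefs_unique n r F c c' m : is_coefs n r F c -> is_coefs n r F c' -> size m = n -> c m = c' m.
Proof. by move=> H H' sm; apply: is_cavg_unique (H m sm) (H' m sm). Qed.

Lemma coefs_exist n r F : 0 < r -> hol n r F -> exists c, is_coefs n r F c.
Proof.
move=> r0 hF; have [l Hl] := hol_approx n r F hF.
have ve := vanishing_inv 1 Rle_0_1.
have [|c [Hc _]] := coefs_approx n r F l _ r0 hF ve; last by exists c.
by move=> j; have [sl Hj] := Hl j; split=> // z Dz; rewrite Rmult_1_l; apply: Hj.
Qed.

Lemma lists_uptoS n B :
  lists_upto n.+1 B = [seq x :: s | x <- seq.iota 0 B.+1, s <- lists_upto n B].
Proof. by []. Qed.

Lemma mem_lists_upto n B s : (s \in lists_upto n B) = (size s == n) && all (fun x => (x <= B)%nat) s.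
Proof.
elim: n s => [|n IH] s; first by rewrite inE; case: s.
rewrite lists_uptoS; apply/allpairsP/idP => [[[x t] [xB tl ->]]|].
  by move: tl xB; rewrite IH mem_iota add0n ltnS => /andP[/= /eqP -> ->] ->; rewrite eqxx.
case: s => [|x t] //=; rewrite eqSS => /and3P[st xB tB].
have xi : x \in seq.iota 0 B.+1 by rewrite mem_iota add0n ltnS.
by exists (x, t); split=> //; rewrite IH st.
Qed.

Lemma uniq_lists_upto n B : uniq (lists_upto n B).
Proof.
elim: n => // n IH; rewrite lists_uptoS; apply: allpairs_uniq => //; first exact: iota_uniq.
by move=> [x s] [y t] _ _ /= [-> ->].
Qed.

Lemma bounded_on_prod n rho (h : nat -> C -> C) :
  (forall i, (i < n)%nat -> bounded_on (fun z => Cmod z = rho i) (h i)) ->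
  bounded_on (torus n rho) (fun z => nprod n (fun i => h i (z i))).
Proof.
elim: n => [|n IH] H; first by exists 1 => z _; rewrite /= Cmod_1; lra.
have [|M HM] := IH; first by move=> i iN; apply: H; apply: ltnW.
have [N HN] := H n (leqnn _); exists (M * N) => z Tz; rewrite Cprod_recr Cmod_mult.
apply: Rmult_le_compat; try exact: Cmod_ge_0.
  by apply: HM => i iN; apply: Tz; apply: ltnW.
by apply: HN; apply: Tz.
Qed.

(** For polynomials this is linearity, and both sides are continuous in F: the left by uniform
    convergence on the torus, the right by the Cauchy estimates, the sum being finite because
    moments beyond B vanish. The radii [rho] may differ from the r that defines [c], so independence
    of the radii is contained here. *)
Lemma cavg_expand n r F c rho (h : nat -> C -> C) gam B : 0 < r -> hol n r F -> is_coefs n r F c ->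
  (forall i, (i < n)%nat -> 0 < rho i <= r) ->
  (forall i a, (i < n)%nat ->
     cint (fun t => Cpow (RtoC (rho i) * ce t) a * h i (RtoC (rho i) * ce t))%C (gam i a)) ->
  (forall i a, (i < n)%nat -> (B < a)%nat -> gam i a = 0) ->
  (forall i, (i < n)%nat -> bounded_on (fun z => Cmod z = rho i) (h i)) ->
  is_cavg n rho (fun z => F z * nprod n (fun i => h i (z i)))%C
    (Csum (lists_upto n B) (fun m => c m * nprod n (fun i => gam i (nth 0%nat m i)))%C).
Proof.
move=> r0 hF Hc Hr Hg gB hb.
have [l Hl] := hol_approx n r F hF.
have ve := vanishing_inv 1 Rle_0_1; set e := (fun j => _) in ve.
have He j : all (fun p => size p.2 == n) (l j) /\
    forall z, polydisc n r z -> Cmod (polyval (l j) z - F z) <= e j.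
  by have [sl Hj] := Hl j; split=> // z Dz; rewrite /e Rmult_1_l; apply: Hj.
have [c' [Hc' Hcc']] := coefs_approx n r F l e r0 hF ve He.
have [M M0 HM] := bounded_onP _ _ (bounded_on_prod n rho h hb).
pose g m := nprod n (fun i => gam i (nth 0%nat m i)).
pose v j := Csum (lists_upto n B) (fun m => poly_coef (l j) m * g m)%C.
have Hv j : is_cavg n rho (fun z => polyval (l j) z * nprod n (fun i => h i (z i)))%C (v j).
  have [sl _] := He j; have := cavg_polyval n rho h gam (l j) sl Hg.
  congr is_cavg; rewrite /v /poly_coef.
  rewrite !CsumE.
  under [RHS]eq_bigr => m _ do rewrite CsumE CmultE big_distrl /=.
  rewrite exchange_big /=; apply: eq_big_seq => p pl.
  have sp : size p.2 = n by apply/eqP; move/allP: sl; apply.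
  rewrite -/(g p.2).
  case: (boolP (p.2 \in lists_upto n B)) => pB.
    rewrite (bigD1_seq p.2) ?uniq_lists_upto //= big1 ?addr0.
      by rewrite /delta eqxx; Cring.
    by move=> m; rewrite eq_sym /delta => /negbTE ->; Cring.
  (* An exponent outside the box exceeds B in some coordinate and meets a vanishing moment there. *)
  have g0 : g p.2 = 0.
    move: pB; rewrite mem_lists_upto sp eqxx /= => /allPn[x /(nthP 0%nat)[i ip <-]].
    rewrite -ltnNge => Bx; rewrite /g CprodE (bigD1_seq i) ?iota_uniq ?mem_iota //=; last by rewrite -sp.
    by rewrite gB //; [Cring|rewrite -sp].
  rewrite g0 big_seq big1; first by Cring.
  move=> m mB; rewrite /delta; case: eqP => [E|_]; last by Cring.
  by rewrite E mB in pB.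
have [|||u Hu Hu'] := is_cavg_lim n rho _ v (fun z => F z * nprod n (fun i => h i (z i)))%C
    (fun j => M * e j) _ _ Hv.
- by move=> i /Hr; lra.
- by apply: vanishing_scal => //; lra.
- move=> j w Tw; rewrite (_ : (_ - _ = nprod n (fun i => h i (w i)) * (polyval (l j) w - F w))%C); last by ring.
  rewrite Cmod_mult; apply: Rmult_le_compat; try exact: Cmod_ge_0; first exact: HM.
  by apply: (proj2 (He j)); apply: torus_polydisc Tw => i /Hr; lra.
suff <- : u = Csum (lists_upto n B) (fun m => c m * g m)%C by [].
apply: (Ccv_unique v); first by apply: Ccv_vanishing Hu'; apply: vanishing_scal => //; lra.
(* The coefficient errors, weighted by the moments, add up to at most K times e_j. *)
pose K := foldr (fun m s => / r ^ sumn m * Cmod (g m) + s) 0 (lists_upto n B).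
have K0 : 0 <= K.
  rewrite /K; elim: (lists_upto n B) => [|m s IH] /=; first by lra.
  apply: Rplus_le_le_0_compat => //; apply: Rmult_le_pos; last exact: Cmod_ge_0.
  by apply: Rlt_le; apply: Rinv_0_lt_compat; apply: pow_lt.
apply: (Ccv_vanishing _ _ (fun j => K * e j)); first exact: vanishing_scal.
move=> j; rewrite (_ : (_ - _)%C = Csum (lists_upto n B) (fun m => (poly_coef (l j) m - c m) * g m)%C); last first.
  rewrite /v; elim: (lists_upto n B) => [|m s IH] /=; first by ring.
  by rewrite -IH; ring.
apply: Rle_trans (Cmod_sum _ _ _ (fun m => / r ^ sumn m * Cmod (g m) * e j) _) _.
  move=> m; rewrite mem_lists_upto => /andP[/eqP sm _].
  rewrite Cmod_mult (is_coefs_unique n r F c c') //.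
  have := Hcc' j m sm; have := Cmod_ge_0 (g m) => g0 Hm.
  by apply: Rle_trans (Rmult_le_compat_r _ _ _ g0 Hm) _; apply: Req_le; ring.
rewrite /K; elim: (lists_upto n B) => [|m s IH] /=; first by rewrite Rmult_0_l; lra.
by rewrite Rmult_plus_distr_r; apply: Rplus_le_compat => //; apply: Rle_refl.
Qed.

Lemma hol_coord n r j : (j < n)%nat -> hol n r (fun z => z j).
Proof. by move=> jn; apply: unif_ext (unif_gen _ _ j) => z _; rewrite /coord jn. Qed.

(** * Taylor expansions: existence and uniqueness *)

Lemma compsS n d :
  comps n.+1 d = [seq x :: s | x <- seq.iota 0 d.+1, s <- comps n (d - x)%nat].
Proof. by []. Qed.

Lemma mem_comps n d s : (s \in comps n d) = (size s == n) && (sumn s == d).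
Proof.
elim: n d s => [|n IH] d s.
  by rewrite /comps; case: eqP => [->|/eqP d0]; case: s => //=; rewrite ?in_nil // eq_sym (negbTE d0).
rewrite compsS; apply/allpairsPdep/idP => [[x [t [xd td ->]]]|].
  move: td xd; rewrite IH mem_iota add0n ltnS => /andP[/eqP st /eqP sd] /andP[_ xd] /=.
  by rewrite st eqxx sd subnKC /=.
case: s => [|x t] //= /andP[]; rewrite eqSS => st /eqP sd.
have xi : x \in seq.iota 0 d.+1 by rewrite mem_iota add0n ltnS -sd leq_addr.
by exists x, t; split=> //; rewrite IH st -sd addKn eqxx.
Qed.

Lemma uniq_comps n d : uniq (comps n d).
Proof.
elim: n d => [|n IH] d; first by rewrite /comps; case: eqP.
rewrite compsS; apply: allpairs_uniq_dep => //; first exact: iota_uniq.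
by move=> [x s] [y t] _ _ /= [-> ->].
Qed.

(** A crude count of the monomials of degree d, sufficient because the expansion is only claimed on
    a quarter of the radius. *)
Lemma size_comps n d : (size (comps n d) <= expn 2 (n + d))%nat.
Proof.
elim: n d => [|n IH] d; first by rewrite /comps; case: eqP => _ //=; apply: expn_gt0.
rewrite compsS size_allpairs_dep sumnE big_map.
apply: (@leq_trans (\sum_(x <- seq.iota 0 d.+1) expn 2 (n + (d - x)))).
  by apply: leq_sum => x _; apply: IH.
elim: d => [|d IHd]; first by rewrite big_seq1 !addn0 leq_exp2l.
rewrite -[d.+2]add1n iotaD big_cat big_seq1 subn0 -[(0 + 1)%nat]addn0 iotaDl big_map.
rewrite addSn expnS mul2n -addnn leq_add //; have <- : (n.+1 + d = n + d.+1)%nat by rewrite addSnnS.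
by apply: leq_trans IHd; apply: leq_sum => x _; rewrite leq_exp2l //; lia.
Qed.

Lemma INR_exp2 k : INR (expn 2 k) = 2 ^ k.
Proof. by elim: k => // k IH; rewrite expnS mult_INR IH. Qed.

Definition taylor_sum (n D : nat) (c : seq nat -> C) (z : nat -> C) : C :=
  nsum D (fun d => Csum (comps n d) (fun m => c m * monom m z)%C).

(** At |z_i| <= r/4 a monomial of degree d contributes at most K 4^{-d}, and there are at most
    2^{n+d} of them; the degree-d parts are then dominated by K 2^n 2^{-d}. The bound does not
    depend on D. *)
Lemma taylor_sum_bound n D c z K r : 0 <= K -> 0 < r ->
  (forall m, size m = n -> Cmod (c m) <= / r ^ sumn m * K) ->
  (forall i, (i < n)%nat -> Cmod (z i) <= r / 4) ->
  Cmod (taylor_sum n D c z) <= K * 2 ^ n.+1.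
Proof.
move=> K0 r0 Hc Hz.
have rp k : 0 < / r ^ k by apply: Rinv_0_lt_compat; apply: pow_lt.
have Hd d : Cmod (Csum (comps n d) (fun m => c m * monom m z)%C) <= K * (2 ^ n * (/ 2) ^ d).
  apply: Rle_trans (Cmod_sum _ _ _ (fun=> K * (/ 4) ^ d) _) _.
    move=> m; rewrite mem_comps => /andP[/eqP sm /eqP dm]; rewrite Cmod_mult.
    apply: (Rle_trans _ (/ r ^ sumn m * K * (r / 4) ^ sumn m)).
      apply: Rmult_le_compat; try exact: Cmod_ge_0; first exact: Hc.
      by apply: monom_bound; [lra|rewrite sm].
    apply: Req_le; rewrite dm /Rdiv Rpow_mult_distr.
    by have := pow_lt r d r0; move=> ?; field; lra.
  apply: (Rle_trans _ (INR (size (comps n d)) * (K * (/ 4) ^ d))).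
    apply: Req_le; elim: (comps n d) => [|m s IH]; first by rewrite /= Rmult_0_l.
    by rewrite [size _]/= S_INR /= IH; ring.
  have s2 : INR (size (comps n d)) <= 2 ^ (n + d).
    by rewrite -INR_exp2; apply: le_INR; apply/leP; apply: size_comps.
  have p4 : 0 <= K * (/ 4) ^ d by apply: Rmult_le_pos => //; apply: pow_le; lra.
  apply: Rle_trans (Rmult_le_compat_r _ _ _ p4 s2) _; apply: Req_le.
  rewrite pow_add (_ : / 4 = / 2 * / 2); last by field.
  rewrite Rpow_mult_distr -[in RHS](Rmult_1_r ((/ 2) ^ d)).
  have -> : 1 = 2 ^ d * (/ 2) ^ d by rewrite -Rpow_mult_distr Rinv_r ?pow1 //; lra.
  by ring.
have : forall D, Cmod (taylor_sum n D c z) <= K * 2 ^ n * (2 - 2 * (/ 2) ^ D).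
  elim=> [|{}D IH]; first by rewrite /taylor_sum /= Cmod_0; lra.
  rewrite /taylor_sum Csum_recr; apply: Rle_trans (Cmod_triangle _ _) _.
  have := Hd D; have := IH; rewrite /taylor_sum /=; lra.
move=> /(_ D) H; apply: Rle_trans H _; rewrite -tech_pow_Rmult.
have h : 0 < (/ 2) ^ D by apply: pow_lt; lra.
have k2 : 0 <= K * 2 ^ n by apply: Rmult_le_pos => //; apply: pow_le; lra.
by nra.
Qed.

Lemma taylor_sum_poly n D l z : all (fun p => size p.2 == n) l ->
  all (fun p => (sumn p.2 < D)%nat) l -> taylor_sum n D (poly_coef l) z = polyval l z.
Proof.
move=> sl Dl; rewrite /taylor_sum /polyval /poly_coef !CsumE.
under eq_bigr => d _ do (rewrite CsumE; under eq_bigr => m _ do rewrite CsumE CmultE big_distrl /=).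
under eq_bigr => d _ do rewrite exchange_big /=.
rewrite exchange_big /=; apply: eq_big_seq => p pl.
have sp := allP sl p pl; have dp := allP Dl p pl.
rewrite (bigD1_seq (sumn p.2)) ?iota_uniq ?mem_iota //= (bigD1_seq p.2) ?uniq_comps ?mem_comps ?sp ?eqxx //=.
rewrite [X in (_ + X + _)%ring]big1 ?[X in (_ + X)%ring]big1 ?addr0.
- by rewrite /delta eqxx; Cring.
- move=> d nd; rewrite big_seq big1 // => m; rewrite mem_comps => /andP[_ /eqP dm].
  by rewrite /delta; case: eqP => [E|_]; [rewrite -dm -E eqxx in nd|Cring].
- by move=> m; rewrite eq_sym /delta => /negbTE ->; Cring.
Qed.

(** Taylor sums reproduce an approximating polynomial exactly once D exceeds its degree. The Taylor
    sum of the coefficient differences is bounded uniformly in D by the approximation error, so the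
    same polynomial is close to both F and its Taylor sums. *)
Lemma hol_taylor n r F c dom : 0 < r -> hol n r F -> is_coefs n r F c ->
  is_taylor_expansion n dom F c.
Proof.
move=> r0 hF Hc; exists (r / 4); split; first by lra.
move=> z Hz _; apply/CcvP => eta e0; rewrite -/(taylor_sum _ _ _ _).
have [l Hl] := hol_approx n r F hF.
pose e j := 1 * / (INR j + 1); have ve : vanishing e := vanishing_inv 1 Rle_0_1.
have [||c' [Hc' Hcc']] := coefs_approx n r F l e r0 hF.
- exact: ve.
- by move=> j; have [sl Hj] := Hl j; split=> // w Dw; rewrite /e Rmult_1_l; apply: Hj.
have p2 : 0 < 2 ^ n.+1 by apply: pow_lt; lra.
have [vp Hv] := ve.
have [j Hj] := Hv (eta / (2 ^ n.+1 + 1)) ltac:(apply: Rdiv_lt_0_compat; lra).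
have {Hj}ej := Hj j (leqnn j).
have [sl Hlj] := Hl j.
(* Beyond all degrees occurring in the j-th approximating polynomial. *)
pose D0 := (\max_(p <- l j) sumn p.2).+1.
exists D0 => D D0D.
have tp : taylor_sum n D (poly_coef (l j)) z = polyval (l j) z.
  apply: taylor_sum_poly => //; apply/allP => p pl.
  by apply: leq_trans D0D; rewrite /D0 ltnS; apply: leq_bigmax_seq.
have Dz : polydisc n r z by move=> i iN; have := Hz i iN; lra.
have b1 : Cmod (taylor_sum n D (fun m => c m - poly_coef (l j) m)%C z) <= e j * 2 ^ n.+1.
  apply: (taylor_sum_bound _ _ _ _ _ r) => //.
  - move=> m sm; rewrite Cmod_minus_sym (is_coefs_unique n r F c c') //; exact: Hcc'.
  - by move=> i iN; apply: Rlt_le; apply: Hz.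
have E : (taylor_sum n D c z - polyval (l j) z = taylor_sum n D (fun m => c m - poly_coef (l j) m)%C z)%C.
  rewrite -tp /taylor_sum; elim: (seq.iota 0 D) => [|d s IH] /=; first by ring.
  rewrite -IH; set A := Csum s _; set B := Csum s _.
  suff -> : Csum (comps n d) (fun m => (c m - poly_coef (l j) m) * monom m z)%C =
    (Csum (comps n d) (fun m => c m * monom m z) - Csum (comps n d) (fun m => poly_coef (l j) m * monom m z))%C by ring.
  by elim: (comps n d) => [|m t IHt] /=; [ring|rewrite IHt; ring].
apply: Rle_lt_trans (Cmod_triangle3 _ (polyval (l j) z) _) _.
rewrite E; have := Hlj z Dz; rewrite -[/ (_ + 1)]Rmult_1_l -/(e j) => b2.
apply: (Rle_lt_trans _ (e j * (2 ^ n.+1 + 1))); first by lra.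
have -> : eta = eta / (2 ^ n.+1 + 1) * (2 ^ n.+1 + 1) by field; lra.
by apply: Rmult_lt_compat_r => //; lra.
Qed.

Lemma Ccv_bounded u L : Ccv u L -> exists2 M, 0 < M & forall n, Cmod (u n) <= M.
Proof.
move=> H; have [N HN] := H 1 Rlt_0_1.
suff [M HM] : exists M, forall n, (n < N)%nat -> Cmod (u n) <= M.
  exists (Rmax M (1 + Cmod L)); first by have := Rmax_r M (1 + Cmod L); have := Cmod_ge_0 L; lra.
  move=> n; case: (ltnP n N) => [nN|/HN nN]; first by have := HM n nN; have := Rmax_l M (1 + Cmod L); lra.
  have := Cmod_triangle (u n - L) L; rewrite (_ : (u n - L + L)%C = u n); last by ring.
  by have := Rmax_r M (1 + Cmod L); lra.
elim: N {HN} => [|N [M HM]]; first by exists 0.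
exists (Rmax M (Cmod (u N))) => n; rewrite ltnS leq_eqVlt => /orP[/eqP->|/HM]; first exact: Rmax_r.
by have := Rmax_l M (Cmod (u N)); lra.
Qed.

Lemma Ccv_sub u v L M : Ccv u L -> Ccv v M -> Ccv (fun n => u n - v n)%C (L - M)%C.
Proof.
move=> Hu Hv eps e0; have [N HN] := Hu (eps / 2) ltac:(lra); have [K HK] := Hv (eps / 2) ltac:(lra).
exists (maxn N K) => n; rewrite geq_max => /andP[/HN a /HK b].
rewrite (_ : (_ - _ = (u n - L) - (v n - M))%C); last by ring.
by apply: Rle_lt_trans (Cmod_triangle _ _) _; rewrite Cmod_opp; lra.
Qed.

(** Convergence at t = 1 bounds the coefficients; a first nonzero coefficient would then dominate
    the series for small t. *)
Lemma pseries_unique0 (g : nat -> C) :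
  (forall t, 0 < t <= 1 -> Ccv (fun D => nsum D (fun d => RtoC (t ^ d) * g d)%C) 0) ->
  forall d, g d = 0.
Proof.
move=> H.
have [M M0 HM] : exists2 M, 0 < M & forall d, Cmod (g d) <= M.
  have [M M0 HM] := Ccv_bounded _ _ (H 1 ltac:(lra)).
  exists (2 * M) => [|d]; first by lra.
  have := Cmod_triangle (nsum d.+1 (fun d => RtoC (1 ^ d) * g d)%C)
    (- nsum d (fun d => RtoC (1 ^ d) * g d)%C).
  rewrite Cmod_opp; have := HM d; have := HM d.+1; rewrite Csum_recr pow1.
  rewrite (_ : (_ + _ + _)%C = g d); last by ring.
  by lra.
elim/ltn_ind => d IH; apply: Cmod_eq_0; apply: Rle_antisym; last exact: Cmod_ge_0.
apply: Rnot_lt_le => gd.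
(* With t <= |g d| / (4M) and t <= 1/2 the tail is at most 2 M t t^d, which is at most half of |g d|
   t^d. *)
pose t := Rmin (/ 2) (Cmod (g d) / (4 * M)).
have t0 : 0 < t by apply: Rmin_pos; [lra|apply: Rdiv_lt_0_compat; lra].
have t2 : t <= / 2 by apply: Rmin_l.
have tM : 4 * M * t <= Cmod (g d).
  have : t <= Cmod (g d) / (4 * M) by apply: Rmin_r.
  move=> h; apply: Rle_trans (Rmult_le_compat_l (4 * M) _ _ _ h) _; first by lra.
  by apply: Req_le; field; lra.
have td : 0 < t ^ d by apply: pow_lt.
pose S D := nsum D (fun d => RtoC (t ^ d) * g d)%C.
have tail k : Cmod (S (d.+1 + k)%nat - RtoC (t ^ d) * g d)%C <= M * t ^ d * (2 * t - 2 * t * t ^ k).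
  elim: k => [|k IHk].
    rewrite addn0 /S Csum_recr (Csum_ext _ _ _ (fun=> RtoC 0 * 0)%C).
      rewrite Csum_scal (_ : (_ - _)%C = 0) ?Cmod_0; last by ring.
      by rewrite /=; lra.
    by move=> i; rewrite mem_iota0 => /IH ->; ring.
  rewrite addnS /S Csum_recr -/(S _) (_ : (_ + _ - _ = (S (d.+1 + k)%nat - RtoC (t ^ d) * g d) + RtoC (t ^ (d.+1 + k)) * g (d.+1 + k)%nat)%C); last by ring.
  apply: Rle_trans (Cmod_triangle _ _) _; rewrite Cmod_mult Cmod_R Rabs_pos_eq; last by apply: pow_le; lra.
  have := HM (d.+1 + k)%nat => h.
  have tk : 0 < t ^ k by apply: pow_lt.
  have : t ^ (d.+1 + k) * Cmod (g (d.+1 + k)%nat) <= t ^ (d.+1 + k) * M.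
    by apply: Rmult_le_compat_l => //; apply: pow_le; lra.
  rewrite pow_add -!tech_pow_Rmult.
  have : 0 <= (M * t ^ d * t * t ^ k) * (1 - 2 * t).
    by apply: Rmult_le_pos; [repeat apply: Rmult_le_pos; lra|lra].
  by lra.
have [N HN] := H t ltac:(lra) (t ^ d * (Cmod (g d) / 4)) ltac:(apply: Rmult_lt_0_compat; lra).
have := HN (d.+1 + N)%nat (leq_addl _ _); rewrite -/(S _) => h.
have := tail N; have tN : 0 < t ^ N by apply: pow_lt.
have := Cmod_triangle3 (RtoC (t ^ d) * g d) (S (d.+1 + N)%nat) 0.
rewrite (_ : (_ * _ - 0)%C = (RtoC (t ^ d) * g d)%C); last by ring.
rewrite Cmod_mult Cmod_R Rabs_pos_eq; last by lra.
rewrite (Cmod_minus_sym (RtoC _ * _)).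
have : M * t ^ d * (2 * t - 2 * t * t ^ N) <= t ^ d * (Cmod (g d) / 2).
  have : 0 <= M * t ^ d * t * t ^ N by repeat apply: Rmult_le_pos; lra.
  have : 0 <= t ^ d * (Cmod (g d) - 4 * M * t) by apply: Rmult_le_pos; lra.
  by lra.
have : 0 < t ^ d * Cmod (g d) by apply: Rmult_lt_0_compat.
by lra.
Qed.

Lemma monom_scal m t (z : nat -> C) : monom m (fun i => RtoC t * z i)%C = (RtoC (t ^ sumn m) * monom m z)%C.
Proof.
elim: m z => [|x m IH] z; first by rewrite /monom /=; ring.
by rewrite !monom_cons /= IH pow_add RtoC_mult Cpow_mult_l !RtoC_pow; ring.
Qed.

(** On a torus with pairwise different radii all real rescalings stay in [dom]. Uniqueness of power
    series in the scaling parameter makes each homogeneous part of the difference vanish on that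
    torus, and averaging against z^{-m} isolates each coefficient. *)
Lemma taylor_unique n dom F c c' :
  (forall z : nat -> C, (forall i j, (i < n)%nat -> (j < n)%nat -> i <> j -> Cmod (z i) <> Cmod (z j)) -> dom z) ->
  is_taylor_expansion n dom F c -> is_taylor_expansion n dom F c' ->
  forall m, size m = n -> c m = c' m.
Proof.
move=> Hdom [e1 [e10 H1]] [e2 [e20 H2]].
pose e := Rmin e1 e2; have e0 : 0 < e by apply: Rmin_pos.
pose H d z := Csum (comps n d) (fun m => (c m - c' m) * monom m z)%C.
(* Any injective choice of radii below e would do; distinct radii keep the torus off the
   diagonals. *)
pose rho (i : nat) := e / (INR i + 2).
have rho0 i : 0 < rho i < e.
  have := pos_INR i => i0; split; first by apply: Rdiv_lt_0_compat; lra.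
  apply: (Rmult_lt_reg_r (INR i + 2)); first by lra.
  by rewrite /rho /Rdiv Rmult_assoc Rinv_l; nra.
have rhoI i j : rho i = rho j -> i = j.
  have i0 := pos_INR i; have j0 := pos_INR j.
  move=> E; apply: INR_eq; have : e * (INR i + 2) = e * (INR j + 2).
    have -> : e * (INR i + 2) = rho j * (INR j + 2) * (INR i + 2) by rewrite /rho; field; lra.
    by rewrite -E /rho; field; lra.
  by move/Rmult_eq_reg_l; lra.
have H0 d z : torus n rho z -> H d z = 0.
  move=> Tz; move: d; apply: pseries_unique0 => t Ht.
  pose w i := (RtoC t * z i)%C.
  have we i : (i < n)%nat -> Cmod (w i) < e.
    move=> iN; rewrite /w Cmod_mult Cmod_R Rabs_pos_eq ?Tz //; last by lra.
    by have := rho0 i; nra.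
  have dw : dom w.
    apply: Hdom => i j iN jN ij; rewrite /w !Cmod_mult !Tz // => /Rmult_eq_reg_l E.
    by apply: ij; apply: rhoI; apply: E; rewrite Cmod_R Rabs_pos_eq; lra.
  have /CcvP A1 := H1 w (fun i iN => Rlt_le_trans _ _ _ (we i iN) (Rmin_l e1 e2)) dw.
  have /CcvP A2 := H2 w (fun i iN => Rlt_le_trans _ _ _ (we i iN) (Rmin_r e1 e2)) dw.
  have := Ccv_sub _ _ _ _ A1 A2; rewrite (_ : (F w - F w)%C = 0); last by ring.
  congr Ccv; apply: functional_extensionality => D.
  elim: (seq.iota 0 D) => [|d s IH] /=; first by ring.
  rewrite -IH; set A := Csum s _; set B := Csum s _.
  suff -> : (RtoC (t ^ d) * H d z = Csum (comps n d) (fun m => c m * monom m w) - Csum (comps n d) (fun m => c' m * monom m w))%C by ring.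
  rewrite /H -Csum_scal.
  have : forall m, m \in comps n d -> sumn m = d by move=> m; rewrite mem_comps => /andP[_ /eqP].
  elim: (comps n d) => [|m l IHl] Hl /=; first by ring.
  rewrite IHl; last by move=> p pl; apply: Hl; rewrite inE pl orbT.
  by rewrite /w monom_scal (Hl m (mem_head _ _)); ring.
move=> m sm.
suff : (c m - c' m)%C = 0.
  move=> E; have -> : c m = (c m - c' m + c' m)%C by ring.
  by rewrite E Cplus_0_l.
pose l := [seq ((c p - c' p)%C, p) | p <- comps n (sumn m)].
have sl : all (fun p => size p.2 == n) l.
  by apply/allP => _ /mapP[p pm ->]; move: pm; rewrite mem_comps => /andP[].
have := cavg_polyval n rho (fun i z => / Cpow z (nth 0%nat m i))%C
  (fun i a => RtoC (if a == nth 0%nat m i then 1 else 0)) l sl (fun i a _ => cint_pow _ _ _ (proj1 (rho0 i))).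
have Z : is_cavg n rho (fun z => polyval l z * nprod n (fun i => / Cpow (z i) (nth 0%nat m i)))%C 0.
  apply: is_cavg_ext (is_cavg_const n rho 0); first by move=> i _; apply: (proj1 (rho0 i)).
  move=> w /(H0 (sumn m)) Hw; rewrite /polyval CsumE big_map -CsumE -/(H _ _) Hw; ring.
move=> /(is_cavg_unique _ _ _ _ _ Z) ->; rewrite CsumE big_map.
rewrite (bigD1_seq m) ?uniq_comps ?mem_comps ?sm ?eqxx //= big_seq_cond big1 ?addr0.
  by rewrite (delta_prod n) // /delta eqxx; ring.
move=> p; rewrite mem_comps => /andP[/andP[/eqP sp _] pm].
by rewrite (delta_prod n) // /delta (negbTE pm); Cring.
Qed.

(** * The function s zeta(1 + s) near s = 0 *)

Lemma Cmod_Cpowr p s : Cmod (Cpowr p s) = exp (Re s * ln p).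
Proof.
rewrite /Cpowr Cmod_Cexp; congr exp.
by rewrite /Re /Im /=; ring.
Qed.

Lemma Cpowr_add p s t : Cpowr p (s + t)%C = (Cpowr p s * Cpowr p t)%C.
Proof. by rewrite /Cpowr -Cexp_add; congr Cexp; ring. Qed.

Lemma Cpowr_opp p s : Cpowr p (- s)%C = (/ Cpowr p s)%C.
Proof. by rewrite /Cpowr -Cexp_opp; congr Cexp; ring. Qed.

Lemma Re_bound (z : C) : - Cmod z <= Re z <= Cmod z.
Proof. by have := re_le_Cmod z; have := Rle_abs (Re z); have := Rle_abs (- Re z); rewrite Rabs_Ropp; lra. Qed.

Lemma ln_ge0 x : 1 <= x -> 0 <= ln x.
Proof. by move=> [x1|<-]; [rewrite -ln_1; apply: Rlt_le; apply: ln_increasing; lra|rewrite ln_1; lra]. Qed.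

Lemma ln_succ_diff x : 0 < x -> 0 <= ln (x + 1) - ln x <= / x.
Proof.
move=> x0; split; first by have := ln_increasing x (x + 1) x0 ltac:(lra); lra.
have x1 : 0 < 1 + / x by have := Rinv_0_lt_compat x x0; lra.
have -> : x + 1 = x * (1 + / x) by field; lra.
rewrite ln_mult //; have := exp_ineq1_le (ln (1 + / x)); rewrite exp_ln //.
by lra.
Qed.

Lemma Rpower_neg_antitone x y a : 0 < x <= y -> 0 <= a -> Rpower y (- a) <= Rpower x (- a).
Proof.
move=> xy a0; rewrite !Rpower_Ropp; apply: Rinv_le_contravar; first exact: Rpower_pos.
by apply: Rle_Rpower_l.
Qed.

Lemma Rpower_half x y : 0 < y -> y / 2 <= x -> Rpower x (- (5 / 4)) <= 4 * Rpower y (- (5 / 4)).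
Proof.
move=> y0 xy; apply: (Rle_trans _ (Rpower (y * / 2) (- (5 / 4)))).
  by apply: Rpower_neg_antitone; lra.
rewrite -Rpower_mult_distr ?(Rmult_comm 4); try lra.
apply: Rmult_le_compat_l; first by apply: Rlt_le; apply: Rpower_pos.
have -> : Rpower (/ 2) (- (5 / 4)) = Rpower 2 (5 / 4).
  by rewrite /Rpower ln_Rinv; [congr exp; ring|lra].
apply: Rle_trans (Rle_Rpower 2 (5 / 4) 2 _ _) _; try lra.
by rewrite (_ : 2 = INR 2) // Rpower_pow /=; lra.
Qed.

(** The difference is x^{-w} (1 - e^y) with |y| <= 2/x, which gains a factor 1/x. The real part of w
    is at least 5/6, but |x^{-w}| is only bounded by x^{-1/4}, so that the exponent 5/4 of [tailmaj]
    appears. *)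
Lemma Cpowr_succ_diff x w : 1 <= x -> Cmod (w - 1) <= / 6 ->
  Cmod (Cpowr x (- w) - Cpowr (x + 1) (- w)) <= 4 * exp 2 * Rpower x (- (5 / 4)).
Proof.
move=> x1 w1.
have [l0 l1] := ln_succ_diff x ltac:(lra); set l := ln (x + 1) - ln x in l0 l1.
have x0 : 0 < / x <= 1.
  by split; [apply: Rinv_0_lt_compat; lra|rewrite -Rinv_1; apply: Rinv_le_contravar; lra].
have Rw : 5 / 6 <= Re w.
  by have := Re_bound (w - 1); rewrite /Re /=; lra.
have w2 : Cmod w <= 2.
  have := Cmod_triangle (w - 1) 1; rewrite Cmod_1 (_ : (w - 1 + 1)%C = w); first by lra.
  by ring.
pose y := (- w * RtoC l)%C.
have -> : (Cpowr x (- w) - Cpowr (x + 1) (- w))%C = (Cpowr x (- w) * - (Cexp y - 1))%C.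
  have -> : Cpowr (x + 1) (- w) = (Cpowr x (- w) * Cexp y)%C.
    rewrite /Cpowr -Cexp_add /y -Cmult_plus_distr_l -RtoC_plus; congr (Cexp (_ * RtoC _)).
    by rewrite /l; ring.
  by ring.
have yb : Cmod y <= 2 * / x.
  rewrite /y Cmod_mult Cmod_opp Cmod_R Rabs_pos_eq //.
  by apply: Rmult_le_compat => //; apply: Cmod_ge_0.
have y2 : Cmod y <= 2 by lra.
rewrite Cmod_mult Cmod_opp Cmod_Cpowr.
have px : exp (Re (- w)%C * ln x) <= Rpower x (- (1 / 4)).
  rewrite /Rpower; apply: exp_le; rewrite /Re /=.
  by have := ln_ge0 x x1; rewrite -/(Re w); nra.
have b : Cmod (Cexp y - 1) <= 4 * exp 2 * / x.
  apply: Rle_trans (Cexp_near1 y) _.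
  have -> : 4 * exp 2 * / x = 2 * exp 2 * (2 * / x) by ring.
  apply: Rmult_le_compat => //; [by have := exp_pos (Cmod y); lra|exact: Cmod_ge_0|].
  by have := exp_le _ _ y2; lra.
have -> : - (5 / 4) = - (1 / 4) + - 1 by field.
rewrite Rpower_plus Rpower_Ropp Rpower_Ropp Rpower_1 -?Rpower_Ropp; last by lra.
have -> : 4 * exp 2 * (Rpower x (- (1 / 4)) * / x) = Rpower x (- (1 / 4)) * (4 * exp 2 * / x) by ring.
apply: Rmult_le_compat => //; [by apply: Rlt_le; apply: exp_pos|exact: Cmod_ge_0].
Qed.

Definition disc (d : R) (s : C) : Prop := Cmod s <= d.
Definition disc_coord (_ : unit) (s : C) : C := s.

Lemma disc_bounded d i : bounded_on (disc d) (disc_coord i).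
Proof. by exists d. Qed.

Definition eta_term (s : C) (n : nat) : C :=
  (RtoC ((-1) ^ n) * Cpowr (INR n.+1) (- (1 + s)))%C.

Definition eta_sum (s : C) (N : nat) : C := nsum N (eta_term s).

Lemma eta_term_bound s n : Cmod s <= / 6 -> Cmod (eta_term s n) <= tailmaj n.
Proof.
move=> s1; rewrite /eta_term Cmod_mult Cmod_R pow_1_abs Rmult_1_l Cmod_Cpowr.
have n0 := pos_INR n; rewrite S_INR.
apply: (Rle_trans _ (Rpower (INR n + 1) (- / 4))).
  rewrite /Rpower; apply: exp_le; rewrite /Re /=.
  have := ln_ge0 (INR n + 1) ltac:(lra); have := Re_bound s; rewrite /Re; nra.
by rewrite /tailmaj; have := Rpower_pos (INR n + 1) (- / 4); lra.
Qed.

(** Terms 2m and 2m+1 form a difference of consecutive powers. One factor 4 comes from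
    [Cpowr_succ_diff], the other from replacing 2m + 1 by m + 2 through [Rpower_half]. *)
Lemma eta_pair s m : Cmod s <= / 6 ->
  Cmod (eta_sum s (2 * m.+1) - eta_sum s (2 * m)) <=
  16 * exp 2 * tailmaj m - 16 * exp 2 * tailmaj m.+1.
Proof.
move=> s1; have m0 := pos_INR m.
have -> : (2 * m.+1 = (2 * m).+2)%nat by lia.
rewrite /eta_sum !Csum_recr /eta_term.
have -> : (-1) ^ (2 * m).+1 = -1 by rewrite -tech_pow_Rmult pow_1_even; ring.
rewrite pow_1_even.
have E1 : INR (2 * m).+1 = 2 * INR m + 1 by rewrite S_INR mult_INR.
have E2 : INR (2 * m).+2 = 2 * INR m + 1 + 1 by rewrite S_INR E1.
rewrite E1 E2.
rewrite (_ : (_ + _ + _ - _)%C = (Cpowr (2 * INR m + 1) (- (1 + s)) - Cpowr (2 * INR m + 1 + 1) (- (1 + s)))%C); last by ring.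
apply: Rle_trans (Cpowr_succ_diff _ _ _ _) _; first by lra.
  by rewrite (_ : (1 + s - 1)%C = s) //; ring.
have := tailmaj_diff m => td; have e2 := exp_pos 2.
have H : Rpower (2 * INR m + 1) (- (5 / 4)) <= 4 * Rpower (INR m + 2) (- (5 / 4)).
  by apply: Rpower_half; lra.
have : 4 * exp 2 * Rpower (2 * INR m + 1) (- (5 / 4)) <= 4 * exp 2 * (4 * Rpower (INR m + 2) (- (5 / 4))).
  by apply: Rmult_le_compat_l => //; lra.
have : 16 * exp 2 * Rpower (INR m + 2) (- (5 / 4)) <= 16 * exp 2 * (tailmaj m - tailmaj m.+1).
  by apply: Rmult_le_compat_l => //; lra.
by lra.
Qed.

Lemma unif_Cpowr {X I : Type} (D : X -> Prop) (g : I -> X -> C) p F :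
  (forall i, bounded_on D (g i)) -> unif D g F -> unif D g (fun x => Cpowr p (F x)).
Proof. by move=> gb uF; apply: unif_Cexp => //; apply: unif_mul => //; apply: unif_const. Qed.

Lemma eta_hol : exists2 E : C -> C, unif (disc (/ 6)) disc_coord E &
  forall s, disc (/ 6) s -> Defs.eta (1 + s)%C = E s.
Proof.
pose t m := 16 * exp 2 * tailmaj m.
have vt : vanishing t.
  by apply: vanishing_scal tailmaj_vanishing; have := exp_pos 2; lra.
have lim s : disc (/ 6) s -> exists L, forall m, Cmod (eta_sum s (2 * m) - L) <= t m.
  by move=> Ds; apply: (telescoping_cv (fun m => eta_sum s (2 * m)) t vt) => n; apply: eta_pair.
have [E HE] := choice_on _ _ (RtoC 0) _ _ lim.
have db := disc_bounded (/ 6).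
exists E.
  apply: (unif_cvg _ _ (fun m s => eta_sum s (2 * m)) _ t vt) => [m|m s Ds]; last exact: HE.
  apply: unif_Csum => n _; apply: unif_mul => //; first exact: unif_const.
  apply: unif_Cpowr => //; apply: unif_opp => //; apply: unif_add; first exact: unif_const.
  exact: (unif_gen (disc (/ 6)) disc_coord tt).
move=> s Ds; apply: (climit_cv (eta_sum s)).
have [_ Hv] := vt; have [_ Hv'] := tailmaj_vanishing.
move=> eps e0; have [N HN] := Hv (eps / 2) ltac:(lra); have [M HM] := Hv' (eps / 2) ltac:(lra).
exists (2 * N + M.+1)%nat => n Hn; rewrite -/(eta_sum s n).
have h : (N <= n./2)%nat by lia.
have := HN _ h; have := HE s Ds n./2.
case: (boolP (odd n)) => on.
  have En : n = (2 * n./2).+1 by rewrite -[in LHS](odd_double_half n) on; lia.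
  have -> : eta_sum s n = (eta_sum s (2 * n./2) + eta_term s (2 * n./2))%C.
    by rewrite [in LHS]En /eta_sum Csum_recr.
  have := eta_term_bound s (2 * n./2) Ds.
  have := HM (2 * n./2)%nat ltac:(lia).
  have := Cmod_triangle (eta_sum s (2 * n./2) - E s) (eta_term s (2 * n./2)).
  by rewrite (_ : (_ - _ + _)%C = (eta_sum s (2 * n./2) + eta_term s (2 * n./2) - E s)%C); [lra|ring].
have En : n = (2 * n./2)%nat by rewrite -[in LHS](odd_double_half n) (negbTE on); lia.
by rewrite -En; lra.
Qed.

Lemma exp_le_3' x : x <= 1 -> exp x <= 3.
Proof. by move=> /exp_le; have := exp_le_3; lra. Qed.

(** With y = -s ln 2 one has 1 - 2^{-s} = s ln 2 phi(y), so the factor s cancels and s zeta(1 + s) =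
    eta(1 + s) / (ln 2 phi(y)). At s = 0 the coded [zeta] divides by zero, so only [H] has the right
    value there. *)
Lemma szeta_hol : exists2 H : C -> C, unif (disc (/ 24)) disc_coord H &
  forall s, disc (/ 24) s -> s <> 0 -> (s * zeta (1 + s) = H s)%C.
Proof.
have [E uE HE] := eta_hol.
have db := disc_bounded (/ 24).
have ln2 : 0 < ln 2 <= 1.
  split; first by have := ln_increasing 1 2 ltac:(lra) ltac:(lra); rewrite ln_1.
  by have := exp_ineq1_le (ln 2); rewrite exp_ln; lra.
pose y (s : C) := (- s * RtoC (ln 2))%C.
have ys s : disc (/ 24) s -> Cmod (y s) <= / 24.
  rewrite /y Cmod_mult Cmod_opp Cmod_R Rabs_pos_eq; last by lra.
  by rewrite /disc => Ds; have := Cmod_ge_0 s; nra.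
have uy : unif (disc (/ 24)) disc_coord y.
  apply: unif_mul => //; last exact: unif_const.
  by apply: unif_opp => //; apply: (unif_gen _ disc_coord tt).
have ph s : disc (/ 24) s -> Cmod (1 - phi (y s)) <= / 2.
  move=> /ys ys'; rewrite Cmod_minus_sym; apply: Rle_trans (phi_near1 _) _.
  have := exp_le_3' (Cmod (y s)) ltac:(lra).
  by have := Cmod_ge_0 (y s); have := exp_pos (Cmod (y s)); nra.
exists (fun s => E s * (RtoC (/ ln 2) * / phi (y s)))%C.
  apply: unif_mul => //.
    move=> eps e0; have [P aP HP] := uE eps e0; exists P => // s Ds; apply: HP.
    by move: Ds; rewrite /disc; lra.
  apply: unif_mul => //; first exact: unif_const.
  apply: (unif_ext _ _ _ (fun s => / (1 - (1 - phi (y s))))%C); first by move=> s _; congr Cinv; ring.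
  apply: (unif_inv1m _ _ _ (/ 2)) => //; first by lra.
  by apply: unif_sub => //; [exact: unif_const|exact: unif_phi].
move=> s Ds s0.
have pn : phi (y s) <> 0.
  by move=> p0; have := ph s Ds; rewrite p0 (_ : (1 - 0)%C = 1) ?Cmod_1; [lra|ring].
rewrite /zeta HE; last by move: Ds; rewrite /disc; lra.
have -> : (1 - Cpowr 2 (1 - (1 + s)) = s * RtoC (ln 2) * phi (y s))%C.
  rewrite /Cpowr (_ : ((1 - (1 + s)) * ln 2)%C = y s); last by rewrite /y; ring.
  by rewrite Cexp_phi {1}/y; ring.
have l0 : RtoC (ln 2) <> 0 by apply: RtoC_neq0; lra.
rewrite RtoC_inv; last by lra.
by field; do !split.
Qed.

(** * Second-order expansions in a small parameter *)

Section Jets.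
Context {X : Type}.
Variables (D : X -> Prop) (q : X -> R) (q0 : R).
Hypotheses (q01 : q0 < 1) (qP : forall x, D x -> 0 <= q x <= q0).

(** A bound O(q^m) uniform over [D]. With the prime included in the point x and q = p^{-5/12}, the
    constants become independent of p, and O(q^3) is the summable O(p^{-5/4}). *)
Definition Oq (m : nat) (f : X -> C) : Prop :=
  exists2 K, 0 <= K & forall x, D x -> Cmod (f x) <= K * q x ^ m.

Lemma Oq_ext m f g : (forall x, D x -> f x = g x) -> Oq m g -> Oq m f.
Proof. by move=> E [K K0 H]; exists K => // x Dx; rewrite E //; apply: H. Qed.

Lemma Oq_add m f g : Oq m f -> Oq m g -> Oq m (fun x => f x + g x)%C.
Proof.
move=> [K K0 H] [L L0 G]; exists (K + L); first by lra.
by move=> x Dx; apply: Rle_trans (Cmod_triangle _ _) _; have := H x Dx; have := G x Dx; lra.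
Qed.

Lemma Oq_mul m n f g : Oq m f -> Oq n g -> Oq (m + n) (fun x => f x * g x)%C.
Proof.
move=> [K K0 H] [L L0 G]; exists (K * L); first by apply: Rmult_le_pos.
move=> x Dx; rewrite Cmod_mult pow_add.
have -> : K * L * (q x ^ m * q x ^ n) = (K * q x ^ m) * (L * q x ^ n) by ring.
by apply: Rmult_le_compat; [exact: Cmod_ge_0|exact: Cmod_ge_0|exact: H|exact: G].
Qed.

Lemma Oq_weaken m n f : (n <= m)%nat -> Oq m f -> Oq n f.
Proof.
move=> /subnKC <- [K K0 H]; exists K => // x Dx; apply: Rle_trans (H x Dx) _.
have [q0x qx] := qP x Dx; rewrite pow_add; apply: Rmult_le_compat_l => //.
rewrite -[X in _ <= X]Rmult_1_r; apply: Rmult_le_compat_l; first exact: pow_le.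
by rewrite -(pow1 (m - n)); apply: pow_incr; lra.
Qed.

Lemma Oq_const c : Oq 0 (fun=> c).
Proof. by exists (Cmod c); [exact: Cmod_ge_0|move=> x _; rewrite /=; lra]. Qed.

Lemma Oq_0 m : Oq m (fun=> RtoC 0).
Proof. by exists 0; [lra|move=> x _; rewrite Cmod_0; lra]. Qed.

Lemma Oq_opp m f : Oq m f -> Oq m (fun x => - f x)%C.
Proof. by move=> [K K0 H]; exists K => // x /H; rewrite Cmod_opp. Qed.

(* f = 1 + a + b + O(q^3) with a = O(q) and b = O(q^2) *)
Definition jet (f a b : X -> C) : Prop :=
  [/\ Oq 1 a, Oq 2 b & Oq 3 (fun x => f x - 1 - a x - b x)%C].

Lemma jet_1 : jet (fun=> RtoC 1) (fun=> RtoC 0) (fun=> RtoC 0).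
Proof.
split; try exact: Oq_0.
by apply: Oq_ext (Oq_0 3) => x _; ring.
Qed.

Lemma jet_mul f a b g c d : jet f a b -> jet g c d ->
  jet (fun x => f x * g x)%C (fun x => a x + c x)%C (fun x => b x + a x * c x + d x)%C.
Proof.
move=> [a1 b2 e3] [c1 d2 h3].
have g0 : Oq 0 g.
  apply: (Oq_ext _ _ (fun x => (1 + c x) + (d x + (g x - 1 - c x - d x)))%C); first by move=> x _; ring.
  apply: Oq_add; apply: Oq_add; [exact: Oq_const|..].
  - exact: Oq_weaken c1.
  - exact: Oq_weaken d2.
  - exact: Oq_weaken h3.
have s0 : Oq 0 (fun x => 1 + (a x + b x))%C.
  by apply: Oq_add; [exact: Oq_const|apply: Oq_add; [exact: Oq_weaken a1|exact: Oq_weaken b2]].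
split; first exact: Oq_add.
  by apply: Oq_add => //; apply: Oq_add => //; apply: (Oq_mul 1 1).
apply: (Oq_ext _ _ (fun x => ((f x - 1 - a x - b x) * g x + (g x - 1 - c x - d x) * (1 + (a x + b x)))
   + (a x * d x + (b x * c x + b x * d x)))%C); first by move=> x _; ring.
apply: Oq_add; apply: Oq_add.
- exact: (Oq_mul 3 0).
- exact: (Oq_mul 3 0).
- exact: (Oq_mul 1 2).
- by apply: Oq_add; [exact: (Oq_mul 2 1)|apply: (Oq_weaken 4) => //; exact: (Oq_mul 2 2)].
Qed.

Lemma jet_ext f a b g c d :
  (forall x, D x -> f x = g x) -> (forall x, D x -> a x = c x) -> (forall x, D x -> b x = d x) ->
  jet g c d -> jet f a b.
Proof.
move=> fg ac bd [H1 H2 H3]; split; [exact: Oq_ext H1|exact: Oq_ext H2|].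
by apply: Oq_ext H3 => x Dx; rewrite fg // ac // bd.
Qed.

(** The remainder of the geometric series is c^3 / (1 - c), and |1 - c| >= 1 - q0. *)
Lemma jet_geom c : (forall x, D x -> Cmod (c x) <= q x) ->
  jet (fun x => / (1 - c x))%C c (fun x => c x * c x)%C.
Proof.
move=> H; have c1 : Oq 1 c by exists 1; [lra|move=> x /H; rewrite /=; lra].
split=> //; first exact: (Oq_mul 1 1).
have lb x : D x -> 1 - q0 <= Cmod (1 - c x).
  move=> Dx; have := Cmod_triangle (1 - c x) (c x); rewrite (_ : (1 - c x + c x)%C = 1); last by ring.
  by rewrite Cmod_1; have := H x Dx; have := qP x Dx; lra.
have nz x : D x -> (1 - c x)%C <> 0.
  by move=> /lb Hx E; rewrite E Cmod_0 in Hx; lra.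
apply: (Oq_ext _ _ (fun x => (c x * (c x * c x)) * / (1 - c x))%C).
  by move=> x /nz ?; field.
apply: (Oq_mul 3 0); first exact: (Oq_mul 1 2 _ _ c1 (Oq_mul 1 1 _ _ c1 c1)).
exists (/ (1 - q0)); first by apply: Rlt_le; apply: Rinv_0_lt_compat; lra.
move=> x Dx; rewrite Cmod_inv; last exact: nz.
by rewrite Rmult_1_r; apply: Rinv_le_contravar; [lra|exact: lb].
Qed.

End Jets.

(** * Infinite products and Euler products *)

(** The partial products are bounded through 1 + x <= e^x, hence their increments are a constant
    times the decrements of [tailmaj], and telescoping applies. *)
Lemma infinite_prod (f : nat -> C) K : 0 <= K ->
  (forall n, Cmod (f n - 1) <= K * (tailmaj n - tailmaj n.+1)) ->
  exists L, forall N, Cmod (nprod N f - L) <= exp (K * tailmaj 0) * K * tailmaj N.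
Proof.
move=> K0 H; have [t0 _] := tailmaj_vanishing.
have ub N : Cmod (nprod N f) <= exp (K * (tailmaj 0 - tailmaj N)).
  elim: N => [|N IH]; first by rewrite /= Cmod_1 Rminus_diag Rmult_0_r exp_0; lra.
  rewrite Cprod_recr Cmod_mult.
  have -> : K * (tailmaj 0 - tailmaj N.+1) = K * (tailmaj 0 - tailmaj N) + K * (tailmaj N - tailmaj N.+1) by ring.
  rewrite exp_plus; apply: Rmult_le_compat => //; try exact: Cmod_ge_0.
  apply: Rle_trans (exp_ineq1_le _).
  have := Cmod_triangle (f N - 1) 1; rewrite Cmod_1 (_ : (f N - 1 + 1)%C = f N); last by ring.
  by have := H N; lra.
have e0 := exp_pos (K * tailmaj 0).
apply: telescoping_cv.
  by apply: vanishing_scal tailmaj_vanishing; apply: Rmult_le_pos; lra.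
move=> n; rewrite Cprod_recr (_ : (_ - _ = nprod n f * (f n - 1))%C); last by ring.
rewrite Cmod_mult -Rmult_minus_distr_l Rmult_assoc.
apply: Rmult_le_compat => //; try exact: Cmod_ge_0.
apply: Rle_trans (ub n) _; apply: exp_le.
by have := t0 n; nra.
Qed.

Lemma Cprod_primes N f :
  Cprod (primes_below N) f = nprod N (fun n => if prime n then f n else 1).
Proof. by rewrite !CprodE /primes_below big_filter big_mkcond. Qed.

Lemma tailmaj_decr n : 0 <= tailmaj n - tailmaj n.+1.
Proof. by apply: Rle_trans (tailmaj_diff n); apply: Rlt_le; apply: Rpower_pos. Qed.

Lemma prime_tail p : (1 < p)%nat -> Rpower (INR p) (- (5 / 4)) <= 4 * (tailmaj p - tailmaj p.+1).
Proof.
move=> /ltP /le_INR /= p2; have td := tailmaj_diff p.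
by have := Rpower_half (INR p) (INR p + 2) ltac:(lra) ltac:(lra); lra.
Qed.

Lemma euler_prod (f : nat -> C) K : 0 <= K ->
  (forall p, prime p -> Cmod (f p - 1) <= K * Rpower (INR p) (- (5 / 4))) ->
  exists L, forall N, Cmod (Cprod (primes_below N) f - L) <=
    exp (K * 4 * tailmaj 0) * (K * 4) * tailmaj N.
Proof.
move=> K0 H.
have [||L HL] := infinite_prod (fun n => if prime n then f n else 1) (K * 4); first by lra.
  move=> n; case: ifP => pn.
    apply: Rle_trans (H n pn) _; rewrite Rmult_assoc; apply: Rmult_le_compat_l => //.
    by apply: prime_tail; apply: prime_gt1.
  rewrite (_ : (1 - 1)%C = 0) ?Cmod_0; last by ring.
  by apply: Rmult_le_pos; [lra|exact: tailmaj_decr].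
by exists L => N; rewrite Cprod_primes; apply: HL.
Qed.

(** * Averaging over the angle theta *)

Lemma unif_Csum_gen {X I T : Type} (D : X -> Prop) (g : I -> X -> C) (l : seq T) (f : T -> X -> C) :
  (forall i, unif D g (f i)) -> unif D g (fun x => Csum l (fun i => f i x)).
Proof. by move=> H; elim: l => [|a l IH] /=; [exact: unif_const|exact: unif_add]. Qed.

(** Both e(theta) and e(-theta) are appended to z as coordinates n and n + 1, so that trigonometric
    polynomials in theta become ordinary polynomials. *)
Definition with_angle (n : nat) (x : R * (nat -> C)) (i : nat) : C :=
  if (i < n)%nat then x.2 i else if i == n then ce x.1 else ce (- x.1).

Definition angle_coord (n i : nat) (x : R * (nat -> C)) : C := coord n.+2 i (with_angle n x).

Definition angle_disc (n : nat) (r : R) (x : R * (nat -> C)) : Prop := polydisc n r x.2.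

Lemma angle_bounded n r i : 0 < r -> bounded_on (angle_disc n r) (angle_coord n i).
Proof.
move=> r0; exists (Rmax r 1) => x Dx; rewrite /angle_coord /coord /with_angle.
have := Rmax_l r 1; have := Rmax_r r 1 => m1 mr.
case: (i < n.+2)%nat; last by rewrite Cmod_0; lra.
case: ltnP => [iN|_]; first by have := Dx i iN; lra.
by case: eqP => _; rewrite Cmod_ce.
Qed.

Lemma monom_with_angle n m x : size m = n.+2 ->
  monom m (with_angle n x) = (nprod n (fun i => Cpow (x.2 i) (nth 0%nat m i)) *
    (Cpow (ce x.1) (nth 0%nat m n) / Cpow (ce x.1) (nth 0%nat m n.+1)))%C.
Proof.
move=> sm; rewrite (monom_coef n.+2) // !Cprod_recr /with_angle ltnn eqxx.
rewrite ltnNge leqnSn /= gtn_eqF // ce_opp.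
rewrite (Cprod_ext _ _ (fun i => Cpow (x.2 i) (nth 0%nat m i))); last first.
  by move=> i; rewrite mem_iota0 => ->.
by rewrite Cpow_inv; [rewrite /Cdiv; ring|exact: ce_neq0].
Qed.

(** For a polynomial the mean over theta keeps exactly the terms with equal powers of e(theta) and
    e(-theta), and is again a polynomial in z; the rest is a uniform limit. *)
Lemma unif_average n r Phi : 0 < r -> unif (angle_disc n r) (angle_coord n) Phi ->
  exists2 F, hol n r F & forall z, polydisc n r z -> cint (fun t => Phi (t, z)) (F z).
Proof.
move=> r0 uP.
have cb i : bounded_on (polydisc n r) (coord n i) by exact: coord_bounded.
have step P : alg (angle_coord n) P ->
    exists2 Q, hol n r Q & forall z, cint (fun t => P (t, z)) (Q z).
  move=> aP.
  have [P' aP' EP] : exists2 P', alg (coord n.+2) P' & forall x, P x = P' (with_angle n x).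
    elim: aP => [c|i|F G _ [F' aF EF] _ [G' aG EG]|F G _ [F' aF EF] _ [G' aG EG]].
    - by exists (fun=> c) => //; apply: alg_const.
    - by exists (coord n.+2 i) => //; apply: alg_gen.
    - by exists (fun w => F' w + G' w)%C; [exact: alg_add|move=> x; rewrite EF EG].
    - by exists (fun w => F' w * G' w)%C; [exact: alg_mul|move=> x; rewrite EF EG].
  have [l [sl El]] := poly_normal _ _ aP'.
  exists (fun z => Csum l (fun p => p.1 * nprod n (fun i => Cpow (coord n i z) (nth 0%nat p.2 i)) *
     RtoC (if nth 0%nat p.2 n == nth 0%nat p.2 n.+1 then 1 else 0)))%C.
    apply: unif_Csum_gen => p; apply: unif_mul => //; last exact: unif_const.
    apply: unif_scal => //.
    apply: (unif_Cprod _ _ _ (fun i z => Cpow (coord n i z) (nth 0%nat p.2 i))) => // i _.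
    by apply: unif_pow => //; apply: unif_gen.
  move=> z; apply: (cint_ext (fun t => Csum l (fun p => p.1 * nprod n (fun i => Cpow (coord n i z) (nth 0%nat p.2 i)) *
     (Cpow (ce t) (nth 0%nat p.2 n) / Cpow (ce t) (nth 0%nat p.2 n.+1))))%C).
    move=> t _; rewrite EP El; apply: Csum_ext => p pl.
    rewrite (monom_with_angle n); last by apply/eqP; move/allP: sl; apply.
    rewrite Cmult_assoc; congr (_ * _ * _)%C; apply: Cprod_ext => i.
    by rewrite mem_iota0 /coord => ->.
  apply: (cint_sum _ l (fun p t => _)) => p; apply: cint_scal; exact: cint_ce_pow.
have approx j : exists PQ : ((R * (nat -> C)) -> C) * ((nat -> C) -> C),
    [/\ hol n r PQ.2, forall z, cint (fun t => PQ.1 (t, z)) (PQ.2 z) &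
     forall x, angle_disc n r x -> Cmod (PQ.1 x - Phi x) <= / (INR j + 1)].
  have [P aP HP] := uP (/ (INR j + 1)) ltac:(apply: Rinv_0_lt_compat; have := pos_INR j; lra).
  have [Q hQ HQ] := step P aP; exists (P, Q); split=> //= x Dx.
  by rewrite Cmod_minus_sym; apply: HP.
have [PQ HPQ] := choice_fun _ _ _ approx.
have ve := vanishing_inv 1 Rle_0_1.
have lim z : polydisc n r z -> exists w,
    cint (fun t => Phi (t, z)) w /\ forall j, Cmod ((PQ j).2 z - w) <= 1 * / (INR j + 1).
  move=> Dz.
  have [||w Hw Hw'] := cint_lim (fun j t => (PQ j).1 (t, z)) (fun j => (PQ j).2 z) (fun t => Phi (t, z)) _ ve.
  - by move=> j; have [_ H _] := HPQ j.
  - by move=> j t; have [_ _ H] := HPQ j; rewrite Rmult_1_l; apply: H.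
  - by exists w.
have [F HF] := choice_on _ _ (RtoC 0) _ _ lim.
exists F; last by move=> z /HF[].
apply: (unif_cvg _ _ (fun j => (PQ j).2) _ _ ve) => [j|j z Dz]; first by have [] := HPQ j.
by have [_] := HF z Dz; apply.
Qed.

(** * The local factors of A_k and convergence of the Euler product *)

Definition ualpha (p : nat) (z : nat -> C) (j : nat) : C := (/ Cpowr (INR p) (RtoC (1 / 2) + z j))%C.
Definition ubeta (k p : nat) (z : nat -> C) (j : nat) : C :=
  (/ Cpowr (INR p) (RtoC (1 / 2) - z (k + j)%nat))%C.

(** Common bound for |p^{-1/2 - s}| when |s| <= 1/12, since 1/2 - 1/12 = 5/12. *)
Definition qp (p : nat) : R := Rpower (INR p) (- (5 / 12)).

Lemma qp_bound p : (1 < p)%nat -> 0 <= qp p <= Rpower 2 (- (5 / 12)).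
Proof.
move=> /ltP /le_INR /= p2; split; first by apply: Rlt_le; apply: Rpower_pos.
by apply: Rpower_neg_antitone; lra.
Qed.

Lemma qp_lt1 : Rpower 2 (- (5 / 12)) < 1.
Proof. by rewrite -[X in _ < X](Rpower_O 2); [apply: Rpower_lt; lra|lra]. Qed.

Lemma qp_cube p : qp p ^ 3 = Rpower (INR p) (- (5 / 4)).
Proof.
rewrite /qp -Rpower_pow; last exact: Rpower_pos.
by rewrite Rpower_mult; congr Rpower; rewrite /=; field.
Qed.

Lemma half_power_bound p s : (1 < p)%nat -> Cmod s <= / 12 ->
  Cmod (/ Cpowr (INR p) (RtoC (1 / 2) + s)) <= qp p.
Proof.
move=> /ltP /le_INR /= p2 s1; rewrite -Cpowr_opp Cmod_Cpowr /qp /Rpower.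
apply: exp_le; rewrite /Re /=.
by have := ln_ge0 (INR p) ltac:(lra); have := Re_bound s; rewrite /Re; nra.
Qed.

Lemma ualpha_bound k p z j : (1 < p)%nat -> polydisc (2 * k) (/ 48) z -> (j < k)%nat ->
  Cmod (ualpha p z j) <= qp p.
Proof.
move=> p1 Dz jk; apply: half_power_bound => //.
by have := Dz j ltac:(lia); lra.
Qed.

Lemma ubeta_bound k p z j : (1 < p)%nat -> polydisc (2 * k) (/ 48) z -> (j < k)%nat ->
  Cmod (ubeta k p z j) <= qp p.
Proof.
move=> p1 Dz jk; apply: half_power_bound => //; rewrite Cmod_opp.
by have := Dz (k + j)%nat ltac:(lia); lra.
Qed.

Definition local_integrand (k p : nat) (x : R * (nat -> C)) : C :=
  nprod k (fun j => / (1 - ce x.1 * ualpha p x.2 j) * / (1 - ce (- x.1) * ubeta k p x.2 j))%C.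

Definition local_product (k p : nat) (z : nat -> C) : C :=
  nprod k (fun i => nprod k (fun j => 1 - ualpha p z i * ubeta k p z j)%C).

(** The power p^{-1 - z_i + z_{k+j}} is the product of [ualpha] at i and [ubeta] at j. *)
Lemma local_factorE k p z : local_factor k p z = (local_product k p z *
  @RInt C_R_CompleteNormedModule (fun t => local_integrand k p (t, z)) 0 1)%C.
Proof.
rewrite /local_factor /local_product; congr Cmult.
apply: Cprod_ext => i _; apply: Cprod_ext => j _.
rewrite /ualpha /ubeta -!Cpowr_opp -Cpowr_add; congr (_ - Cpowr _ _)%C.
have -> : RtoC (-1) = (- RtoC (1 / 2) - RtoC (1 / 2))%C by rewrite -RtoC_opp -RtoC_minus; congr RtoC; field.
ring.
Qed.

Definition local_dom (k : nat) (x : nat * (R * (nat -> C))) : Prop :=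
  (1 < x.1)%nat /\ polydisc (2 * k) (/ 48) x.2.2.

Lemma local_dom_q k x : local_dom k x -> 0 <= qp x.1 <= Rpower 2 (- (5 / 12)).
Proof. by move=> [p1 _]; apply: qp_bound. Qed.

Notation ljet k := (jet (local_dom k) (fun x => qp x.1)).

Lemma jet_one_sided k m (e : R -> C) (c : nat -> nat -> (nat -> C) -> C) :
  (forall t, Cmod (e t) = 1) ->
  (forall j p z, (j < m)%nat -> (1 < p)%nat -> polydisc (2 * k) (/ 48) z -> Cmod (c j p z) <= qp p) ->
  exists A : nat -> (nat -> C) -> C,
    ljet k (fun x => nprod m (fun j => / (1 - e x.2.1 * c j x.1 x.2.2))%C)
      (fun x => e x.2.1 * nsum m (fun j => c j x.1 x.2.2))%C
      (fun x => e x.2.1 * e x.2.1 * A x.1 x.2.2)%C.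
Proof.
move=> e1; elim: m => [|m IH] H.
  exists (fun _ _ => RtoC 0).
  by apply: jet_ext (jet_1 _ _) => x _ //=; ring.
have [|A HA] := IH; first by move=> j p z jm; apply: H; apply: ltnW.
exists (fun p z => A p z + nsum m (fun j => c j p z) * c m p z + c m p z * c m p z)%C.
have HG : ljet k (fun x => / (1 - e x.2.1 * c m x.1 x.2.2))%C (fun x => e x.2.1 * c m x.1 x.2.2)%C
    (fun x => (e x.2.1 * c m x.1 x.2.2) * (e x.2.1 * c m x.1 x.2.2))%C.
  apply: (jet_geom _ _ _ qp_lt1 (local_dom_q k)) => -[p [t z]] [/= p1 Dz].
  by rewrite Cmod_mult e1 Rmult_1_l; apply: H.
apply: jet_ext (jet_mul _ _ _ qp_lt1 (local_dom_q k) _ _ _ _ _ _ HA HG) => x _.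
- by rewrite Cprod_recr.
- by rewrite Csum_recr; ring.
- by ring.
Qed.

Lemma ce_freq n s : (0 < n)%nat -> s = 1 \/ s = -1 -> cint (fun t => Cpow (ce (s * t)) n) 0.
Proof.
move=> n0 Hs; apply: (cint_ext (fun t => ce (s * INR n * t))).
  by move=> t _; rewrite ce_pow; congr ce; ring.
have nn : INR n <> 0 by have := lt_0_INR n ltac:(by apply/ltP); lra.
apply: cint_ce_freq; first by case: Hs => ->; lra.
case: Hs => ->; first by rewrite Rmult_1_l ce_INR.
by rewrite (_ : -1 * INR n = - INR n) ?ce_opp ?ce_INR ?Cinv_1 //; ring.
Qed.

Lemma local_integrand_unif k p : (1 < p)%nat ->
  unif (angle_disc (2 * k) (/ 48)) (angle_coord (2 * k)) (local_integrand k p).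
Proof.
move=> p1; have r48 : 0 < / 48 by lra.
have gb i : bounded_on (angle_disc (2 * k) (/ 48)) (angle_coord (2 * k) i) by exact: angle_bounded.
have uz j : (j < 2 * k)%nat -> unif (angle_disc (2 * k) (/ 48)) (angle_coord (2 * k)) (fun x => x.2 j).
  move=> jk; apply: unif_ext (unif_gen _ _ j) => x _.
  by rewrite /angle_coord /coord /with_angle jk (ltnW (ltnW _)) ?ltnS.
have ue : unif (angle_disc (2 * k) (/ 48)) (angle_coord (2 * k)) (fun x => ce x.1).
  apply: unif_ext (unif_gen _ _ (2 * k)%nat) => x _.
  by rewrite /angle_coord /coord /with_angle ltnn eqxx ltnS leqnSn.
have ue' : unif (angle_disc (2 * k) (/ 48)) (angle_coord (2 * k)) (fun x => ce (- x.1)).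
  apply: unif_ext (unif_gen _ _ (2 * k).+1) => x _.
  by rewrite /angle_coord /coord /with_angle ltnSn ltnNge leqnSn gtn_eqF.
apply: (unif_Cprod _ _ _ (fun j x => / (1 - ce x.1 * ualpha p x.2 j) * / (1 - ce (- x.1) * ubeta k p x.2 j))%C) => // j.
rewrite mem_iota0 => jk.
have jq := proj2 (qp_bound p p1).
apply: unif_mul => //; apply: (unif_inv1m _ _ _ _ gb qp_lt1).
- move=> [t z] Dz; rewrite Cmod_mult Cmod_ce Rmult_1_l.
  by apply: Rle_trans jq; apply: ualpha_bound Dz jk.
- apply: unif_mul => //; apply: (unif_ext _ _ _ (fun x => Cpowr (INR p) (- (RtoC (1 / 2) + x.2 j)))%C).
    by move=> x _; rewrite Cpowr_opp.
  apply: unif_Cpowr => //; apply: unif_opp => //; apply: unif_add; first exact: unif_const.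
  by apply: uz; lia.
- move=> [t z] Dz; rewrite Cmod_mult Cmod_ce Rmult_1_l.
  by apply: Rle_trans jq; apply: ubeta_bound Dz jk.
- apply: unif_mul => //; apply: (unif_ext _ _ _ (fun x => Cpowr (INR p) (- (RtoC (1 / 2) - x.2 (k + j)%nat)))%C).
    by move=> x _; rewrite Cpowr_opp.
  apply: unif_Cpowr => //; apply: unif_opp => //; apply: unif_sub => //; first exact: unif_const.
  by apply: uz; lia.
Qed.

Lemma local_average k : exists F : nat -> (nat -> C) -> C,
  (forall p, (1 < p)%nat -> hol (2 * k) (/ 48) (F p)) /\
  (forall p z, (1 < p)%nat -> polydisc (2 * k) (/ 48) z ->
     cint (fun t => local_integrand k p (t, z)) (F p z)).
Proof.
have average p : (1 < p)%nat -> exists F, hol (2 * k) (/ 48) F /\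
    forall z, polydisc (2 * k) (/ 48) z -> cint (fun t => local_integrand k p (t, z)) (F z).
  move=> p1; have [|F hF HF] := unif_average (2 * k) (/ 48) _ _ (local_integrand_unif k p p1); first by lra.
  by exists F.
have [F HF] := choice_on _ _ (fun=> RtoC 0) _ _ average.
by exists F; split=> [p p1|p z p1 Dz]; have [hF HFz] := HF p p1; [|apply: HFz].
Qed.

(** In the product of the two one-sided expansions all terms of frequency 1, -1, 2, -2 average to 0.
    Only the cross term, in which e(theta) meets e(-theta), survives. *)
Lemma jet_local_average k (F : nat -> (nat -> C) -> C) :
  (forall p z, (1 < p)%nat -> polydisc (2 * k) (/ 48) z ->
     cint (fun t => local_integrand k p (t, z)) (F p z)) ->
  ljet k (fun x => F x.1 x.2.2) (fun=> RtoC 0)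
    (fun x => nsum k (ualpha x.1 x.2.2) * nsum k (ubeta k x.1 x.2.2))%C.
Proof.
move=> HF.
have [A HA] := jet_one_sided k k ce (fun j p z => ualpha p z j) Cmod_ce
  (fun j p z jk p1 Dz => ualpha_bound k p z j p1 Dz jk).
have [B HB] := jet_one_sided k k (fun t => ce (- t)) (fun j p z => ubeta k p z j) (fun t => Cmod_ce (- t))
  (fun j p z jk p1 Dz => ubeta_bound k p z j p1 Dz jk).
have [_ b2 h3] := jet_mul _ _ _ qp_lt1 (local_dom_q k) _ _ _ _ _ _ HA HB.
have [a1 _ _] := HA; have [c1 _ _] := HB.
split; first exact: Oq_0.
  apply: Oq_ext (Oq_mul _ _ 1 1 _ _ a1 c1) => -[p [t z]] _ /=.
  rewrite -/(ualpha p z) -/(ubeta k p z) ce_opp; field; exact: ce_neq0.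
have [K K0 HK] := h3; exists K => // -[p [t0 z]] [/= p1 Dz].
set A1 := nsum k (ualpha p z); set B1 := nsum k (ubeta k p z).
(* The O(q^3) bound is uniform in theta, hence holds for the mean of the remainder. *)
apply: (cint_bound (fun t => local_integrand k p (t, z) - 1 - (ce t * A1 + ce (- t) * B1) -
  (ce t * ce t * A p z + A1 * B1 + ce (- t) * ce (- t) * B p z))%C).
  move=> t _; have := HK (p, (t, z)) (conj p1 Dz) => /=.
  rewrite -/A1 -/B1; congr (Cmod _ <= _).
  rewrite /local_integrand /= Cprod_mul; congr (_ - _)%C.
  rewrite (_ : (ce t * A1 * (ce (- t) * B1) = A1 * B1)%C) //.
  by rewrite ce_opp; field; apply: ce_neq0.
have s1 : 1 = 1 \/ 1 = -1 by left. have s2 : -1 = 1 \/ -1 = -1 by right.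
have f1 := ce_freq 1 1 isT s1; have f2 := ce_freq 2 1 isT s1.
have g1 := ce_freq 1 (-1) isT s2; have g2 := ce_freq 2 (-1) isT s2.
have -> : (F p z - 1 - 0 - A1 * B1)%C =
  (F p z - 1 - (A1 * 0 + B1 * 0) - (A p z * 0 + A1 * B1 + B p z * 0))%C by ring.
apply: (cint_ext (fun t => local_integrand k p (t, z) - 1 -
   (A1 * Cpow (ce (1 * t)) 1 + B1 * Cpow (ce (-1 * t)) 1) -
   (A p z * Cpow (ce (1 * t)) 2 + A1 * B1 + B p z * Cpow (ce (-1 * t)) 2))%C).
  move=> t _; rewrite Rmult_1_l (_ : -1 * t = - t); last by ring.
  by rewrite /=; ring.
apply: cint_opp_sub.
  apply: cint_opp_sub; first by apply: cint_opp_sub; [exact: HF|exact: cint_const].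
  by apply: cint_add; apply: cint_scal.
apply: cint_add; last exact: cint_scal.
by apply: cint_add; [exact: cint_scal|exact: cint_const].
Qed.

Lemma jet_local_product k :
  ljet k (fun x => local_product k x.1 x.2.2) (fun=> RtoC 0)
    (fun x => - (nsum k (ualpha x.1 x.2.2) * nsum k (ubeta k x.1 x.2.2)))%C.
Proof.
have J := jet_mul _ _ _ qp_lt1 (local_dom_q k).
have bound1 c : (forall x, local_dom k x -> Cmod (c x) <= qp x.1) ->
    Oq (local_dom k) (fun x => qp x.1) 1 c.
  by move=> H; exists 1; [lra|move=> x /H; rewrite /=; lra].
have factor i j : (i < k)%nat -> (j < k)%nat ->
    ljet k (fun x => 1 - ualpha x.1 x.2.2 i * ubeta k x.1 x.2.2 j)%C (fun=> RtoC 0)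
      (fun x => - (ualpha x.1 x.2.2 i * ubeta k x.1 x.2.2 j))%C.
  move=> ik jk; split; first exact: Oq_0.
    apply: Oq_opp; apply: (Oq_mul _ _ 1 1); apply: bound1 => -[p [t z]] [/= p1 Dz].
      exact: ualpha_bound Dz ik.
    exact: ubeta_bound Dz jk.
  by apply: Oq_ext (Oq_0 _ _ 3) => x _; ring.
have row i m : (i < k)%nat -> (m <= k)%nat ->
    ljet k (fun x => nprod m (fun j => 1 - ualpha x.1 x.2.2 i * ubeta k x.1 x.2.2 j)%C)
      (fun=> RtoC 0) (fun x => - (ualpha x.1 x.2.2 i * nsum m (ubeta k x.1 x.2.2)))%C.
  move=> ik; elim: m => [|m IH] mk.
    by apply: jet_ext (jet_1 _ _) => x _ //=; ring.
  apply: jet_ext (J _ _ _ _ _ _ (IH (ltnW mk)) (factor i m ik mk)) => x _.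
  - by rewrite Cprod_recr.
  - by ring.
  - by rewrite Csum_recr; ring.
have all m : (m <= k)%nat ->
    ljet k (fun x => nprod m (fun i => nprod k (fun j => 1 - ualpha x.1 x.2.2 i * ubeta k x.1 x.2.2 j)%C))
      (fun=> RtoC 0) (fun x => - (nsum m (ualpha x.1 x.2.2) * nsum k (ubeta k x.1 x.2.2)))%C.
  elim: m => [|m IH] mk.
    by apply: jet_ext (jet_1 _ _) => x _ //=; ring.
  apply: jet_ext (J _ _ _ _ _ _ (IH (ltnW mk)) (row m k mk (leqnn k))) => x _.
  - by rewrite Cprod_recr.
  - by ring.
  - by rewrite Csum_recr; ring.
exact: all.
Qed.

(** The finite product contributes minus the cross term that the mean contributes, so the
    second-order terms cancel and O(q^3) remains. *)
Lemma local_factor_near1 k : exists2 K, 0 <= K & forall p z, (1 < p)%nat -> polydisc (2 * k) (/ 48) z ->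
  Cmod (local_factor k p z - 1) <= K * Rpower (INR p) (- (5 / 4)).
Proof.
have [F [_ HF]] := local_average k.
have := jet_mul _ _ _ qp_lt1 (local_dom_q k) _ _ _ _ _ _ (jet_local_product k) (jet_local_average k F HF).
move=> [_ _ [K K0 H]]; exists K => // p z p1 Dz.
have := H (p, (0, z)) (conj p1 Dz) => /=.
rewrite -[qp p * _]/(qp p ^ 3) qp_cube local_factorE (cint_RInt _ _ (HF p z p1 Dz)).
by congr (Cmod _ <= _); ring.
Qed.

Lemma unif_local_factor k p : (1 < p)%nat -> hol (2 * k) (/ 48) (local_factor k p).
Proof.
move=> p1; have [F [hF HF]] := local_average k.
have gb i : bounded_on (polydisc (2 * k) (/ 48)) (coord (2 * k) i) by apply: coord_bounded; lra.
apply: (unif_ext _ _ _ (fun z => local_product k p z * F p z)%C).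
  by move=> z Dz; rewrite local_factorE (cint_RInt _ _ (HF p z p1 Dz)).
apply: unif_mul => //; last exact: hF.
apply: (unif_Cprod _ _ _ (fun i z => nprod k (fun j => 1 - ualpha p z i * ubeta k p z j)%C)) => // i.
rewrite mem_iota0 => ik.
apply: (unif_Cprod _ _ _ (fun j z => 1 - ualpha p z i * ubeta k p z j)%C) => // j.
rewrite mem_iota0 => jk.
apply: unif_sub => //; first exact: unif_const.
apply: unif_mul => //.
- apply: (unif_ext _ _ _ (fun x => Cpowr (INR p) (- (RtoC (1 / 2) + x i)))%C).
    by move=> x _; rewrite Cpowr_opp.
  apply: unif_Cpowr => //; apply: unif_opp => //; apply: unif_add; first exact: unif_const.
  by apply: hol_coord; lia.
- apply: (unif_ext _ _ _ (fun x => Cpowr (INR p) (- (RtoC (1 / 2) - x (k + j)%nat)))%C).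
    by move=> x _; rewrite Cpowr_opp.
  apply: unif_Cpowr => //; apply: unif_opp => //; apply: unif_sub => //; first exact: unif_const.
  by apply: hol_coord; lia.
Qed.

Lemma hol_Ak k : hol (2 * k) (/ 48) (Ak k).
Proof.
have [K K0 HK] := local_factor_near1 k.
have gb i : bounded_on (polydisc (2 * k) (/ 48)) (coord (2 * k) i) by apply: coord_bounded; lra.
pose t N := exp (K * 4 * tailmaj 0) * (K * 4) * tailmaj N.
have vt : vanishing t.
  apply: vanishing_scal tailmaj_vanishing; apply: Rmult_le_pos; last by lra.
  by apply: Rlt_le; apply: exp_pos.
apply: (unif_cvg _ _ (fun N z => Cprod (primes_below N) (fun p => local_factor k p z)) _ t vt).
  move=> N; apply: (unif_Cprod _ _ _ (fun p z => local_factor k p z)) => // p.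
  by rewrite mem_filter => /andP[/prime_gt1 p1 _]; apply: unif_local_factor.
move=> N z Dz.
have [|L HL] := euler_prod (fun p => local_factor k p z) K K0.
  by move=> p /prime_gt1 p1; apply: HK.
rewrite /Ak (climit_cv _ L); first exact: HL.
exact: Ccv_vanishing vt HL.
Qed.

(** * The constant a_k is nonzero *)

(** From an index M with K [tailmaj] M < 1/2, the inequality (1 - A)(1 - B) >= 1 - A - B keeps all
    later partial products above half of the M-th one in modulus. *)
Lemma infinite_prod_neq0 (f : nat -> C) K L : 0 <= K ->
  (forall n, Cmod (f n - 1) <= K * (tailmaj n - tailmaj n.+1)) -> (forall n, f n <> 0) ->
  Ccv (fun N => nprod N f) L -> L <> 0.
Proof.
move=> K0 H f0 HL L0.
have [t0 Ht] := vanishing_scal K _ K0 tailmaj_vanishing.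
have [M HM] := Ht (/ 2) ltac:(lra); have tM := HM M (leqnn M).
have P0 : 0 < Cmod (nprod M f).
  apply/Cmod_gt_0; elim: (seq.iota 0 M) => [|a l IH] /=; first by case; lra.
  exact: Cmult_neq_0.
have lb d : Cmod (nprod M f) * (1 - (K * tailmaj M - K * tailmaj (M + d)%nat)) <=
    Cmod (nprod (M + d) f).
  elim: d => [|d IH]; first by rewrite addn0; lra.
  rewrite addnS Cprod_recr Cmod_mult.
  have fb : 1 - K * (tailmaj (M + d) - tailmaj (M + d).+1) <= Cmod (f (M + d)%nat).
    have := Cmod_triangle (1 - f (M + d)%nat) (f (M + d)%nat).
    rewrite (_ : (1 - f (M + d)%nat + f (M + d)%nat)%C = 1); last by ring.
    by rewrite Cmod_1 Cmod_minus_sym; have := H (M + d)%nat; lra.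
  have := tailmaj_decr (M + d); have := t0 (M + d)%nat.
  have : 0 <= K * tailmaj M - K * tailmaj (M + d)%nat.
    elim: (d) => [|j IHj]; first by rewrite addn0; lra.
    rewrite addnS; have := tailmaj_decr (M + j) => hj.
    by have := Rmult_le_pos _ _ K0 hj; lra.
  move=> A0 tMd hd; have B0 := Rmult_le_pos _ _ K0 hd.
  set A := K * tailmaj M - K * tailmaj (M + d)%nat in IH A0.
  set B := K * (tailmaj (M + d) - tailmaj (M + d).+1) in fb B0.
  have -> : K * tailmaj M - K * tailmaj (M + d).+1 = A + B by rewrite /A /B; ring.
  have A2 : A <= / 2 by rewrite /A; lra.
  apply: (Rle_trans _ (Cmod (nprod M f) * (1 - A) * Cmod (f (M + d)%nat))).
    apply: (Rle_trans _ (Cmod (nprod M f) * (1 - A) * (1 - B))).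
      rewrite Rmult_assoc; apply: Rmult_le_compat_l; first by lra.
      by have := Rmult_le_pos _ _ A0 B0; lra.
    by apply: Rmult_le_compat_l => //; apply: Rmult_le_pos; lra.
  by apply: Rmult_le_compat_r => //; apply: Cmod_ge_0.
have [N HN] := HL (Cmod (nprod M f) / 2) ltac:(lra).
have := HN (M + N)%nat (leq_addl _ _); rewrite L0.
rewrite (_ : (_ - 0)%C = nprod (M + N) f); last by ring.
have := lb N; have := t0 (M + N)%nat; set P := Cmod _ in P0 *.
by nra.
Qed.

Lemma Series_ge0 a : (forall n, 0 <= a n) -> ex_series a -> 0 <= Series a.
Proof.
move=> a0 ea; rewrite -(Rmult_0_l (Series a)) -Series_scal_l.
by apply: Series_le => // n; have := a0 n; lra.
Qed.

Section GaussSeries.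
Variable (K : R).
Hypothesis K0 : 0 < K.

Definition gauss_coef (n : nat) : R := rising K n * rising K n / (rising 1 n * INR n`!).

Lemma rising_pos a n : 0 < a -> 0 < rising a n.
Proof.
by move=> a0; elim: n => [|n IH] /=; [lra|apply: Rmult_lt_0_compat => //; have := pos_INR n; lra].
Qed.

Lemma gauss_coef_pos n : 0 < gauss_coef n.
Proof.
apply: Rdiv_lt_0_compat; apply: Rmult_lt_0_compat; try exact: rising_pos.
- by apply: rising_pos; lra.
- exact: INR_fact_pos.
Qed.

(** Ratio test at 1/2, the largest value of 1/p; the coefficient ratios tend to 1. *)
Lemma ex_series_gauss : ex_series (fun n => gauss_coef n * (/ 2) ^ n).
Proof.
have pos n : 0 < gauss_coef n * (/ 2) ^ n.
  by apply: Rmult_lt_0_compat; [exact: gauss_coef_pos|apply: pow_lt; lra].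
apply: (ex_series_ext (fun n => Rabs (gauss_coef n * (/ 2) ^ n))).
  by move=> n; rewrite Rabs_pos_eq //; apply: Rlt_le.
apply: (ex_series_DAlembert _ (/ 2)); first by lra.
  by move=> n; have := pos n; lra.
have lim1 : is_lim_seq (fun n => 1 + (K - 1) * / (INR n + 1)) 1.
  rewrite -[X in is_lim_seq _ (Finite X)](_ : 1 + (K - 1) * 0 = 1); last by ring.
  apply: is_lim_seq_plus'; first exact: is_lim_seq_const.
  apply: (is_lim_seq_scal_l _ (K - 1) 0).
  apply: (is_lim_seq_inv _ p_infty) => //.
  apply: (is_lim_seq_ext (fun n => INR n.+1)); first by move=> n; rewrite S_INR.
  by apply: (proj1 (is_lim_seq_incr_1 INR p_infty)); apply: is_lim_seq_INR.
rewrite -[X in is_lim_seq _ (Finite X)](_ : 1 * 1 * / 2 = / 2); last by ring.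
apply: (is_lim_seq_ext (fun n => (1 + (K - 1) * / (INR n + 1)) * (1 + (K - 1) * / (INR n + 1)) * / 2)).
  move=> n; rewrite Rabs_pos_eq; last by apply: Rlt_le; apply: (Rdiv_lt_0_compat _ _ (pos n.+1) (pos n)).
  rewrite /gauss_coef [rising K n.+1]/= [rising 1 n.+1]/= factS mult_INR S_INR.
  have := rising_pos K n K0; have := rising_pos 1 n Rlt_0_1; have := INR_fact_pos n.
  have := pos_INR n => n0 f0 r1 r2; have h2 : 0 < (/ 2) ^ n by apply: pow_lt; lra.
  by rewrite -[(/ 2) ^ n.+1]/(/ 2 * (/ 2) ^ n); field; do !split; lra.
by apply: is_lim_seq_mult'; [exact: is_lim_seq_mult'|exact: is_lim_seq_const].
Qed.

Lemma gauss_expand : exists2 S, 0 <= S & forall x, 0 <= x <= / 2 ->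
  exists2 r, hyp2F1 K K 1 x = 1 + K ^ 2 * x + r & 0 <= r <= S * x ^ 2.
Proof.
have ex2 : ex_series (fun n => gauss_coef n.+2 * (/ 2) ^ n).
  apply: (ex_series_ext (fun n => 4 * (gauss_coef n.+2 * (/ 2) ^ n.+2))).
    by move=> n; rewrite /=; field.
  apply: (@ex_series_scal R_AbsRing R_NormedModule).
  exact: (proj1 (ex_series_incr_1 _) (proj1 (ex_series_incr_1 _) ex_series_gauss)).
exists (Series (fun n => gauss_coef n.+2 * (/ 2) ^ n)).
  apply: Series_ge0 => // n.
  by apply: Rmult_le_pos; [apply: Rlt_le; exact: gauss_coef_pos|apply: pow_le; lra].
move=> x x2.
have xn n : 0 <= x ^ n <= (/ 2) ^ n by split; [apply: pow_le; lra|apply: pow_incr; lra].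
have g0 n := gauss_coef_pos n.
have exx : ex_series (fun n => gauss_coef n * x ^ n).
  apply: (@ex_series_le R_AbsRing R_CompleteNormedModule _ _ _ ex_series_gauss) => n.
  rewrite /norm /= /abs /= Rabs_pos_eq; first by apply: Rmult_le_compat_l; [have := g0 n; lra|apply: (proj2 (xn n))].
  by apply: Rmult_le_pos; [have := g0 n; lra|apply: (proj1 (xn n))].
have exx2 : ex_series (fun n => gauss_coef n.+2 * x ^ n).
  apply: (@ex_series_le R_AbsRing R_CompleteNormedModule _ _ _ ex2) => n.
  rewrite /norm /= /abs /= Rabs_pos_eq; first by apply: Rmult_le_compat_l; [have := g0 n.+2; lra|apply: (proj2 (xn n))].
  by apply: Rmult_le_pos; [have := g0 n.+2; lra|apply: (proj1 (xn n))].
exists (x ^ 2 * Series (fun n => gauss_coef n.+2 * x ^ n)).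
  rewrite /hyp2F1 -/(gauss_coef _) (Series_ext _ (fun n => gauss_coef n * x ^ n)) //.
  rewrite Series_incr_1 // (Series_incr_1 (fun n => gauss_coef n.+1 * x ^ n.+1)); last first.
    exact: (proj1 (ex_series_incr_1 _) exx).
  rewrite -Series_scal_l (Series_ext (fun n => gauss_coef n.+2 * x ^ n.+2) (fun n => x ^ 2 * (gauss_coef n.+2 * x ^ n))).
    by rewrite /gauss_coef /= /INR /=; field.
  by move=> n; rewrite -[x ^ n.+2]/(x * (x * x ^ n)); ring.
have x20 : 0 <= x ^ 2 by apply: pow_le; lra.
split.
  apply: Rmult_le_pos => //; apply: Series_ge0 => // n.
  by apply: Rmult_le_pos; [have := g0 n.+2; lra|apply: (proj1 (xn n))].
rewrite Rmult_comm; apply: Rmult_le_compat_r => //; apply: Series_le => // n; split.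
  by apply: Rmult_le_pos; [have := g0 n.+2; lra|apply: (proj1 (xn n))].
by apply: Rmult_le_compat_l; [have := g0 n.+2; lra|apply: (proj2 (xn n))].
Qed.

End GaussSeries.

Lemma binomial_expand m : exists2 B, 0 <= B & forall x, 0 <= x <= 1 ->
  Rabs ((1 - x) ^ m - (1 - INR m * x)) <= B * x ^ 2.
Proof.
elim: m => [|m [B B0 H]]; first by exists 0; [lra|move=> x _; rewrite /= Rmult_0_l !Rminus_0_r Rminus_diag Rabs_R0; lra].
exists (B + INR m); first by have := pos_INR m; lra.
move=> x Hx; have {H}H := H x Hx; have m0 := pos_INR m.
rewrite S_INR -[(1 - x) ^ m.+1]/((1 - x) * (1 - x) ^ m).
have -> : (1 - x) * (1 - x) ^ m - (1 - (INR m + 1) * x) =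
  (1 - x) * ((1 - x) ^ m - (1 - INR m * x)) + INR m * x ^ 2 by ring.
apply: Rle_trans (Rabs_triang _ _) _; rewrite Rabs_mult Rmult_plus_distr_r.
apply: Rplus_le_compat; last first.
  by apply: Req_le; apply: Rabs_pos_eq; apply: Rmult_le_pos => //; apply: pow_le; lra.
rewrite Rabs_pos_eq; last by lra.
by have := Rabs_pos ((1 - x) ^ m - (1 - INR m * x)); nra.
Qed.

(** The linear terms -k^2 x and k^2 x of the two factors cancel. Positivity comes from the positive
    coefficients of the hypergeometric series. *)
Lemma ak_factor_bound k : (0 < k)%nat -> exists2 B, 0 <= B & forall x, 0 <= x <= / 2 ->
  let f := (1 - x) ^ (k * k) * hyp2F1 (INR k) (INR k) 1 x in
  0 < f /\ Rabs (f - 1) <= B * x ^ 2.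
Proof.
move=> /ltP /lt_0_INR k0.
have [S S0 HS] := gauss_expand (INR k) k0.
have [B B0 HB] := binomial_expand (k * k).
set m := INR (k * k) in HB; have mE : m = INR k ^ 2 by rewrite /m mult_INR /=; ring.
have m0 : 0 <= m by apply: pos_INR.
exists (m ^ 2 + (1 + m) * S + B * (1 + m + S)).
  have := Rmult_le_pos _ _ B0 (_ : 0 <= 1 + m + S); have := Rmult_le_pos _ _ (_ : 0 <= 1 + m) S0.
  by have := pow_le m 2 m0; lra.
move=> x Hx /=; have [r -> [r0 rS]] := HS x Hx; rewrite -mE.
have {HB}eB := HB x ltac:(lra); set e := _ - _ in eB.
have -> : (1 - x) ^ (k * k) = 1 - m * x + e by rewrite /e; ring.
split.
  have -> : 1 - m * x + e = (1 - x) ^ (k * k) by rewrite /e; ring.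
  apply: Rmult_lt_0_compat; first by apply: pow_lt; lra.
  by have := Rmult_le_pos _ _ m0 (proj1 Hx); lra.
have x20 : 0 <= x ^ 2 by apply: pow_le; lra.
have x1 : x ^ 2 <= 1 by rewrite /=; nra.
have mx : 0 <= m * x <= m by nra.
have rS' : r <= S by nra.
have -> : (1 - m * x + e) * (1 + m * x + r) - 1 =
  (- (m ^ 2 * x ^ 2) + (1 - m * x) * r) + e * (1 + m * x + r) by ring.
apply: Rle_trans (Rabs_triang _ _) _.
apply: (Rle_trans _ ((m ^ 2 * x ^ 2 + (1 + m) * (S * x ^ 2)) + (B * x ^ 2) * (1 + m + S))); last by lra.
apply: Rplus_le_compat.
  apply: Rle_trans (Rabs_triang _ _) _; apply: Rplus_le_compat.
    by rewrite Rabs_Ropp Rabs_pos_eq; [lra|apply: Rmult_le_pos => //; apply: pow_le].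
  rewrite Rabs_mult (Rabs_pos_eq r) //; apply: Rmult_le_compat => //; first exact: Rabs_pos.
  by apply: Rabs_le; lra.
rewrite Rabs_mult; apply: Rmult_le_compat => //; try exact: Rabs_pos.
by rewrite Rabs_pos_eq; lra.
Qed.

(** Needed to recover the coefficients of the generating function from b_k, which is normalised by
    1/a_k. The factors are 1 + O(p^{-2}), and p^{-2} <= p^{-5/4} lets the same majorant serve. *)
Lemma ak_neq0 k : (0 < k)%nat -> ak k <> 0.
Proof.
move=> k0; have [B B0 HB] := ak_factor_bound k k0.
pose f p := (1 - / INR p) ^ (k * k) * hyp2F1 (INR k) (INR k) 1 (/ INR p).
have Hp p : prime p -> 0 <= / INR p <= / 2.
  move=> /prime_gt1 /ltP /le_INR /= p2.
  by split; [apply: Rlt_le; apply: Rinv_0_lt_compat; lra|apply: Rinv_le_contravar; lra].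
have near1 p : prime p -> Cmod (RtoC (f p) - 1) <= B * Rpower (INR p) (- (5 / 4)).
  move=> pp; have [_ Hf] := HB _ (Hp p pp).
  rewrite -RtoC_minus Cmod_R; apply: Rle_trans Hf _; apply: Rmult_le_compat_l => //.
  have p2 : 2 <= INR p by have /ltP /le_INR := prime_gt1 pp; rewrite /=; lra.
  rewrite Rpower_Ropp pow_inv; apply: Rinv_le_contravar; try exact: Rpower_pos.
  by rewrite -Rpower_pow; [apply: Rle_Rpower; rewrite /=; lra|lra].
have [L HL] := euler_prod (fun p => RtoC (f p)) B B0 near1.
have cvL : Ccv (fun N => Cprod (primes_below N) (fun p => RtoC (f p))) L.
  apply: Ccv_vanishing HL; apply: vanishing_scal tailmaj_vanishing.
  by apply: Rmult_le_pos; [apply: Rlt_le; apply: exp_pos|lra].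
rewrite /ak (climit_cv _ L cvL).
apply: (infinite_prod_neq0 (fun n => if prime n then RtoC (f n) else 1) (B * 4)); first by lra.
- move=> n; case: ifP => pn.
    apply: Rle_trans (near1 n pn) _; rewrite Rmult_assoc; apply: Rmult_le_compat_l => //.
    by apply: prime_tail; apply: prime_gt1.
  rewrite (_ : (1 - 1)%C = 0) ?Cmod_0; last by ring.
  by apply: Rmult_le_pos; [lra|exact: tailmaj_decr].
- move=> n; case: ifP => pn; last by case; lra.
  by apply: RtoC_neq0; have [] := HB _ (Hp n pn); rewrite -/(f n); lra.
- by move: cvL; congr Ccv; apply: functional_extensionality => N; rewrite Cprod_primes.
Qed.

(** * Permutations of variables acting on Taylor coefficients *)

Lemma perm_map_self (T : eqType) (l : seq T) (f : T -> T) : uniq l ->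
  {in l &, injective f} -> (forall x, x \in l -> f x \in l) -> perm_eq [seq f x | x <- l] l.
Proof.
move=> ul fi fl; have um : uniq [seq f x | x <- l] by rewrite map_inj_in_uniq.
apply: uniq_perm => //.
have sub : {subset [seq f x | x <- l] <= l} by move=> _ /mapP[x xl ->]; apply: fl.
by have [|_ ] := uniq_min_size um sub; rewrite ?size_map.
Qed.

(** Permutations as functions on [nat], which act on points z : nat -> C without casts. *)
Definition nat_perm (n : nat) (p : nat -> nat) : Prop :=
  (forall i, (i < n)%nat -> (p i < n)%nat) /\
  (forall i j, (i < n)%nat -> (j < n)%nat -> p i = p j -> i = j).

Lemma nat_perm_iota n p : nat_perm n p -> perm_eq [seq p i | i <- seq.iota 0 n] (seq.iota 0 n).
Proof.
move=> [pn pi]; apply: perm_map_self; first exact: iota_uniq.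
  by move=> i j; rewrite !mem_iota !add0n; apply: pi.
by move=> i; rewrite !mem_iota !add0n; apply: pn.
Qed.

Lemma Cprod_nat_perm n p (f : nat -> C) : nat_perm n p ->
  nprod n (fun i => f (p i)) = nprod n f.
Proof.
move=> H; by rewrite !CprodE -[RHS](perm_big _ (nat_perm_iota n p H)) big_map.
Qed.

Definition permute (n : nat) (p : nat -> nat) (m : seq nat) : seq nat :=
  [seq nth 0%nat m (p i) | i <- seq.iota 0 n].

Lemma size_permute n p m : size (permute n p m) = n.
Proof. by rewrite size_map size_iota. Qed.

Lemma nth_permute n p m i : (i < n)%nat -> nth 0%nat (permute n p m) i = nth 0%nat m (p i).
Proof. by move=> iN; rewrite (nth_map 0%nat) ?size_iota // nth_iota. Qed.

Lemma perm_permute n p m : nat_perm n p -> size m = n -> perm_eq (permute n p m) m.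
Proof.
move=> H sm; have := perm_map (nth 0%nat m) (nat_perm_iota n p H).
by rewrite -map_comp (_ : [seq nth 0%nat m i | i <- seq.iota 0 n] = m) // -sm; apply: mkseq_nth.
Qed.

Lemma permute_inj n p m m' : nat_perm n p -> size m = n -> size m' = n ->
  permute n p m = permute n p m' -> m = m'.
Proof.
move=> H sm sm' E; apply: (@eq_from_nth _ 0%nat); first by rewrite sm sm'.
move=> j; rewrite sm => jn.
have : j \in [seq p i | i <- seq.iota 0 n] by rewrite (perm_mem (nat_perm_iota n p H)) mem_iota add0n.
move=> /mapP[i]; rewrite mem_iota add0n => /= iN ->.
by rewrite -!(nth_permute n) // E.
Qed.

Lemma perm_permute_list n p (l : seq (seq nat)) : nat_perm n p -> uniq l ->
  (forall m, m \in l -> size m = n) -> (forall m m', m \in l -> perm_eq m' m -> m' \in l) ->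
  perm_eq [seq permute n p m | m <- l] l.
Proof.
move=> H ul sl cl; apply: perm_map_self => //.
  by move=> m m' /sl sm /sl sm'; apply: permute_inj.
by move=> m ml; apply: (cl m) => //; apply: perm_permute => //; apply: sl.
Qed.

Lemma monom_permute n p eps (z : nat -> C) m : nat_perm n p -> size m = n ->
  monom (permute n p m) (fun i => RtoC eps * z (p i))%C = (RtoC (eps ^ sumn m) * monom m z)%C.
Proof.
move=> H sm; rewrite monom_scal (perm_sumn (perm_permute n p m H sm)); congr Cmult.
rewrite (monom_coef n) ?size_permute // (monom_coef n) //.
rewrite -(Cprod_nat_perm n p (fun i => Cpow (z i) (nth 0%nat m i))) //.
by apply: Cprod_ext => i; rewrite mem_iota0 => iN; rewrite nth_permute.
Qed.

(** Substituting into the expansion shows that the transformed family is again an expansion of f;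
    with [taylor_unique] this becomes a symmetry of the coefficients. The sign [eps] is there for
    the exchange of the two blocks, which also negates the variables. *)
Lemma taylor_sym n r dom f c eps p : 0 < r -> Rabs eps = 1 -> nat_perm n p ->
  (forall z : nat -> C, dom z -> dom (fun i => RtoC eps * z (p i))%C) ->
  (forall z : nat -> C, polydisc n r z -> dom z -> f (fun i => RtoC eps * z (p i))%C = f z) ->
  is_taylor_expansion n dom f c ->
  is_taylor_expansion n dom f (fun m => RtoC (eps ^ sumn m) * c (permute n p m))%C.
Proof.
move=> r0 e1 Hp Hdom Hf [d [d0 H]]; exists (Rmin d r); split; first exact: Rmin_pos.
move=> z Hz Dz; rewrite -Hf //; last first.
  by move=> i iN; have := Hz i iN; have := Rmin_r d r; lra.
have small i : (i < n)%nat -> Cmod (RtoC eps * z (p i)) < d.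
  move=> iN; rewrite Cmod_mult Cmod_R e1 Rmult_1_l.
  by have := Hz _ (proj1 Hp i iN); have := Rmin_l d r; lra.
have := H (fun i => RtoC eps * z (p i))%C small (Hdom z Dz).
have -> : (fun D => nsum D (fun d => Csum (comps n d) (fun m => c m * monom m (fun i => RtoC eps * z (p i)))%C)) =
  (fun D => nsum D (fun d => Csum (comps n d) (fun m => RtoC (eps ^ sumn m) * c (permute n p m) * monom m z)%C)).
  apply: functional_extensionality => D; apply: Csum_ext => j _.
  have P : perm_eq [seq permute n p m | m <- comps n j] (comps n j).
    apply: perm_permute_list => //; first exact: uniq_comps.
      by move=> m; rewrite mem_comps => /andP[/eqP].
    move=> m m'; rewrite !mem_comps => /andP[/eqP <- /eqP <-] mm'.
    by rewrite (perm_size mm') (perm_sumn mm') !eqxx.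
  rewrite !CsumE -[LHS](perm_big _ P) big_map /=; apply: eq_big_seq => m.
  rewrite mem_comps => /andP[/eqP sm _]; rewrite monom_permute //; Cring.
by [].
Qed.

Lemma taylor_ext n r dom f g c : 0 < r -> (forall z, polydisc n r z -> dom z -> f z = g z) ->
  is_taylor_expansion n dom g c -> is_taylor_expansion n dom f c.
Proof.
move=> r0 E [d [d0 H]]; exists (Rmin d r); split; first exact: Rmin_pos.
move=> z Hz Dz; rewrite E //.
  by apply: H => // i iN; have := Hz i iN; have := Rmin_l d r; lra.
by move=> i iN; have := Hz i iN; have := Rmin_r d r; lra.
Qed.

Lemma off_diag_distinct k z :
  (forall i j, (i < 2 * k)%nat -> (j < 2 * k)%nat -> i <> j -> Cmod (z i) <> Cmod (z j)) -> off_diag k z.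
Proof.
move=> H i j ik jk E; apply: (H i (k + j)%nat); try lia.
by rewrite E.
Qed.

(** * The generating function of b_k and its symmetries *)

Definition bk_fun (k : nat) (z : nat -> C) : C :=
  Cmult (Cmult (Cinv (ak k)) (Ak k z))
    (nprod k (fun i => nprod k (fun j =>
       Cmult (Cminus (z i) (z (k + j)%nat))
         (zeta (Cminus (Cplus (RtoC 1) (z i)) (z (k + j)%nat)))))).

Lemma bkE k a b : bk k a b = taylor_coeff (2 * k) (off_diag k) (bk_fun k) (a ++ b).
Proof. by []. Qed.

Lemma taylor_coeffP n dom f c : is_taylor_expansion n dom f c ->
  is_taylor_expansion n dom f (taylor_coeff n dom f).
Proof.
move=> H; exact: (epsilon_spec (inhabits (fun _ : seq nat => RtoC 0)) (is_taylor_expansion n dom f) (ex_intro _ c H)).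
Qed.

Definition Ak_zeta (k : nat) (z : nat -> C) : C :=
  (Ak k z * nprod k (fun i => nprod k (fun j =>
       (z i - z (k + j)%nat) * zeta (1 + z i - z (k + j)%nat))))%C.

(** F replaces each factor (z_i - z_{k+j}) zeta(1 + z_i - z_{k+j}) by the function [H] of
    [szeta_hol], and so extends [Ak_zeta] across the diagonals. Its Cauchy coefficients are a_k
    times the chosen Taylor coefficients by uniqueness of the expansion off the diagonals. *)
Lemma bk_hol k : (0 < k)%nat -> exists F, [/\ hol (2 * k) (/ 48) F,
  forall z, polydisc (2 * k) (/ 48) z -> off_diag k z ->
    F z = Ak_zeta k z &
  is_taylor_expansion (2 * k) (off_diag k) (bk_fun k) (taylor_coeff (2 * k) (off_diag k) (bk_fun k)) /\
  forall c, is_coefs (2 * k) (/ 48) F c -> forall m, size m = (2 * k)%nat ->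
    c m = (ak k * taylor_coeff (2 * k) (off_diag k) (bk_fun k) m)%C].
Proof.
move=> k0; have [H uH HH] := szeta_hol; have a0 := ak_neq0 k k0.
have r48 : 0 < / 48 by lra.
have gb i : bounded_on (polydisc (2 * k) (/ 48)) (coord (2 * k) i) by apply: coord_bounded.
(* Two coordinates of modulus at most 1/48 differ by at most 1/24. *)
have dz z i j : polydisc (2 * k) (/ 48) z -> (i < k)%nat -> (j < k)%nat ->
    disc (/ 24) (z i - z (k + j)%nat)%C.
  move=> Dz ik jk; apply: Rle_trans (Cmod_triangle _ _) _; rewrite Cmod_opp.
  by have := Dz i ltac:(lia); have := Dz (k + j)%nat ltac:(lia); lra.
pose F z := (Ak k z * nprod k (fun i => nprod k (fun j => H (z i - z (k + j)%nat))))%C.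
have hF : hol (2 * k) (/ 48) F.
  apply: unif_mul => //; first exact: hol_Ak.
  apply: (unif_Cprod _ _ _ (fun i z => nprod k (fun j => H (z i - z (k + j)%nat))%C)) => // i.
  rewrite mem_iota0 => ik.
  apply: (unif_Cprod _ _ _ (fun j z => H (z i - z (k + j)%nat))%C) => // j.
  rewrite mem_iota0 => jk.
  apply: (unif_comp (disc (/ 24)) disc_coord _ _ (fun z => z i - z (k + j)%nat)%C) => //.
    by move=> z Dz; apply: dz.
  by case; apply: unif_sub => //; apply: hol_coord; lia.
have FE z : polydisc (2 * k) (/ 48) z -> off_diag k z ->
    F z = Ak_zeta k z.
  move=> Dz oz; rewrite /F /Ak_zeta; congr Cmult; apply: Cprod_ext => i; rewrite mem_iota0 => ik.
  apply: Cprod_ext => j; rewrite mem_iota0 => jk.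
  rewrite -HH; last 2 first.
  - exact: dz.
  - move=> E; apply: (oz i j ik jk).
    by have -> : z i = (z i - z (k + j)%nat + z (k + j)%nat)%C; [ring|rewrite E Cplus_0_l].
  by congr (_ * zeta _)%C; ring.
have [c Hc] := coefs_exist _ _ F r48 hF.
have tb : is_taylor_expansion (2 * k) (off_diag k) (bk_fun k) (fun m => / ak k * c m)%C.
  apply: (taylor_ext _ (/ 48) _ _ (fun z => / ak k * F z)%C) => //.
    by move=> z Dz oz; rewrite FE // /bk_fun /Ak_zeta Cmult_assoc.
  apply: (hol_taylor _ (/ 48)) => //; first exact: unif_scal.
  move=> m sm; have := is_cavg_scal _ _ (/ ak k)%C _ _ (Hc m sm).
  by congr is_cavg; apply: functional_extensionality => z; rewrite Cmult_assoc.
have tc := taylor_coeffP _ _ _ _ tb.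
exists F; split=> //; split=> // c' Hc' m sm.
have := taylor_unique _ _ _ _ _ (off_diag_distinct k) tb tc m sm => <-.
rewrite (is_coefs_unique _ _ _ _ _ _ Hc' Hc sm) Cmult_assoc Cinv_r // Cmult_1_l.
by [].
Qed.

Lemma ex_local_integral k p z : (1 < p)%nat -> polydisc (2 * k) (/ 48) z ->
  ex_RInt (V := C_R_NormedModule) (fun t => local_integrand k p (t, z)) 0 1.
Proof.
move=> p1 Dz; have [F [_ HF]] := local_average k.
by exists (F p z); apply: HF.
Qed.

Lemma Ak_ext k z w : (forall p, prime p -> local_factor k p z = local_factor k p w) -> Ak k z = Ak k w.
Proof.
move=> E; rewrite /Ak; apply: (f_equal climit); apply: functional_extensionality => N.
apply: Cprod_ext => p; rewrite mem_filter => /andP[pp _]; exact: E.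
Qed.

Lemma Cprod_exchange (l l' : seq nat) (f : nat -> nat -> C) :
  Cprod l (fun i => Cprod l' (f i)) = Cprod l' (fun j => Cprod l (f^~ j)).
Proof.
rewrite !CprodE; under eq_bigr do rewrite CprodE; rewrite exchange_big /=.
by apply: eq_bigr => j _; rewrite CprodE.
Qed.

Definition block_perm (k : nat) (p : nat -> nat) : Prop :=
  nat_perm k p /\ nat_perm k (fun j => p (k + j)%nat - k)%nat /\
  forall j, (j < k)%nat -> (k <= p (k + j))%nat.

Lemma bk_fun_block_perm k p z : block_perm k p -> bk_fun k (fun i => z (p i)) = bk_fun k z.
Proof.
move=> [p1 [p2 p3]].
have zp j : j \in seq.iota 0 k -> z (p (k + j)%nat) = z (k + (p (k + j)%nat - k))%nat.
  by rewrite mem_iota0 => jk; rewrite subnKC //; apply: p3.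
have two (f : C -> C -> C) : nprod k (fun i => nprod k (fun j => f (z (p i)) (z (p (k + j)%nat)))) =
    nprod k (fun i => nprod k (fun j => f (z i) (z (k + j)%nat))).
  rewrite (Cprod_nat_perm k p (fun i => nprod k (fun j => f (z i) (z (p (k + j)%nat))))) //.
  apply: Cprod_ext => i _; rewrite -[RHS](Cprod_nat_perm k _ _ p2).
  by apply: Cprod_ext => j jk; rewrite zp.
rewrite /bk_fun; apply: (f_equal2 Cmult); last exact: (two (fun u v => (u - v) * zeta (1 + u - v))%C).
apply: (f_equal (Cmult (/ ak k)%C)).
apply: Ak_ext => q _; rewrite /local_factor; apply: (f_equal2 Cmult).
  exact: (two (fun u v => 1 - Cpowr (INR q) (RtoC (-1) - u + v))%C).
congr (@RInt C_R_CompleteNormedModule _ 0 1); apply: functional_extensionality => t; rewrite !Cprod_mul; congr Cmult.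
  exact: (Cprod_nat_perm k p (fun j => / (1 - ce t / Cpowr (INR q) (RtoC (1 / 2) + z j)))%C).
rewrite -[RHS](Cprod_nat_perm k _ _ p2).
by apply: Cprod_ext => j jk; rewrite zp.
Qed.

Definition swap (k i : nat) : nat := if (i < k)%nat then (k + i)%nat else (i - k)%nat.

(** Sending (z_i, z_{k+i}) to (-z_{k+i}, -z_i) fixes every difference z_i - z_{k+j} up to exchanging
    i and j, so only the integral over theta needs an argument. *)
Lemma bk_fun_swap k z : polydisc (2 * k) (/ 48) z ->
  bk_fun k (fun i => RtoC (-1) * z (swap k i))%C = bk_fun k z.
Proof.
move=> Dz; have sl i : i \in seq.iota 0 k -> swap k i = (k + i)%nat.
  by rewrite mem_iota0 /swap => ->.
have sr j : swap k (k + j) = j by rewrite /swap ltnNge leq_addr /= addKn.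
have m1 (u : C) : (RtoC (-1) * u)%C = (- u)%C by apply: injective_projections; rewrite /=; ring.
have two (f : C -> C -> C) : (forall u v, f (- v)%C (- u)%C = f u v) ->
    nprod k (fun i => nprod k (fun j => f (RtoC (-1) * z (swap k i)) (RtoC (-1) * z (swap k (k + j)%nat)))%C) =
    nprod k (fun i => nprod k (fun j => f (z i) (z (k + j)%nat))).
  move=> fs; rewrite Cprod_exchange; apply: Cprod_ext => j _; apply: Cprod_ext => i ik.
  by rewrite sr sl // !m1 fs.
rewrite /bk_fun; apply: (f_equal2 Cmult); last first.
  by apply: (two (fun u v => (u - v) * zeta (1 + u - v))%C) => u v; congr (_ * zeta _)%C; ring.
apply: (f_equal (Cmult (/ ak k)%C)).
apply: Ak_ext => q qp; rewrite /local_factor; apply: (f_equal2 Cmult).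
  by apply: (two (fun u v => 1 - Cpowr (INR q) (RtoC (-1) - u + v))%C) => u v; congr (_ - Cpowr _ _)%C; ring.
have [v Hv] := ex_local_integral k q z (prime_gt1 qp) Dz.
(* The reflection of theta to 1 - theta exchanges e(theta) with e(-theta), hence the two families of
   factors, and preserves the integral. *)
have Hv' : cint (fun t => local_integrand k q (1 - t, z)) v.
  have e0 : -1 * 0 + 1 = 1 by ring.
  have e1 : -1 * 1 + 1 = 0 by ring.
  have H : @is_RInt C_R_NormedModule (fun t => local_integrand k q (t, z)) (-1 * 0 + 1) (-1 * 1 + 1) (opp v).
    by rewrite e0 e1; apply: is_RInt_swap Hv.
  have /(@is_RInt_opp C_R_NormedModule) := is_RInt_comp_lin _ _ _ _ _ _ H.
  rewrite opp_opp; apply: cint_ext => t _.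
  rewrite (_ : -1 * t + 1 = 1 - t); last by ring.
  by rewrite (@scal_opp_one R_AbsRing) opp_opp.
rewrite (cint_RInt _ _ Hv); apply: cint_RInt; apply: cint_ext Hv' => t _.
rewrite /local_integrand /=; apply: Cprod_ext => j jk.
rewrite sl // sr Cmult_comm !m1 /ualpha /ubeta /Cdiv.
have -> : ce (1 - t) = ce (- t) by rewrite /Rminus ce_add ce_1 Cmult_1_l.
have -> : ce (- (1 - t)) = ce t.
  by rewrite (_ : - (1 - t) = t + - (1)) ?ce_add ?ce_opp ?ce_1 ?Cinv_1 ?Cmult_1_r //; ring.
congr (_ * _)%C; congr (/ (1 - _ * / Cpowr _ _))%C; ring.
Qed.

(** * Vandermonde determinants and their expansion *)

HB.instance Definition _ := GRing.isZmodMorphism.Build R C RtoC RtoC_minus.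
HB.instance Definition _ := GRing.isMonoidMorphism.Build R C RtoC (conj (erefl (RtoC 1)) RtoC_mult).

Lemma CpowE (z : C) n : Cpow z n = (z ^+ n)%ring.
Proof. by elim: n => [|n IH] //; rewrite exprS /= IH. Qed.

Lemma Cprod_ord n (f : nat -> C) : nprod n f = (\prod_(i < n) f i)%ring.
Proof. by rewrite CprodE -(big_mkord xpredT) /index_iota subn0. Qed.

Lemma Vandermonde_det n (z : nat -> C) :
  Defs.Vandermonde n z = (\det (\matrix_(a < n, b < n) (z a ^+ b)))%ring.
Proof.
have -> : (\matrix_(a < n, b < n) (z a ^+ b) = (matrix.Vandermonde n (\row_(j < n) z j))^T)%ring.
  by apply/matrixP => i j; rewrite !mxE.
rewrite det_tr det_Vandermonde /Defs.Vandermonde Cprod_ord.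
under eq_bigr => j _ do rewrite Cprod_ord.
under [RHS]eq_bigr => i _ do under eq_bigr => j _ do rewrite !mxE.
rewrite [RHS](exchange_big_dep xpredT) //=; apply: eq_bigr => j _.
rewrite (big_ord_widen n (fun i => (z j - z i)%C)); last exact: ltnW.
by [].
Qed.

Lemma Cprod_cat m n (f : nat -> C) :
  nprod (m + n) f = (nprod m f * Cprod (seq.iota m n) f)%C.
Proof. by rewrite iotaD !CprodE big_cat. Qed.

Lemma Cprod_shift m n (f : nat -> C) :
  Cprod (seq.iota m n) f = nprod n (fun i => f (m + i)%nat).
Proof. by rewrite -[X in seq.iota X n]addn0 iotaDl !CprodE big_map. Qed.

Lemma Vandermonde_split k (z : nat -> C) : Defs.Vandermonde (2 * k) z =
  (Defs.Vandermonde k z * Defs.Vandermonde k (fun i => z (k + i)%nat) *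
   nprod k (fun i => nprod k (fun j => z (k + j)%nat - z i)))%C.
Proof.
rewrite /Defs.Vandermonde mul2n -addnn Cprod_cat -Cmult_assoc.
congr Cmult; rewrite Cprod_exchange -Cprod_mul.
rewrite (Cprod_shift k); apply: Cprod_ext => j _.
by rewrite Cprod_cat (Cprod_shift k) Cmult_comm.
Qed.

Lemma Cprod_neg (l : seq nat) (f : nat -> C) :
  Cprod l (fun i => - f i)%C = (RtoC ((-1) ^ size l) * Cprod l f)%C.
Proof.
elim: l => [|a l IH] /=; first by ring.
by rewrite IH RtoC_mult; rewrite (_ : RtoC (-1) = (- (1))%C); [ring|apply: injective_projections; rewrite /=; ring].
Qed.

Lemma Cprod_scal (l : seq nat) c (f : nat -> C) :
  Cprod l (fun i => c * f i)%C = (Cpow c (size l) * Cprod l f)%C.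
Proof. by elim: l => [|a l IH] /=; rewrite ?IH; ring. Qed.

Lemma pow_m1_odd n : (-1) ^ n = if odd n then -1 else 1.
Proof. by elim: n => //= n ->; case: (odd n) => /=; ring. Qed.

Lemma pow_m1_sqr k : (RtoC ((-1) ^ k) * RtoC ((-1) ^ k))%C = 1.
Proof. by rewrite -RtoC_mult -Rpow_mult_distr (_ : -1 * -1 = 1) ?pow1 //; ring. Qed.

(** There are k^2 sign changes, and k^2 has the parity of k. *)
Lemma cross_sign k (z : nat -> C) :
  nprod k (fun i => nprod k (fun j => z (k + j)%nat - z i))%C =
  (RtoC ((-1) ^ k) * nprod k (fun i => nprod k (fun j => z i - z (k + j)%nat)))%C.
Proof.
have E i : nprod k (fun j => z (k + j)%nat - z i)%C =
    (RtoC ((-1) ^ k) * nprod k (fun j => z i - z (k + j)%nat))%C.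
  rewrite -[k in (-1) ^ k](size_iota 0 k) -Cprod_neg.
  by apply: Cprod_ext => j _; ring.
rewrite (Cprod_ext _ _ _ (fun i _ => E i)) Cprod_scal size_iota; congr Cmult.
rewrite -RtoC_pow -pow_mult; congr RtoC.
by rewrite !pow_m1_odd oddM andbb.
Qed.

Lemma Gfun_Vandermonde k F z :
  (off_diag k z -> F z = Ak_zeta k z) ->
  (Gfun k z * Cpow (Defs.Vandermonde (2 * k) z) 2)%C =
  (F z * (RtoC ((-1) ^ k) * (Defs.Vandermonde (2 * k) z *
     (Defs.Vandermonde k z * Defs.Vandermonde k (fun i => z (k + i)%nat)))))%C.
Proof.
move=> HF; case: (classic (off_diag k z)) => [oz|noz]; last first.
  have -> : Defs.Vandermonde (2 * k) z = 0.
    rewrite Vandermonde_split.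
    have [i [j [ik [jk E]]]] : exists i j, (i < k)%nat /\ (j < k)%nat /\ z i = z (k + j)%nat.
      apply: NNPP => H; apply: noz => i j ik jk E; apply: H; by exists i, j.
    suff -> : nprod k (fun i => nprod k (fun j => z (k + j)%nat - z i)%C) = 0 by ring.
    rewrite CprodE (bigD1_seq i) ?iota_uniq ?mem_iota //= CprodE (bigD1_seq j) ?iota_uniq ?mem_iota //=.
    by rewrite E (_ : (z (k + j)%nat - z (k + j)%nat)%C = 0); [Cring|ring].
  by rewrite /=; ring.
rewrite HF // /Ak_zeta /Gfun [Cpow _ 2]/= {1}Vandermonde_split cross_sign.
set P := Cprod _ (fun i => Cprod _ (fun j => zeta _)).
have -> : nprod k (fun i => nprod k (fun j => (z i - z (k + j)%nat) * zeta (1 + z i - z (k + j)%nat)))%C =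
   (nprod k (fun i => nprod k (fun j => z i - z (k + j)%nat)) * P)%C.
  by rewrite -Cprod_mul; apply: Cprod_ext => i _; rewrite Cprod_mul.
ring.
Qed.

Lemma block_mx_eq k n (e : n = (k + k)%nat) (A B : 'M[C]_k) (M : 'M[C]_n) :
  (forall i j : 'I_n, M i j =
     match fintype.split (cast_ord e i), fintype.split (cast_ord e j) with
     | inl i', inl j' => A i' j' | inr i', inr j' => B i' j' | _, _ => 0%ring end) ->
  (\det M = \det A * \det B)%ring.
Proof.
subst n => H; rewrite -(det_ublock A 0%ring B); congr (\det _)%ring.
apply/matrixP => i j; rewrite H !cast_ord_id !mxE.
by case: (fintype.split i) => i'; rewrite !mxE; case: (fintype.split j) => j'; rewrite ?mxE.
Qed.

(** The k by k determinant is bordered by an identity block, so that its permutations live in the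
    same group as those of the large determinant. *)
Lemma Vandermonde_first k (z : nat -> C) : Defs.Vandermonde k z =
  (\det (\matrix_(a < 2 * k, b < 2 * k) if (a < k)%nat && (b < k)%nat then z a ^+ b else (a == b)%:R))%ring.
Proof.
have e : (2 * k = k + k)%nat by rewrite mul2n addnn.
rewrite (block_mx_eq k _ e (\matrix_(a < k, b < k) (z a ^+ b)%ring) 1%:M) => [|i j].
  by rewrite det1 mulr1 Vandermonde_det.
case: (fintype.splitP (cast_ord e i)) => i' /= Ei; case: (fintype.splitP (cast_ord e j)) => j' /= Ej; rewrite ?mxE Ei Ej.
- by rewrite !ltn_ord.
- rewrite ltn_ord ltnNge leq_addr /= -val_eqE /= Ei Ej ltn_eqF //.
  by apply: leq_trans (ltn_ord i') (leq_addr _ _).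
- rewrite ltnNge leq_addr /= -val_eqE /= Ei Ej gtn_eqF //.
  by apply: leq_trans (ltn_ord j') (leq_addr _ _).
- by rewrite ltnNge leq_addr /= -val_eqE /= Ei Ej eqn_add2l.
Qed.

Lemma Vandermonde_second k (z : nat -> C) : Defs.Vandermonde k (fun i => z (k + i)%nat) =
  (\det (\matrix_(a < 2 * k, b < 2 * k) if (k <= a)%nat && (k <= b)%nat then z a ^+ (b - k) else (a == b)%:R))%ring.
Proof.
have e : (2 * k = k + k)%nat by rewrite mul2n addnn.
rewrite (block_mx_eq k _ e 1%:M (\matrix_(a < k, b < k) (z (k + a)%nat ^+ b)%ring)) => [|i j].
  by rewrite det1 mul1r Vandermonde_det.
case: (fintype.splitP (cast_ord e i)) => i' /= Ei; case: (fintype.splitP (cast_ord e j)) => j' /= Ej; rewrite ?mxE Ei Ej.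
- by rewrite leqNgt ltn_ord /= -val_eqE /= Ei Ej.
- rewrite leqNgt ltn_ord /= -val_eqE /= Ei Ej ltn_eqF //.
  by apply: leq_trans (ltn_ord i') (leq_addr _ _).
- rewrite leq_addr leqNgt ltn_ord /= -val_eqE /= Ei Ej gtn_eqF //.
  by apply: leq_trans (ltn_ord j') (leq_addr _ _).
- by rewrite !leq_addr addKn.
Qed.

Definition low (k : nat) : {set 'I_(2 * k)} := [set a | (nat_of_ord a < k)%nat].

(** A permutation that moves an index outside A meets a zero entry of an identity row. *)
Lemma det_perm_on n (A : {set 'I_n}) (M : 'M[C]_n) :
  (forall a b, a \notin A -> M a b = (a == b)%:R%ring) ->
  (\det M = \sum_(s : 'S_n | perm_on A s) (-1) ^+ s * \prod_(a in A) M a (s a))%ring.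
Proof.
move=> HM; rewrite /determinant (bigID (perm_on A)) /= [X in (_ + X)%ring]big1 ?addr0.
  apply: eq_bigr => s sA; congr (_ * _)%ring.
  rewrite (bigID (mem A)) /= [X in (_ * X)%ring]big1 ?mulr1 // => a aA.
  by rewrite HM // (out_perm sA) // eqxx.
move=> s /subsetPn[a]; rewrite inE => sa aA.
by rewrite (bigD1 a) //= HM // eq_sym (negbTE sa) mul0r mulr0.
Qed.

(** The position of i inside its own block. *)
Definition bidx (k i : nat) : nat := if (i < k)%nat then i else (i - k)%nat.

(** The two small determinants have disjoint supports, so s1 and s2 combine into one
    block-preserving permutation s, and the exponent of z_a is the position of s a in its block plus
    p a. *)
Lemma Vandermonde_expand k (z : nat -> C) :
  (Defs.Vandermonde (2 * k) z * (Defs.Vandermonde k z * Defs.Vandermonde k (fun i => z (k + i)%nat)))%C =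
  (\sum_(s1 : 'S_(2 * k) | perm_on (low k) s1) \sum_(s2 : 'S_(2 * k) | perm_on (~: low k) s2)
   \sum_(p : 'S_(2 * k)) (-1) ^+ (s1 * s2)%g * (-1) ^+ p *
     \prod_a z (nat_of_ord a) ^+ (bidx k ((s1 * s2)%g a) + p a))%ring.
Proof.
rewrite (Vandermonde_first k z) (det_perm_on _ (low k)); last first.
  by move=> a b; rewrite inE -leqNgt => ka; rewrite mxE ltnNge ka.
rewrite Vandermonde_second (det_perm_on _ (~: low k)); last first.
  by move=> a b; rewrite !inE negbK => ak; rewrite mxE leqNgt ak.
rewrite Vandermonde_det !CmultE mulrC big_distrl /= big_distrl /=; apply: eq_bigr => s1 h1.
rewrite -mulrA mulrCA mulr_suml; apply: eq_bigr => s2 h2.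
rewrite /determinant !mulr_sumr; apply: eq_bigr => p _.
rewrite odd_permM signr_addb.
set P1 := (\prod_(a in low k) _)%ring; set P2 := (\prod_(a in ~: low k) _)%ring; set P3 := (\prod_(a < _) _)%ring.
have -> : ((-1) ^+ s2 * P2 * ((-1) ^+ s1 * P1 * ((-1) ^+ p * P3)) =
   (-1) ^+ s1 * (-1) ^+ s2 * (-1) ^+ p * (P1 * P2 * P3) :> C)%ring by Cring.
congr (_ * _)%ring.
have -> : (\prod_a z (nat_of_ord a) ^+ (bidx k ((s1 * s2)%g a) + p a))%ring =
   ((\prod_(a in low k) z (nat_of_ord a) ^+ bidx k ((s1 * s2)%g a)) *
    (\prod_(a in ~: low k) z (nat_of_ord a) ^+ bidx k ((s1 * s2)%g a)) * P3)%ring.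
  under eq_bigr do rewrite exprD.
  rewrite big_split /=; congr (_ * _)%ring; last by apply: eq_bigr => a _; rewrite mxE.
  rewrite (bigID (mem (low k))) /=; congr (_ * _)%ring.
  by apply: eq_bigl => a; rewrite in_setC.
congr (_ * _ * _)%ring; apply: eq_bigr => a aA; rewrite mxE permM.
  have sA : s1 a \in low k by rewrite (perm_closed _ h1).
  rewrite (out_perm h2); last by rewrite inE negbK.
  by move: aA sA; rewrite /bidx !inE => -> ->.
rewrite (out_perm h1); last by move: aA; rewrite inE.
have sA : s2 a \in ~: low k by rewrite (perm_closed _ h2).
by move: aA sA; rewrite /bidx !inE -!leqNgt => -> sk; rewrite sk ltnNge sk.
Qed.

(** * Extraction of coefficients from the contour integral *)

Lemma is_cavg_bigsum (T : Type) n rho (l : seq T) (P : pred T) F v :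
  (forall i, P i -> is_cavg n rho (F i) (v i)) ->
  is_cavg n rho (fun z => \sum_(i <- l | P i) F i z)%ring (\sum_(i <- l | P i) v i)%ring.
Proof.
move=> H; elim: l => [|a l IH].
  have := is_cavg_const n rho 0; rewrite big_nil; congr is_cavg.
  by apply: functional_extensionality => z; rewrite big_nil.
have -> : (fun z => \sum_(i <- a :: l | P i) F i z)%ring =
    (fun z => if P a then F a z + \sum_(i <- l | P i) F i z else \sum_(i <- l | P i) F i z)%ring.
  by apply: functional_extensionality => z; rewrite big_cons.
rewrite big_cons; case: ifP => // Pa; apply: is_cavg_add => //; exact: H.
Qed.

(** Extension by the identity, linking permutations of ordinals with [nat_perm]. *)
Definition papp n (s : 'S_n) (i : nat) : nat :=
  if insub i is Some o then nat_of_ord (s o) else i.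

Lemma papp_ord n (s : 'S_n) (a : 'I_n) : papp n s a = s a.
Proof. by rewrite /papp valK. Qed.

Definition ccoef (k : nat) (x : R) (i : nat) : C := RtoC (if (i < k)%nat then x / 2 else - (x / 2)).

Lemma Cexp_sum (l : seq nat) (f : nat -> C) : Cexp (Csum l f) = Cprod l (fun i => Cexp (f i)).
Proof. by elim: l => [|a l IH] /=; [exact: Cexp_0|rewrite Cexp_add IH]. Qed.

Lemma Cexp_ccoef k x (z : nat -> C) :
  Cexp (RtoC (x / 2) * nsum k (fun i => z i - z (i + k)%nat))%C =
  nprod (2 * k) (fun i => Cexp (ccoef k x i * z i)%C).
Proof.
rewrite -Csum_scal Cexp_sum mul2n -addnn Cprod_cat (Cprod_shift k) -Cprod_mul.
apply: Cprod_ext => i; rewrite mem_iota0 => ik.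
rewrite -Cexp_add; congr Cexp; rewrite /ccoef ik ltnNge leq_addr /= [(i + k)%nat]addnC RtoC_opp.
ring.
Qed.

(** The power in the denominator is 2k - 1 and not 2k, because dz_i contributes one factor z_i. *)
Definition laurent_term (k : nat) (x : R) (e i : nat) (u : C) : C :=
  (Cpow u e * Cexp (ccoef k x i * u) / Cpow u (2 * k - 1))%C.

Lemma laurent_bounded k x e i rho : 0 < rho -> bounded_on (fun z => Cmod z = rho) (laurent_term k x e i).
Proof.
move=> r0; exists (rho ^ e * exp (Cmod (ccoef k x i) * rho) / rho ^ (2 * k - 1)) => u ur.
have u0 : u <> 0 by move=> E; rewrite E Cmod_0 in ur; lra.
rewrite /laurent_term Cmod_div; last exact: Cpow_neq0.
rewrite !Cmod_mult !Cmod_pow ur; apply: Rmult_le_compat_r.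
  by apply: Rlt_le; apply: Rinv_0_lt_compat; apply: pow_lt.
apply: Rmult_le_compat_l; first by apply: pow_le; lra.
rewrite Cmod_Cexp; apply: exp_le; apply: Rle_trans (proj2 (Re_bound _)) _.
by rewrite Cmod_mult ur; lra.
Qed.

Lemma cavg_laurent k x r F c rho (e : nat -> nat) B : 0 < r -> hol (2 * k) r F -> is_coefs (2 * k) r F c ->
  (forall i, 0 < rho i <= r) -> (2 * k - 1 <= B)%nat ->
  is_cavg (2 * k) rho (fun z => F z * nprod (2 * k) (fun i => laurent_term k x (e i) i (z i)))%C
    (Csum (lists_upto (2 * k) B) (fun m => c m * nprod (2 * k)
       (fun i => exp_coef (ccoef k x i) (nth 0%nat m i + e i) (2 * k - 1)))%C).
Proof.
move=> r0 hF Hc Hr kB.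
apply: (cavg_expand _ r _ _ _ (fun i => laurent_term k x (e i) i)
  (fun i a => exp_coef (ccoef k x i) (a + e i) (2 * k - 1)) B) => //.
- move=> i a _; apply: cint_ext (cint_pow_Cexp _ _ (a + e i) (2 * k - 1) (proj1 (Hr i))) => t _.
  by rewrite /laurent_term Cpow_add_r /Cdiv; ring.
- by move=> i a _ Ba; rewrite /exp_coef leqNgt (leq_ltn_trans kB) // (leq_trans Ba) // leq_addr.
- by move=> i _; apply: laurent_bounded; case: (Hr i).
Qed.

(** Entry (a, b) is the coefficient of u^{2k-1} in u^{m_a + bidx a + b} e^{cu}, with c = x/2 in the
    first block of rows and c = -x/2 in the second. *)
Definition coef_mx (k : nat) (x : R) (m : seq nat) : 'M[C]_(2 * k) :=
  (\matrix_(a < 2 * k, b < 2 * k)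
    exp_coef (ccoef k x a) (nth 0%nat m a + (bidx k a + b))%nat (2 * k - 1))%ring.

Lemma low_perm_block k (s1 s2 : 'S_(2 * k)) : perm_on (low k) s1 -> perm_on (~: low k) s2 ->
  forall a : 'I_(2 * k), ((s1 * s2)%g a < k)%nat = (a < k)%nat.
Proof.
move=> h1 h2 a; rewrite permM; case: (boolP (a \in low k)) => aA.
  have sA : s1 a \in low k by rewrite (perm_closed _ h1).
  rewrite (out_perm h2); last by rewrite inE negbK.
  by move: aA sA; rewrite !inE => -> ->.
rewrite (out_perm h1) //.
have sA : s2 a \in ~: low k by rewrite (perm_closed _ h2) inE.
by move: aA sA; rewrite !inE => /negbTE -> /negbTE ->.
Qed.

Lemma papp_block_perm k (s : 'S_(2 * k)) : (forall a : 'I_(2 * k), (s a < k)%nat = (a < k)%nat) ->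
  block_perm k (papp _ s) /\ nat_perm (2 * k) (papp _ s).
Proof.
move=> H.
have E i (iN : (i < 2 * k)%nat) : papp _ s i = s (Ordinal iN) by rewrite -(papp_ord _ _ (Ordinal iN)).
have inj i j : (i < 2 * k)%nat -> (j < 2 * k)%nat -> papp _ s i = papp _ s j -> i = j.
  move=> iN jN; rewrite (E i iN) (E j jN) => /val_inj /perm_inj /(congr1 val); exact.
have lo i : (i < k)%nat -> (papp _ s i < k)%nat.
  move=> ik; have iN : (i < 2 * k)%nat by lia.
  by rewrite (E i iN) H.
have hi j : (j < k)%nat -> (k <= papp _ s (k + j))%nat /\ (papp _ s (k + j) < 2 * k)%nat.
  move=> jk; have iN : (k + j < 2 * k)%nat by lia.
  by rewrite (E _ iN); split; [rewrite leqNgt H /=; lia|exact: ltn_ord].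
split; last first.
  by split=> // i iN; rewrite (E i iN); apply: ltn_ord.
split; first by split=> // i j ik jk; apply: inj; lia.
split; last by move=> j /hi[].
split=> [j jk|i j ik jk Eij]; first by have [] := hi j jk; lia.
have [hi1 _] := hi i ik; have [hj1 _] := hi j jk.
have : (k + i = k + j)%nat by apply: inj; lia.
by lia.
Qed.

Lemma coef_mx_permute k x m (s : 'S_(2 * k)) : (forall a : 'I_(2 * k), (s a < k)%nat = (a < k)%nat) ->
  (\matrix_(a < 2 * k, b < 2 * k)
    exp_coef (ccoef k x a) (nth 0%nat (permute (2 * k) (papp _ s) m) a + (bidx k (s a) + b))%nat (2 * k - 1))%ring =
  row_perm s (coef_mx k x m).
Proof.
move=> H; apply/matrixP => a b; rewrite !mxE nth_permute // papp_ord.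
by congr exp_coef; rewrite /ccoef H.
Qed.

Lemma card_low k : #|low k| = k.
Proof.
rewrite -sum1_card (eq_bigl (fun a : 'I_(2 * k) => (a < k)%nat)); last by move=> a; rewrite inE.
by rewrite -(big_ord_widen (2 * k) (fun=> 1%nat)) ?sum1_card ?card_ord //; lia.
Qed.

Lemma card_high k : #|~: low k| = k.
Proof. by rewrite cardsCs setCK card_ord card_low; lia. Qed.

(** The right-hand side does not depend on s. Reindexing m by s, under which [c] is invariant, turns
    the sum over p into the determinant of [coef_mx] with rows permuted by s, and the sign of that
    permutation cancels the factor in front. *)
Lemma sum_lists_permute k x c B (s : 'S_(2 * k)) :
  (forall a : 'I_(2 * k), (s a < k)%nat = (a < k)%nat) ->
  (forall p m, block_perm k p -> nat_perm (2 * k) p -> size m = (2 * k)%nat -> c (permute (2 * k) p m) = c m) ->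
  (\sum_(p : 'S_(2 * k)) (-1) ^+ s * (-1) ^+ p *
     Csum (lists_upto (2 * k) B) (fun m => c m * nprod (2 * k)
       (fun i => exp_coef (ccoef k x i) (nth 0%nat m i + (bidx k (papp _ s i) + papp _ p i))%nat (2 * k - 1)))%C =
   Csum (lists_upto (2 * k) B) (fun m => c m * \det (coef_mx k x m)))%ring.
Proof.
move=> Hs Hc; have [bp np] := papp_block_perm k s Hs.
under eq_bigr do rewrite CsumE mulr_sumr.
rewrite exchange_big /= CsumE.
have P : perm_eq [seq permute (2 * k) (papp _ s) m | m <- lists_upto (2 * k) B] (lists_upto (2 * k) B).
  apply: perm_permute_list => //; first exact: uniq_lists_upto.
    by move=> m; rewrite mem_lists_upto => /andP[/eqP].
  move=> m m'; rewrite !mem_lists_upto => /andP[/eqP <- am] mm'.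
  by rewrite (perm_size mm') eqxx (perm_all _ mm').
rewrite -[LHS](perm_big _ P) big_map /=; apply: eq_big_seq => m.
rewrite mem_lists_upto => /andP[/eqP sm _].
rewrite Hc //.
have -> : (\det (coef_mx k x m))%ring = ((-1) ^+ s * \det (row_perm s (coef_mx k x m)))%ring.
  by rewrite row_permE det_mulmx det_perm mulrA -signr_addb addbb mul1r.
rewrite -coef_mx_permute // /determinant !mulr_sumr; apply: eq_bigr => p _.
rewrite Cprod_ord.
have -> : (\prod_(i < 2 * k) exp_coef (ccoef k x i) (nth 0%nat (permute (2 * k) (papp _ s) m) i + (bidx k (papp _ s i) + papp _ p i))%nat (2 * k - 1))%ring =
  (\prod_(i < 2 * k) (\matrix_(a < 2 * k, b < 2 * k)
    exp_coef (ccoef k x a) (nth 0%nat (permute (2 * k) (papp _ s) m) a + (bidx k (s a) + b))%nat (2 * k - 1)) i (p i))%ring.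
  by apply: eq_bigr => i _; rewrite !mxE !papp_ord.
by Cring.
Qed.

Lemma Cprod_inv (l : seq nat) (f : nat -> C) : (forall i, i \in l -> f i <> 0) ->
  (/ Cprod l f)%C = Cprod l (fun i => / f i)%C /\ Cprod l f <> 0.
Proof.
elim: l => [|a l IH] H /=; first by rewrite Cinv_1; split=> //; case; lra.
have fa : f a <> 0 by apply: H; apply: mem_head.
have [|E nz] := IH; first by move=> i il; apply: H; rewrite inE il orbT.
by rewrite -E; split; [field|apply: Cmult_neq_0].
Qed.

Lemma mulrn_INR (u : C) n : (u *+ n)%ring = (RtoC (INR n) * u)%C.
Proof.
elim: n => [|n IH]; first by rewrite mulr0n /=; Cring.
by rewrite mulrSr IH S_INR RtoC_plus; Cring.
Qed.

Lemma twopii_neq0 : (RtoC (2 * PI) * Ci)%C <> 0.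
Proof.
apply: Cmult_neq_0; first by apply: RtoC_neq0; have := PI_RGT_0; lra.
by case; lra.
Qed.

Lemma jacobian k x (z : nat -> C) : (0 < k)%nat -> (forall i, (i < 2 * k)%nat -> z i <> 0) ->
  (/ nprod (2 * k) (fun i => Cpow (z i) (2 * k)) *
   nprod (2 * k) (fun i => Cexp (ccoef k x i * z i)) *
   nprod (2 * k) (fun i => RtoC (2 * PI) * Ci * z i))%C =
  (Cpow (RtoC (2 * PI) * Ci) (2 * k) *
   nprod (2 * k) (fun i => Cexp (ccoef k x i * z i) / Cpow (z i) (2 * k - 1)))%C.
Proof.
move=> k0 z0.
have zi i : i \in seq.iota 0 (2 * k) -> z i <> 0 by rewrite mem_iota0; apply: z0.
have [|-> _] := Cprod_inv (seq.iota 0 (2 * k)) (fun i => Cpow (z i) (2 * k)).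
  by move=> i /zi zi0; apply: Cpow_neq0.
rewrite -!Cprod_mul -[X in Cpow _ X](size_iota 0 (2 * k)) -Cprod_scal.
apply: Cprod_ext => i /zi zi0.
have -> : Cpow (z i) (2 * k) = (z i * Cpow (z i) (2 * k - 1))%C.
  by rewrite -Cpow_S; congr Cpow; lia.
by field; split=> //; apply: Cpow_neq0.
Qed.

Lemma Pk_integrand k x F (z : nat -> C) : (0 < k)%nat -> (forall i, (i < 2 * k)%nat -> z i <> 0) ->
  (off_diag k z -> F z = Ak_zeta k z) ->
  (Cpow (RtoC (2 * PI) * Ci) (2 * k) * RtoC ((-1) ^ k) *
   \sum_(s1 : 'S_(2 * k) | perm_on (low k) s1) \sum_(s2 : 'S_(2 * k) | perm_on (~: low k) s2)
   \sum_(p : 'S_(2 * k)) (-1) ^+ (s1 * s2)%g * (-1) ^+ p *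
     (F z * nprod (2 * k) (fun i =>
        laurent_term k x (bidx k (papp _ (s1 * s2)%g i) + papp _ p i) i (z i)))%C)%ring =
  (Gfun k z * Cpow (Defs.Vandermonde (2 * k) z) 2 /
     nprod (2 * k) (fun i => Cpow (z i) (2 * k)) *
   Cexp (RtoC (x / 2) * nsum k (fun i => z i - z (i + k)%nat)) *
   nprod (2 * k) (fun i => RtoC (2 * PI) * Ci * z i))%C.
Proof.
move=> k0 z0 HF; rewrite (Gfun_Vandermonde k F z HF) Cexp_ccoef Vandermonde_expand.
set W := (\sum_(s1 | _) _)%ring; set U := (X in (_ * (_ * X))%C).
set T := nprod (2 * k) (fun i => Cexp (ccoef k x i * z i) / Cpow (z i) (2 * k - 1))%C.
have -> : W = (F z * T * U)%ring.
  rewrite /W /U mulr_sumr; apply: eq_bigr => s1 _; rewrite mulr_sumr; apply: eq_bigr => s2 _.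
  rewrite mulr_sumr; apply: eq_bigr => p _.
  have -> : (\prod_a z (nat_of_ord a) ^+ (bidx k ((s1 * s2)%g a) + p a))%ring =
      nprod (2 * k) (fun i => Cpow (z i) (bidx k (papp _ (s1 * s2)%g i) + papp _ p i)).
    by rewrite Cprod_ord; apply: eq_bigr => a _; rewrite !papp_ord CpowE.
  have -> : nprod (2 * k) (fun i => laurent_term k x (bidx k (papp _ (s1 * s2)%g i) + papp _ p i) i (z i)) =
      (nprod (2 * k) (fun i => Cpow (z i) (bidx k (papp _ (s1 * s2)%g i) + papp _ p i)) * T)%C.
    rewrite /T -Cprod_mul; apply: Cprod_ext => i _.
    by rewrite /laurent_term /Cdiv; ring.
  by Cring.
have := jacobian k x z k0 z0; rewrite -/T.
set E := Cprod _ (fun i => Cexp _); set J := Cprod _ (fun i => (RtoC (2 * PI) * Ci * z i)%C).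
set V := Cprod _ _; set Q := Cpow _ _ => H.
transitivity (F z * (RtoC ((-1) ^ k) * U) * (Q * T))%C; first by Cring.
by rewrite -H /Cdiv; Cring.
Qed.

Lemma Pk_formula k rho x F c B : (0 < k)%nat -> hol (2 * k) (/ 48) F ->
  (forall z, polydisc (2 * k) (/ 48) z -> off_diag k z ->
    F z = Ak_zeta k z) ->
  is_coefs (2 * k) (/ 48) F c ->
  (forall p m, block_perm k p -> nat_perm (2 * k) p -> size m = (2 * k)%nat -> c (permute (2 * k) p m) = c m) ->
  (forall i, 0 < rho i <= / 48) -> (2 * k - 1 <= B)%nat ->
  Pk k rho x = Csum (lists_upto (2 * k) B) (fun m => c m * (\det (coef_mx k x m))%ring)%C.
Proof.
move=> k0 hF HF Hc sc Hr kB.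
set X := Csum _ _.
pose K := (Cpow (RtoC (2 * PI) * Ci) (2 * k) * RtoC ((-1) ^ k))%C.
have Hv : circle_int (2 * k) rho (fun z =>
     Cmult (Cdiv (Cmult (Gfun k z) (Cpow (Defs.Vandermonde (2 * k) z) 2))
                 (nprod (2 * k) (fun i => Cpow (z i) (2 * k))))
       (Cexp (Cmult (RtoC (x / 2))
                (nsum k (fun i => Cminus (z i) (z (i + k)%nat)))))) =
    (K * (RtoC (INR k`!) * (RtoC (INR k`!) * X)))%C.
  apply: circle_int_cavg.
  have -> : (RtoC (INR k`!) * (RtoC (INR k`!) * X))%C =
     (\sum_(s1 : 'S_(2 * k) | perm_on (low k) s1) \sum_(s2 : 'S_(2 * k) | perm_on (~: low k) s2)
       \sum_(p : 'S_(2 * k)) (-1) ^+ (s1 * s2)%g * (-1) ^+ p *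
     Csum (lists_upto (2 * k) B) (fun m => c m * nprod (2 * k)
       (fun i => exp_coef (ccoef k x i) (nth 0%nat m i + (bidx k (papp _ (s1 * s2)%g i) + papp _ p i))%nat (2 * k - 1)))%C)%ring.
    (* Each pair (s1, s2) contributes X, and there are k! permutations supported in each block. *)
    transitivity (\sum_(s1 : 'S_(2 * k) | perm_on (low k) s1) \sum_(s2 : 'S_(2 * k) | perm_on (~: low k) s2) X)%ring.
      by rewrite !sumr_const !card_perm card_low card_high !mulrn_INR.
    apply: eq_bigr => s1 h1; apply: eq_bigr => s2 h2.
    by rewrite (sum_lists_permute k x c B (s1 * s2)%g) //; apply: low_perm_block.
  apply: is_cavg_ext; last first.
  - apply: is_cavg_scal; apply: is_cavg_bigsum => s1 _; apply: is_cavg_bigsum => s2 _; apply: is_cavg_bigsum => p _.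
    apply: is_cavg_scal.
    apply: (cavg_laurent k x (/ 48) F c rho (fun i => bidx k (papp _ (s1 * s2)%g i) + papp _ p i)%nat B) => //.
    by lra.
  - move=> w Tw; apply: Pk_integrand => //.
      by move=> i iN w0; have := Tw i iN; rewrite w0 Cmod_0; have := Hr i; lra.
    by apply: HF; apply: torus_polydisc Tw => i _; have := Hr i; lra.
  - by move=> i _; have := Hr i; lra.
rewrite /Pk Hv /K.
have f0 : RtoC (INR k`!) <> 0 by apply: RtoC_neq0; have := INR_fact_pos k; lra.
have q0 : Cpow (RtoC (2 * PI) * Ci)%C (2 * k) <> 0 by apply: Cpow_neq0; exact: twopii_neq0.
have -> : RtoC ((-1) ^ k / INR (factorial k) ^ 2) = (RtoC ((-1) ^ k) / (RtoC (INR k`!) * RtoC (INR k`!)))%C.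
  rewrite -RtoC_mult -RtoC_div /=; last by have := INR_fact_pos k; nra.
  by rewrite Rmult_1_r.
(* One sign is the prefactor of P_k, the other comes from the cross differences in the Vandermonde
   product. *)
transitivity ((RtoC ((-1) ^ k) * RtoC ((-1) ^ k)) * X)%C; last by rewrite pow_m1_sqr; ring.
by field; split.
Qed.

(** * Determinants of reciprocal Gamma values *)

Section CoefMatrix.
Local Open Scope ring_scope.

(** With indices counted from 0, the argument 2k - i - j + 2 - a_i becomes 2k - i - j - a_i, and
    Gamma of it is the factorial of one less. The truncated subtraction is exact under the guard. *)
Lemma invGammaE n i j c :
  invGamma (Posz n - Posz i - Posz j - Posz c) =
  if (c + (i + j) < n)%nat then ((n - 1 - (c + (i + j)))`!)%:R^-1 else 0.
Proof.
case: ltnP => h.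
  have -> : Posz n - Posz i - Posz j - Posz c = Posz (n - 1 - (c + (i + j))).+1 by lia.
  by [].
have [m ->] : exists m, Posz n - Posz i - Posz j - Posz c = - Posz m.
  by exists (c + (i + j) - n)%nat; lia.
by case: m.
Qed.

Definition real_coef_mx (k : nat) (y : R) (m : seq nat) : 'M[R]_(2 * k) :=
  \matrix_(i < 2 * k, j < 2 * k)
    let A := (nth 0%nat m i + (bidx k i + j))%nat in
    if (A <= 2 * k - 1)%nat then (if (i < k)%nat then y else - y) ^+ (2 * k - 1 - A) / ((2 * k - 1 - A)`!)%:R else 0.

Lemma coef_mx_real k x m : coef_mx k x m = map_mx RtoC (real_coef_mx k (x / 2)%R m).
Proof.
apply/matrixP => i j; rewrite !mxE /exp_coef; case: ifP => _; last by [].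
set N := (_ - _ - _)%nat.
rewrite /ccoef -RtoC_pow -RtoC_div; last by have := INR_fact_pos N; lra.
by congr RtoC; rewrite RpowE INRE /Rdiv RinvE RmultE.
Qed.

Lemma signr_eq_even m n k : (m + n = 2 * k)%nat -> (-1) ^+ m = (-1) ^+ n :> R.
Proof.
move=> e; rewrite -signr_odd -[RHS]signr_odd; congr (_ ^+ nat_of_bool _).
by lia.
Qed.

(** In the lower rows (-y)^{2k-1-A} carries the sign (-1)^{A+1} with A = b_i + i + j. The part
    (-1)^{i+j+1} is already in [Mmat]; the rest, (-1)^{b_i}, is left for the prefactor of
    [Mtilde]. *)
Lemma real_coef_entry k y a b (i j : 'I_(2 * k)) : (0 < k)%nat -> size a = k -> size b = k ->
  let A := (nth 0%nat (a ++ b) i + (bidx k i + j))%nat in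
  real_coef_mx k y (a ++ b) i j =
  (if (i < k)%nat then 1 else (-1) ^+ nth 0%nat b (i - k)) * y ^+ (2 * k - 1 - A) * Mmat k a b i j /\
  ((2 * k - 1 < A)%nat -> Mmat k a b i j = 0).
Proof.
move=> k0 sa sb A; rewrite !mxE; cbv zeta; rewrite -/A.
have AE : A = (if (i < k)%nat then nth 0%nat a i + (i + j) else nth 0%nat b (i - k) + ((i - k) + j))%nat.
  by rewrite /A nth_cat sa /bidx; case: ifP.
have lt2 : (A <= 2 * k - 1)%nat = (A < 2 * k)%nat by lia.
rewrite lt2 (_ : ltn i k = (i < k)%nat) //.
case: (ltnP i k) AE => ik AE; rewrite invGammaE -AE.
  split; last by move=> h; rewrite ltnNge (_ : (2 * k <= A)%nat) //; lia.
  by case: ifP => _; rewrite ?mulr0 // mul1r.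
split; last by move=> h; rewrite ltnNge (_ : (2 * k <= A)%nat) ?mulr0 //; lia.
case: ifP => hA; last by rewrite !mulr0.
rewrite (exprNn y) (signr_eq_even (2 * k - 1 - A) (nth 0%nat b (i - k) + (i - k + j + 1)) k); last by lia.
rewrite exprD -!mulrA; congr (_ * _).
by rewrite mulrCA.
Qed.

Lemma sum_ord_double n : (2 * (\sum_(i < n) i) = n * (n - 1))%nat.
Proof. by elim: n => [|n IH]; [rewrite big_ord0|rewrite big_ord_recr /= mulnDr IH; nia]. Qed.

Lemma double_square k : (2 * k * (2 * k - 1) = k * k + k * (k - 1) + k * (2 * k - 1))%nat.
Proof.
case: k => // j.
have h1 : (2 * j.+1 - 1 = 2 * j + 1)%nat by lia.
have h2 : (j.+1 - 1 = j)%nat by lia.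
rewrite h1 h2; lia.
Qed.

Lemma big_upper (T : Type) (idx : T) op k (F : nat -> T) :
  \big[op/idx]_(k <= i < 2 * k) F i = \big[op/idx]_(i < k) F (i + k)%nat.
Proof.
rewrite -[X in index_iota X _]add0n big_addn (_ : (2 * k - k)%nat = k); last by lia.
by rewrite big_mkord.
Qed.

Lemma sum_bidx k : (\sum_(i < 2 * k) bidx k i = 2 * (\sum_(i < k) i))%nat.
Proof.
rewrite -(big_mkord xpredT (bidx k)) (@big_cat_nat _ _ _ k) //=; last by lia.
rewrite [in RHS]mul2n -addnn; congr addn.
  by rewrite big_mkord; apply: eq_bigr => i _; rewrite /bidx ltn_ord.
by rewrite big_upper; apply: eq_bigr => i _; rewrite /bidx ltnNge leq_addl addnK.
Qed.

Lemma sum_nth_ord n (m : seq nat) : size m = n -> (\sum_(i < n) nth 0%nat m i = sumn m)%nat.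
Proof. by move=> <-; rewrite sumnE (big_nth 0%nat) big_mkord. Qed.

(** Homogeneity: in every nonzero term of the determinant the exponents of y add up to 2k(2k-1) - r
    - k(k-1) - k(2k-1) = k^2 - r. If r > k^2, each term contains an entry with A > 2k - 1, which is
    0. *)
Lemma det_real_coef_mx k y a b : (0 < k)%nat -> size a = k -> size b = k ->
  let r := (sumn a + sumn b)%nat in
  \det (real_coef_mx k y (a ++ b)) =
  if (r <= k * k)%nat then y ^+ (k * k - r) * Mtilde k a b else 0.
Proof.
move=> k0 sa sb r; set m := a ++ b.
pose A (i j : 'I_(2 * k)) := (nth 0%nat m i + (bidx k i + j))%nat.
pose sg (i : 'I_(2 * k)) : R := if (i < k)%nat then 1 else (-1) ^+ nth 0%nat b (i - k).
have ent i j := real_coef_entry k y a b i j k0 sa sb.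
have sizem : size m = (2 * k)%nat by rewrite size_cat sa sb; lia.
have sumA (s : 'S_(2 * k)) : (\sum_i A i (s i) = r + k * (k - 1) + k * (2 * k - 1))%nat.
  rewrite /A !big_split /= sum_nth_ord // sum_bidx sum_ord_double sumn_cat -/r.
  rewrite (reindex_inj (@perm_inj _ s^-1%g)) /=.
  under eq_bigr do rewrite permKV.
  have := sum_ord_double (2 * k); rewrite -mulnA => /eqP; rewrite eqn_pmul2l // => /eqP.
  by move=> ->; rewrite addnA.
have sgE : \prod_i sg i = (-1) ^+ sumn b.
  rewrite /sg -(big_mkord xpredT (fun i => if (i < k)%nat then 1 else (-1) ^+ nth 0%nat b (i - k))).
  rewrite (@big_cat_nat _ _ _ k) //=; last by lia.
  rewrite [X in X * _]big1_seq ?mul1r; last first.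
    by move=> i; rewrite mem_index_iota => /andP[_ /andP[_ ->]].
  rewrite big_upper -(sum_nth_ord k b sb) expr_sum; apply: eq_bigr => i _.
  by rewrite ltnNge leq_addl /= addnK.
have term (s : 'S_(2 * k)) : \prod_i real_coef_mx k y m i (s i) =
    if (r <= k * k)%nat then y ^+ (k * k - r) * (-1) ^+ sumn b * \prod_i Mmat k a b i (s i) else 0.
  under eq_bigr => i _ do rewrite (proj1 (ent i (s i))).
  rewrite !big_split /= -/(sg _) -/m.
  case: (boolP [forall i, (A i (s i) <= 2 * k - 1)%nat]) => [/forallP hA|].
    have tot : (\sum_i (2 * k - 1 - A i (s i)) + \sum_i A i (s i) = 2 * k * (2 * k - 1))%nat.
      rewrite -big_split /= (eq_bigr (fun=> (2 * k - 1)%nat)) ?sum_nat_const ?card_ord //.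
      by move=> i _; rewrite subnK.
    rewrite sumA double_square in tot.
    have rk : (r <= k * k)%nat by lia.
    have tot' : (\sum_i (2 * k - 1 - A i (s i)) = k * k - r)%nat by lia.
    rewrite rk sgE prodrXr (_ : (\sum_i _)%nat = (k * k - r)%nat); last exact: tot'.
    by rewrite [(-1) ^+ _ * _]mulrC.
  rewrite negb_forall => /existsP[i]; rewrite -ltnNge => hA.
  have M0 : \prod_i Mmat k a b i (s i) = 0 by rewrite (bigD1 i) //= (proj2 (ent i (s i)) hA) mul0r.
  by rewrite M0 !mulr0; case: ifP.
rewrite /Mtilde /determinant; case: ifP => rk; last first.
  by rewrite big1 // => s _; rewrite term rk mulr0.
rewrite mulrA mulr_sumr; apply: eq_bigr => s _; rewrite term rk.
by rewrite mulrCA.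
Qed.

Lemma det_coef_mx k x a b : (0 < k)%nat -> size a = k -> size b = k ->
  \det (coef_mx k x (a ++ b)) =
  RtoC (if (sumn a + sumn b <= k * k)%nat
        then (x / 2)%R ^+ (k * k - (sumn a + sumn b)) * Mtilde k a b else 0).
Proof. by move=> k0 sa sb; rewrite coef_mx_real det_map_mx det_real_coef_mx. Qed.

End CoefMatrix.

(** * Symmetries of b_k and of the determinants *)

Section TaylorSymmetry.
Variable k : nat.
Hypothesis k0 : (0 < k)%nat.

Let tc := taylor_coeff (2 * k) (off_diag k) (bk_fun k).

Lemma bk_taylor : is_taylor_expansion (2 * k) (off_diag k) (bk_fun k) tc.
Proof. by have [F [_ _ []]] := bk_hol k k0. Qed.

Lemma bk_coef_block p m : block_perm k p -> nat_perm (2 * k) p -> size m = (2 * k)%nat ->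
  tc (permute (2 * k) p m) = tc m.
Proof.
move=> bp np sm; have T := bk_taylor.
have one (z : nat -> C) : (fun i => RtoC 1 * z (p i))%C = (fun i => z (p i)).
  by apply: functional_extensionality => i; ring.
have [p1 [p2 p3]] := bp.
have T' := taylor_sym (2 * k) (/ 48) (off_diag k) (bk_fun k) tc 1 p ltac:(lra) Rabs_R1 np.
have E := taylor_unique _ _ _ _ _ (off_diag_distinct k) (T' _ _ T) T m sm.
rewrite -E ?pow1; [ring| |].
- move=> z oz; rewrite one => i j ik jk.
  rewrite -[p (k + j)%nat](subnKC (p3 j jk)); apply: oz; first exact: (proj1 p1).
  exact: (proj1 p2).
- by move=> z _ _; rewrite one; apply: bk_fun_block_perm.
Qed.

Lemma nat_perm_swap : nat_perm (2 * k) (swap k).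
Proof.
split=> [i iN|i j iN jN]; first by rewrite /swap; case: (ltnP i k) => ik; lia.
rewrite /swap; case: (ltnP i k) => ik; case: (ltnP j k) => jk; lia.
Qed.

Lemma permute_swap a b : size a = k -> size b = k -> permute (2 * k) (swap k) (a ++ b) = b ++ a.
Proof.
move=> sa sb; apply: (@eq_from_nth _ 0%nat); first by rewrite size_permute size_cat sa sb; lia.
move=> i; rewrite size_permute => iN; rewrite nth_permute // !nth_cat sa sb /swap.
case: (ltnP i k) => ik; first by rewrite ltnNge leq_addr addKn.
have h : (i - k < k)%nat by lia.
by rewrite h.
Qed.

Lemma bk_coef_swap a b : size a = k -> size b = k ->
  tc (a ++ b) = (RtoC ((-1) ^ (sumn a + sumn b)%nat) * tc (b ++ a))%C.
Proof.
move=> sa sb; have T := bk_taylor.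
have T' := taylor_sym (2 * k) (/ 48) (off_diag k) (bk_fun k) tc (-1) (swap k) ltac:(lra) _ nat_perm_swap.
have r1 : Rabs (-1) = 1 by rewrite Rabs_left; lra.
have sm : size (a ++ b) = (2 * k)%nat by rewrite size_cat sa sb; lia.
have E := taylor_unique _ _ _ _ _ (off_diag_distinct k) T (T' r1 _ _ T) _ sm.
rewrite {1}E ?sumn_cat ?permute_swap // => [z oz i j ik jk|z Dz _]; last exact: bk_fun_swap.
rewrite /swap ik ltnNge leq_addr /= addKn => H; apply: (oz j i jk ik).
have m1 (u : C) : (RtoC (-1) * (RtoC (-1) * u))%C = u.
  by apply: injective_projections; rewrite /=; ring.
by rewrite -[z j]m1 -H m1.
Qed.

(** Separate rearrangements of the two tuples are glued into one block-preserving permutation of the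
    2k variables. *)
Lemma bk_coef_perm a b s t : size a = k -> size b = k -> perm_eq s a -> perm_eq t b ->
  tc (s ++ t) = tc (a ++ b).
Proof.
move=> sa sb /(perm_iotaP 0%nat)[Is pIs ->] /(perm_iotaP 0%nat)[It pIt ->].
rewrite sa in pIs; rewrite sb in pIt.
have zI : size Is = k by rewrite (perm_size pIs) size_iota.
have zJ : size It = k by rewrite (perm_size pIt) size_iota.
have uI : uniq Is by rewrite (perm_uniq pIs) iota_uniq.
have uJ : uniq It by rewrite (perm_uniq pIt) iota_uniq.
have ltI i : (i < k)%nat -> (nth 0%nat Is i < k)%nat.
  move=> ik; have : nth 0%nat Is i \in Is by rewrite mem_nth // zI.
  by rewrite (perm_mem pIs) mem_iota.
have ltJ i : (i < k)%nat -> (nth 0%nat It i < k)%nat.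
  move=> ik; have : nth 0%nat It i \in It by rewrite mem_nth // zJ.
  by rewrite (perm_mem pIt) mem_iota.
pose p i := if (i < k)%nat then nth 0%nat Is i else (k + nth 0%nat It (i - k))%nat.
have pl i : (i < k)%nat -> p i = nth 0%nat Is i by rewrite /p => ->.
have ph j : p (k + j)%nat = (k + nth 0%nat It j)%nat by rewrite /p ltnNge leq_addr /= addKn.
have injI i j : (i < k)%nat -> (j < k)%nat -> nth 0%nat Is i = nth 0%nat Is j -> i = j.
  by move=> ik jk /eqP; rewrite nth_uniq ?zI // => /eqP.
have injJ i j : (i < k)%nat -> (j < k)%nat -> nth 0%nat It i = nth 0%nat It j -> i = j.
  by move=> ik jk /eqP; rewrite nth_uniq ?zJ // => /eqP.
have bp : block_perm k p.
  split; last split.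
  - by split=> [i ik|i j ik jk]; rewrite !pl //; [exact: ltI|exact: injI].
  - by split=> [i ik|i j ik jk]; rewrite !ph !addKn; [exact: ltJ|exact: injJ].
  - by move=> j jk; rewrite ph leq_addr.
have np : nat_perm (2 * k) p.
  split=> [i iN|i j iN jN].
    rewrite /p; case: (ltnP i k) => ik; first by have := ltI i ik; lia.
    by have := ltJ (i - k)%nat ltac:(lia); lia.
  rewrite /p; case: (ltnP i k) => ik; case: (ltnP j k) => jk.
  - exact: injI.
  - by have := ltI i ik; lia.
  - by have := ltI j jk; lia.
  - by move=> E; have := injJ (i - k)%nat (j - k)%nat ltac:(lia) ltac:(lia) ltac:(lia); lia.
rewrite -(bk_coef_block p (a ++ b)) //; last by rewrite size_cat sa sb; lia.
congr tc; apply: (@eq_from_nth _ 0%nat).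
  by rewrite size_permute size_cat !size_map zI zJ; lia.
move=> i; rewrite size_cat !size_map zI zJ => iN.
rewrite nth_permute; last by lia.
rewrite !nth_cat size_map zI sa /p; case: (ltnP i k) => ik.
  by rewrite (nth_map 0%nat) ?zI // ltI.
by rewrite (nth_map 0%nat) ?zJ; [rewrite ltnNge leq_addr addKn|lia].
Qed.

Definition swap_ord (i : 'I_(2 * k)) : 'I_(2 * k) := Ordinal (proj1 nat_perm_swap i (ltn_ord i)).

Lemma swap_ord_inj : injective swap_ord.
Proof.
move=> i j /(congr1 val) E; apply: val_inj.
exact: (proj2 nat_perm_swap i j (ltn_ord i) (ltn_ord j) E).
Qed.

Definition swap_perm : 'S_(2 * k) := perm swap_ord_inj.

(* The sign of the block swap is read off from its effect on a nonzero Vandermonde determinant. *)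
Lemma swap_perm_sign : ((-1) ^+ swap_perm = RtoC ((-1) ^ k) :> C)%ring.
Proof.
pose z (i : nat) : C := RtoC (INR i).
have V0 : Defs.Vandermonde (2 * k) z <> 0.
  rewrite /Defs.Vandermonde; apply: (proj2 (Cprod_inv _ _ _)) => j _; apply: (proj2 (Cprod_inv _ _ _)) => i.
  rewrite mem_iota0 => ij; rewrite /z -RtoC_minus; apply: RtoC_neq0.
  by move/ltP/lt_INR: ij; lra.
have E1 : Defs.Vandermonde (2 * k) (fun i => z (swap k i)) = ((-1) ^+ swap_perm * Defs.Vandermonde (2 * k) z)%ring.
  rewrite !Vandermonde_det -det_perm -det_mulmx -row_permE; congr (\det _)%ring.
  by apply/matrixP => i j; rewrite !mxE permE.
have E2 : Defs.Vandermonde (2 * k) (fun i => z (swap k i)) = (RtoC ((-1) ^ k) * Defs.Vandermonde (2 * k) z)%C.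
  have sl i : (i < k)%nat -> swap k i = (k + i)%nat by rewrite /swap => ->.
  have sr j : swap k (k + j) = j by rewrite /swap ltnNge leq_addr /= addKn.
  have V1 : Defs.Vandermonde k (fun i => z (swap k i)) = Defs.Vandermonde k (fun i => z (k + i)%nat).
    apply: Cprod_ext => j; rewrite mem_iota0 => jk.
    apply: Cprod_ext => i; rewrite mem_iota0 => ij.
    by rewrite !sl //; apply: ltn_trans ij jk.
  have V2 : Defs.Vandermonde k (fun i => z (swap k (k + i)%nat)) = Defs.Vandermonde k z.
    by apply: Cprod_ext => j _; apply: Cprod_ext => i _; rewrite !sr.
  have cs := cross_sign k (fun i => z (swap k i)); cbv beta in cs.
  rewrite !Vandermonde_split V1 V2 cs.
  have -> : nprod k (fun i => nprod k (fun j => z (swap k i) - z (swap k (k + j)%nat)))%C =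
     nprod k (fun i => nprod k (fun j => z (k + j)%nat - z i))%C.
    rewrite Cprod_exchange; apply: Cprod_ext => j _; apply: Cprod_ext => i.
    by rewrite mem_iota0 => ik; rewrite sr sl.
  by ring.
have : ((-1) ^+ swap_perm * Defs.Vandermonde (2 * k) z = RtoC ((-1) ^ k) * Defs.Vandermonde (2 * k) z :> C)%ring.
  by rewrite -E1.
rewrite -!CmultE => /(f_equal (fun u => u / Defs.Vandermonde (2 * k) z)%C).
by rewrite /Cdiv -!Cmult_assoc Cinv_r // !Cmult_1_r.
Qed.

(** Exchanging the blocks of rows also exchanges the exponentials with parameters x/2 and -x/2,
    which amounts to negating x. *)
Lemma coef_mx_swap x a b : size a = k -> size b = k ->
  coef_mx k x (b ++ a) = row_perm swap_perm (coef_mx k (- x) (a ++ b)).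
Proof.
move=> sa sb; apply/matrixP => i j; rewrite !mxE permE /= -(permute_swap a b) // nth_permute //.
have -> : bidx k (swap k i) = bidx k i.
  by rewrite /bidx /swap; case: (ltnP i k) => ik; [rewrite ltnNge leq_addr addKn|rewrite (_ : (i - k < k)%nat = true) //; have := ltn_ord i; lia].
congr exp_coef; rewrite /ccoef /swap; congr RtoC; have iN := ltn_ord i; case: (ltnP i k) => ik.
  by rewrite ltnNge leq_addr /=; field.
by rewrite (_ : (i - k < k)%nat); [field|lia].
Qed.

(** The sign of the block exchange is (-1)^k, and negating x contributes (-1)^{k^2 - r}; together
    they give (-1)^r. *)
Lemma Mtilde_swap a b : size a = k -> size b = k -> (sumn a + sumn b <= k * k)%nat ->
  Mtilde k b a = (-1) ^ (sumn a + sumn b)%nat * Mtilde k a b.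
Proof.
(* At x = 2 the power of x/2 is 1 on one side and a bare sign on the other. *)
move=> sa sb rk; have := coef_mx_swap 2 a b sa sb.
move/(f_equal (fun M => \det M)%ring); rewrite row_permE det_mulmx det_perm swap_perm_sign.
rewrite !det_coef_mx // [(sumn b + sumn a)%nat]addnC rk -!RpowE -CmultE -RtoC_mult => /RtoC_inj.
have e1 : 2 / 2 = 1 by field.
have e2 : - (2) / 2 = -1 by field.
rewrite e1 e2 -!RmultE pow1 Rmult_1_l => ->.
rewrite -Rmult_assoc -pow_add; apply: (f_equal (Rmult^~ _)).
by rewrite !pow_m1_odd; congr (if _ then _ else _); rewrite plusE oddD oddB // oddM andbb addbA addbb.
Qed.

End TaylorSymmetry.

(** * From pairs of tuples to ordered pairs of partitions *)

Section Grouping.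
Local Open Scope ring_scope.

Lemma lex_geC a b : size a = size b -> lex_ge b a = (a == b) || ~~ lex_ge a b.
Proof.
elim: a b => [|x a IH] [|y b] //= [] sab; rewrite eqseq_cons (IH b sab) !/ltn /=.
by case: (ltngtP x y) => //= _; case: (a == b); case: (lex_ge a b).
Qed.

Lemma lex_ge_refl a : lex_ge a a.
Proof. by elim: a => //= x a ->; rewrite eqxx orbT. Qed.

Lemma sum_lists_cat (V : nmodType) m n B (h : seq nat -> V) :
  \sum_(s <- lists_upto (m + n) B) h s =
  \sum_(a <- lists_upto m B) \sum_(b <- lists_upto n B) h (a ++ b).
Proof.
transitivity (\sum_(s <- [seq a ++ b | a <- lists_upto m B, b <- lists_upto n B]) h s); last first.
  by rewrite big_allpairs_dep.
apply: perm_big; apply: uniq_perm; first exact: uniq_lists_upto.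
  apply: allpairs_uniq; [exact: uniq_lists_upto|exact: uniq_lists_upto|].
  move=> [a b] [a' b'] /allpairsP[[u v] [/= ul vl [-> ->]]] /allpairsP[[u' v'] [/= ul' vl' [-> ->]]] /= /eqP.
  move: ul ul'; rewrite !mem_lists_upto => /andP[/eqP su _] /andP[/eqP su' _].
  by rewrite eqseq_cat ?su // => /andP[/eqP -> /eqP ->].
move=> s; rewrite mem_lists_upto; apply/idP/allpairsP.
  move=> /andP[/eqP ss al]; exists (take m s, drop m s); rewrite /= cat_take_drop.
  have [al1 al2] : all (fun x => (x <= B)%nat) (take m s) /\ all (fun x => (x <= B)%nat) (drop m s).
    by apply/andP; rewrite -all_cat cat_take_drop.
  by rewrite !mem_lists_upto size_drop size_takel ss ?leq_addr // addKn !eqxx.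
move=> [[a b] [/= al bl ->]]; move: al bl; rewrite !mem_lists_upto.
by move=> /andP[/eqP sa aa] /andP[/eqP sb ab]; rewrite size_cat sa sb eqxx all_cat aa ab.
Qed.

Definition partitions (k B : nat) : seq (seq nat) := [seq a <- lists_upto k B | path.sorted geq a].

Lemma mem_partitions k B a : (a \in partitions k B) = is_partition_k k a && all (fun x => (x <= B)%nat) a.
Proof. by rewrite mem_filter mem_lists_upto /is_partition_k; case: path.sorted; rewrite ?andbT ?andbF. Qed.

(** Tuples are grouped by their nonincreasing rearrangement; bounded entries are preserved by
    sorting. *)
Lemma sum_by_permutations (V : nmodType) k B (h : seq nat -> V) :
  \sum_(s <- lists_upto k B) h s = \sum_(a <- partitions k B) \sum_(s <- permutations a) h s.
Proof.
have geq_tot : total geq by move=> x y; apply: leq_total.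
have geq_tr : transitive geq by move=> y u v /= yu vy; exact: leq_trans vy yu.
have geq_anti : antisymmetric geq by move=> u v /= /andP[vu uv]; apply/eqP; rewrite eqn_leq uv vu.
have sort_mem s : s \in lists_upto k B -> path.sort geq s \in partitions k B.
  rewrite mem_lists_upto mem_partitions /is_partition_k => /andP[/eqP ss al].
  by rewrite size_sort ss eqxx path.sort_sorted // (perm_all _ (permEl (path.perm_sort geq s))).
transitivity (\sum_(s <- lists_upto k B) \sum_(a <- partitions k B | path.sort geq s == a) h s).
  apply: eq_big_seq => s sl.
  rewrite big_mkcond (bigD1_seq (path.sort geq s)) ?sort_mem ?filter_uniq ?uniq_lists_upto //=.
  rewrite eqxx big1 ?addr0 // => a na; rewrite eq_sym (negbTE na) //.
rewrite (exchange_big_dep xpredT) //=; apply: eq_big_seq => a.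
rewrite mem_partitions => /andP[/andP[/eqP sa srt] al].
rewrite -big_filter; apply: perm_big; apply: uniq_perm.
- by rewrite filter_uniq // uniq_lists_upto.
- exact: permutations_uniq.
move=> s; rewrite mem_filter mem_permutations mem_lists_upto; apply/idP/idP.
  by move=> /andP[/eqP <- _]; rewrite perm_sym (permEl (path.perm_sort geq s)).
move=> sp; rewrite (perm_size sp) sa eqxx (perm_all _ sp) al !andbT.
apply/eqP; apply: (path.sorted_eq geq_tr geq_anti) => //; first exact: path.sort_sorted.
by rewrite (permPl (permEl (path.perm_sort geq s))).
Qed.

(** The pairs below the diagonal are reflected onto those above; the diagonal is met once, which is
    the weight 2^{1 - delta}. *)
Lemma sum_lex_fold (V : nmodType) (l : seq (seq nat)) n (T : seq nat -> seq nat -> V) :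
  (forall a, a \in l -> size a = n) ->
  (forall a b, a \in l -> b \in l -> T b a = T a b) ->
  \sum_(a <- l) \sum_(b <- l) T a b =
  \sum_(a <- l) \sum_(b <- l | lex_ge a b) T a b *+ (if a == b then 1 else 2).
Proof.
move=> sl sT.
transitivity (\sum_(a <- l) (\sum_(b <- l | lex_ge a b) T a b + \sum_(b <- l | ~~ lex_ge a b) T a b)).
  by apply: eq_bigr => a _; rewrite (bigID (lex_ge a)).
rewrite big_split /=.
have -> : \sum_(a <- l) \sum_(b <- l | ~~ lex_ge a b) T a b = \sum_(a <- l) \sum_(b <- l | ~~ lex_ge b a) T a b.
  rewrite (exchange_big_dep xpredT) //=; apply: eq_big_seq => b bl.
  by rewrite big_seq_cond [RHS]big_seq_cond; apply: eq_bigr => a /andP[al _]; rewrite sT.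
rewrite -big_split /=; apply: eq_big_seq => a al.
rewrite (big_mkcond (lex_ge a)) (big_mkcond (fun b => ~~ lex_ge b a)) -big_split [RHS]big_mkcond /=.
apply: eq_big_seq => b bl.
rewrite (lex_geC a b) ?(sl a) ?(sl b) // negb_or negbK.
case: (eqVneq a b) => [->|_] /=; first by rewrite lex_ge_refl addr0 mulr1n.
by case: ifP => _; rewrite ?mulr2n ?addr0.
Qed.

Lemma mem_pairs (T1 T2 : eqType) (l : seq T1) (l' : seq T2) a b :
  ((a, b) \in [seq (u, v) | u <- l, v <- l']) = (a \in l) && (b \in l').
Proof.
apply/allpairsP/andP => [[[u v] [/= ul vl [-> ->]]]|[al bl]] //.
by exists (a, b).
Qed.

(** A tuple of total at most r has entries at most r, so the boxes of side r in [index_pairs] and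
    the common box of side B contain the same relevant partitions. *)
Lemma sum_index_pairs (V : nmodType) k B N (w : seq nat * seq nat -> V) : (N <= B)%nat ->
  (forall a b, (N < sumn a + sumn b)%nat -> w (a, b) = 0) ->
  \sum_(a <- partitions k B) \sum_(b <- partitions k B | lex_ge a b) w (a, b) =
  \sum_(r <- seq.iota 0 N.+1) \sum_(ab <- index_pairs k r) w ab.
Proof.
move=> NB w0.
have bnd (a : seq nat) r : (sumn a <= r)%nat -> all (fun x => (x <= r)%nat) a.
  elim: a => //= x a IH h; rewrite (leq_trans (leq_addr _ _) h) /= IH //.
  exact: leq_trans (leq_addl _ _) h.
pose L := [seq (a, b) | a <- partitions k B, b <- partitions k B].
have -> : \sum_(a <- partitions k B) \sum_(b <- partitions k B | lex_ge a b) w (a, b) =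
    \sum_(ab <- L | lex_ge ab.1 ab.2) w ab.
  rewrite [RHS]big_mkcond /L big_allpairs_dep /=; apply: eq_bigr => a _.
  by rewrite big_mkcond.
have uL : uniq L.
  by apply: allpairs_uniq => [||[a b] [a' b'] _ _ //]; rewrite filter_uniq // uniq_lists_upto.
transitivity (\sum_(ab <- L | lex_ge ab.1 ab.2) \sum_(r <- seq.iota 0 N.+1 | (sumn ab.1 + sumn ab.2 == r)%nat) w ab).
  apply: eq_bigr => -[a b] _; case: (leqP (sumn a + sumn b) N) => h.
    rewrite big_mkcond (bigD1_seq (sumn a + sumn b)%nat) ?iota_uniq ?mem_iota //=.
    by rewrite eqxx big1 ?addr0 // => r nr; rewrite eq_sym (negbTE nr).
  by rewrite big1 => [|r _]; rewrite (w0 a b h).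
rewrite (exchange_big_dep xpredT) //; apply: eq_big_seq => r.
rewrite mem_iota0 ltnS => rN.
rewrite -big_filter; apply: perm_big; apply: uniq_perm.
- by rewrite filter_uniq.
- rewrite filter_uniq //; apply: allpairs_uniq => [||[a b] [a' b'] _ _ //]; exact: uniq_lists_upto.
move=> [a b]; rewrite !mem_filter /L !mem_pairs !mem_partitions !mem_lists_upto /=.
case pa: (is_partition_k k a); last by rewrite /= !andbF.
case pb: (is_partition_k k b); last by rewrite /= !andbF.
case: (eqVneq (sumn a + sumn b)%nat r) => [sr|] //=; last by rewrite !andbF.
case: (lex_ge a b) => //=.
move: pa pb => /andP[-> _] /andP[-> _] /=.
have ar : all (fun x => (x <= r)%nat) a by apply: bnd; rewrite -sr leq_addr.
have br : all (fun x => (x <= r)%nat) b by apply: bnd; rewrite -sr leq_addl.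
have up l : all (fun x => (x <= r)%nat) l -> all (fun x => (x <= B)%nat) l.
  by apply: sub_all => x xr; apply: leq_trans xr (leq_trans rN NB).
by rewrite ar br !up.
Qed.

End Grouping.

(** * Assembling the coefficients of P_k *)

Lemma prodfact_neq0 k : prodfact k <> 0.
Proof.
apply/eqP; apply/prodf_neq0 => l _; apply: mulf_neq0; last apply: invr_neq0.
  by rewrite Num.Theory.pnatr_eq0 -lt0n fact_gt0.
by rewrite Num.Theory.pnatr_eq0 -lt0n fact_gt0.
Qed.

(** The normalisation of N_k cancels the factorial product, and its power of 2 turns x into x/2. *)
Lemma Nk_scaled k x a b : (prodfact k * Nk k a b * x ^ (k * k - (sumn a + sumn b)) =
  (x / 2) ^ (k * k - (sumn a + sumn b)) *
  (\sum_(s <- permutations a) \sum_(t <- permutations b) Mtilde k s t)%ring).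
Proof.
rewrite /Nk; set n := (_ - _)%nat; set S := (\sum_(s <- _) _)%ring.
have p0 := prodfact_neq0 k.
rewrite -!RinvE -RpowE -INRE /Rdiv Rpow_mult_distr pow_inv.
have p2 : INR 2 ^ n <> 0 by apply: pow_nonzero; rewrite /=; lra.
rewrite (_ : INR 2 = 2) // in p2 *.
by field.
Qed.

Lemma double_sum_perm (a b : seq nat) (g h : seq nat -> seq nat -> C) :
  (forall s t, perm_eq s a -> perm_eq t b -> g s t = h s t) ->
  (\sum_(s <- permutations a) \sum_(t <- permutations b) g s t =
   \sum_(s <- permutations a) \sum_(t <- permutations b) h s t)%ring.
Proof.
move=> H; apply: eq_big_seq => s; rewrite mem_permutations => sa.
by apply: eq_big_seq => t; rewrite mem_permutations => tb; apply: H.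
Qed.

Theorem theorem1 (k : nat) : (0 < k)%nat ->
  exists rho0 : R, 0 < rho0 /\
  forall rho : nat -> R, (forall i : nat, 0 < rho i < rho0) ->
  forall x : R,
    Pk k rho x =
    Csum (seq.iota 0 (k * k)%nat.+1) (fun r =>
      Cmult
        (Cmult (Cmult (ak k) (RtoC (prodfact k)))
           (Csum (index_pairs k r) (fun ab =>
              Cmult (Cmult (RtoC (if ab.1 == ab.2 then 1 else 2)) (bk k ab.1 ab.2))
                    (RtoC (Nk k ab.1 ab.2)))))
        (RtoC (x ^ (k * k - r)%nat))).
Proof.
move=> k0; exists (/ 48); split; first by lra.
move=> rho Hr x.
have [F [hF HF [Ht Hc]]] := bk_hol k k0.
have [c cF] : exists c, is_coefs (2 * k) (/ 48) F c by apply: coefs_exist hF; lra.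
pose tc := taylor_coeff (2 * k) (off_diag k) (bk_fun k).
have cE m : size m = (2 * k)%nat -> c m = (ak k * tc m)%C by exact: Hc cF m.
(* Large enough for the coefficient extraction, which needs 2k - 1, and for the entries of
   partitions of total at most k^2. *)
pose B := (2 * k + k * k)%nat.
rewrite (Pk_formula k rho x F c B k0 hF HF cF).
- pose g (a b : seq nat) : C := if (sumn a + sumn b <= k * k)%nat
    then (tc (a ++ b) * RtoC ((x / 2) ^ (k * k - (sumn a + sumn b))%nat * Mtilde k a b))%C else 0.
  have size_upto m n : m \in lists_upto n B -> size m = n by rewrite mem_lists_upto => /andP[/eqP].
  have -> : Csum (lists_upto (2 * k) B) (fun m => c m * (\det (coef_mx k x m))%ring)%C =
      (ak k * (\sum_(a <- lists_upto k B) \sum_(b <- lists_upto k B) g a b)%ring)%C.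
    rewrite CsumE {1}mul2n -addnn sum_lists_cat CmultE mulr_sumr; apply: eq_big_seq => a /size_upto sa.
    rewrite mulr_sumr; apply: eq_big_seq => b /size_upto sb.
    rewrite det_coef_mx // cE; last by rewrite size_cat sa sb; lia.
    rewrite /g; case: ifP => _; last by Cring.
    by rewrite RmultE RpowE; Cring.
  pose T a b : C := (\sum_(s <- permutations a) \sum_(t <- permutations b) g s t)%ring.
  have -> : (\sum_(a <- lists_upto k B) \sum_(b <- lists_upto k B) g a b)%ring =
     (\sum_(a <- partitions k B) \sum_(b <- partitions k B) T a b)%ring.
    rewrite sum_by_permutations; apply: eq_bigr => a _.
    under eq_bigr => s _ do rewrite sum_by_permutations.
    by rewrite exchange_big.
  (* The coefficient and the determinant each acquire the sign (-1)^{|s| + |t|} under the exchange,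
     so their product is symmetric. *)
  have gC s t : size s = k -> size t = k -> g t s = g s t.
    move=> ss st; rewrite /g [(sumn t + sumn s)%nat]addnC; case: ifP => // rk.
    rewrite Mtilde_swap // /tc (bk_coef_swap k k0 s t) // -/tc !RtoC_mult; ring.
  have Tz a b : (k * k < sumn a + sumn b)%nat -> T a b = 0.
    move=> h; rewrite /T (double_sum_perm _ _ _ (fun _ _ => RtoC 0)).
      by rewrite big1 // => s _; rewrite big1.
    by move=> s t /perm_sumn sa /perm_sumn tb; rewrite /g sa tb leqNgt h.
  (* All rearrangements share one Taylor coefficient, which leaves the sum of [Mtilde] that defines
     N_k. *)
  have TE a b : size a = k -> size b = k -> (sumn a + sumn b <= k * k)%nat ->
      T a b = (tc (a ++ b) * RtoC (prodfact k * Nk k a b * x ^ (k * k - (sumn a + sumn b))))%C.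
    move=> sa sb rk; rewrite Nk_scaled RtoC_mult /T.
    set Y := (x / 2) ^ _.
    rewrite (double_sum_perm _ _ _ (fun s t => tc (a ++ b) * RtoC Y * RtoC (Mtilde k s t))%C).
      rewrite Cmult_assoc rmorph_sum [RHS]CmultE mulr_sumr; apply: eq_bigr => s _.
      by rewrite rmorph_sum mulr_sumr.
    move=> s t ps pt; rewrite /g (perm_sumn ps) (perm_sumn pt) rk RtoC_mult.
    by rewrite /tc (bk_coef_perm k k0 a b s t) // -/tc -/Y Cmult_assoc.
  have sP a : a \in partitions k B -> size a = k.
    by rewrite mem_partitions => /andP[/andP[/eqP]].
  rewrite (sum_lex_fold _ (partitions k B) k T) //; last first.
    move=> a b /sP sa /sP sb; rewrite /T exchange_big /=.
    apply: double_sum_perm => s t /perm_size ss /perm_size st.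
    by apply: gC; rewrite ?ss ?st.
  rewrite (sum_index_pairs _ k B (k * k) (fun ab => (T ab.1 ab.2 *+ (if ab.1 == ab.2 then 1 else 2))%ring)).
  + rewrite CsumE CmultE mulr_sumr; apply: eq_big_seq => r.
    rewrite mem_iota0 ltnS => rk.
    rewrite CsumE !CmultE !mulr_sumr mulr_suml; apply: eq_big_seq => -[a b].
    rewrite mem_filter => /andP[/and4P[/andP[/eqP sa _] /andP[/eqP sb _] /eqP sr _] _].
    rewrite /= in sa sb sr *.
    rewrite TE ?sr // bkE -/tc mulrn_INR -!CmultE.
    move: (Nk k a b) (prodfact k) => q p; rewrite !RtoC_mult.
    have -> : RtoC (INR (if a == b then 1 else 2)%nat) = RtoC (if a == b then 1 else 2) by case: (a == b).
    move: (RtoC (if _ then _ else _)) => w; ring.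
  + by rewrite /B; apply: leq_addl.
  + by move=> a b h; rewrite /= Tz // mul0rn.
- move=> p m bp np sm; rewrite !cE ?size_permute //; congr Cmult.
  exact: (bk_coef_block k k0 p m).
- by move=> i; have := Hr i; lra.
- by rewrite /B; lia.
Qed.
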